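(* Let $H$ be a quadratic numerical semigroup with $\operatorname{embdim}(H)=n>1$, and let $K[H]$ be its semigroup ring. Then: (a) $n\leq e(H)\leq 2^{n-1}$; (b) $e(H)=n$ if and only if $I_H^*$ has a linear resolution over $S=K[x_1,\dots,x_n]$; (c) $e(H)=2^{n-1}$ if and only if $I_H^*$ is a complete intersection ideal, if and only if $I_H$ is a complete intersection ideal.
   Context: A numerical semigroup is a submonoid $H\subseteq\mathbb{N}$ with $\mathbb{N}\setminus H$ finite; $G(H)$ is its unique minimal generating set, $e(H)=\min G(H)$ and $\operatorname{embdim}(H)=|G(H)|$. $K$ is a field, $K[H]=\bigoplus_{h\in H}Kt^h\subseteq K[t]$, with maximal ideal $\mathfrak m=(t^h:h\in H\setminus\{0\})$. If $G(H)=\{a_1<\dots<a_n\}$, $S=K[x_1,\dots,x_n]$ and $I_H$ is the kernel of the $K$-algebra map $S\to K[H]$, $x_i\mapsto t^{a_i}$. For $0\neq f\in S$, $f^*$ is the homogeneous component of $f$ of least degree, and for an ideal $I$, $I^*=(f^*:0\neq f\in I)$; thus $\operatorname{gr}_{\mathfrak m}K[H]\cong S/I_H^*$. $H$ is called quadratic if $I_H^*$ is generated by homogeneous polynomials of degree $2$. An ideal $I$ is a complete intersection ideal if it is minimally generated by $\operatorname{height} I$ elements. *)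

(* Defs.v *)
From HB Require Import structures.
From mathcomp Require Import all_boot all_order all_algebra.
From mathcomp Require Import mpoly.

Set Implicit Arguments.
Unset Strict Implicit.
Unset Printing Implicit Defensive.

Import GRing.Theory.
Local Open Scope ring_scope.

Definition numerical_semigroup (H : nat -> Prop) : Prop :=
  H 0%N /\ (forall x y, H x -> H y -> H (x + y)%N) /\
  (exists N, forall m, (N <= m)%N -> H m).

Definition generates (H A : nat -> Prop) : Prop :=
  forall h, H h <-> exists (k : nat) (g : 'I_k -> nat),
                     (forall i, A (g i)) /\ h = (\sum_(i < k) g i)%N.

(* A is a minimal generating set of H (minimal w.r.t. inclusion);
   for a numerical semigroup it is unique, this is G(H) *)
Definition minimal_generating_set (H A : nat -> Prop) : Prop :=
  generates H A /\
  (forall B : nat -> Prop, (forall x, B x -> A x) -> generates H B ->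
     forall x, A x -> B x).

Definition low_deg (K : fieldType) (n : nat) (f : {mpoly K[n]}) : nat :=
  \big[minn/msize f]_(m <- msupp f) mdeg m.

Definition initial_form (K : fieldType) (n : nat) (f : {mpoly K[n]}) :
  {mpoly K[n]} := pihomog mdeg (low_deg f) f.

Definition ideal_gen (R : comNzRingType) (P : R -> Prop) (h : R) : Prop :=
  exists (k : nat) (r g : 'I_k -> R),
    (forall i, P (g i)) /\ h = \sum_(i < k) r i * g i.

Definition generated_by (R : comNzRingType) (I P : R -> Prop) : Prop :=
  forall h, I h <-> ideal_gen P h.

Definition initial_ideal (K : fieldType) (n : nat) (I : {mpoly K[n]} -> Prop)
  : {mpoly K[n]} -> Prop :=
  ideal_gen (fun g => exists f, I f /\ f <> 0 /\ g = initial_form f).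

Definition sg_map (K : fieldType) (n : nat) (a : 'I_n -> nat)
  (f : {mpoly K[n]}) : {poly K} :=
  mmap (@polyC K) (fun i => 'X^(a i)) f.

Definition sg_ideal (K : fieldType) (n : nat) (a : 'I_n -> nat)
  (f : {mpoly K[n]}) : Prop := sg_map a f = 0.

Definition quadratic_ideal (K : fieldType) (n : nat) (I : {mpoly K[n]} -> Prop)
  : Prop :=
  exists P : {mpoly K[n]} -> Prop,
    (forall p, P p -> p \is 2.-homog) /\ generated_by I P.

(* I has a linear resolution: a (finite) free resolution
   0 <- I <- S^(b 0) <- S^(b 1) <- ... <- S^(b m) <- 0
   in which the generators (the map S^(b 0) -> I) are homogeneous of one
   degree d and all the differentials are matrices of linear forms
   (i.e. the minimal graded free resolution is d-linear). Vectors are rows,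
   maps are right multiplication. *)
Definition has_linear_resolution (K : fieldType) (n : nat)
  (I : {mpoly K[n]} -> Prop) : Prop :=
  exists (d : nat) (b : nat -> nat) (g : 'cV[{mpoly K[n]}]_(b 0%N))
         (F : forall k : nat, 'M[{mpoly K[n]}]_(b k.+1, b k)),
    (forall i, g i ord0 \is d.-homog) /\
    (forall k i j, F k i j \is 1.-homog) /\
    (exists m, b m = 0%N) /\
    (forall h, I h <-> exists v : 'rV_(b 0%N), h = (v *m g) ord0 ord0) /\
    (forall v : 'rV_(b 0%N), v *m g = 0 <-> exists w, v = w *m F 0%N) /\
    (forall k (v : 'rV_(b k.+1)), v *m F k = 0 <-> exists w, v = w *m F k.+1).

Definition is_ideal (R : comNzRingType) (P : R -> Prop) : Prop :=
  P 0 /\ (forall x y, P x -> P y -> P (x + y)) /\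
  (forall r x, P x -> P (r * x)).

Definition prime_ideal (R : comNzRingType) (P : R -> Prop) : Prop :=
  is_ideal P /\ ~ P 1 /\ (forall x y, P (x * y) -> P x \/ P y).

Definition strict_subset (R : Type) (P Q : R -> Prop) : Prop :=
  (forall x, P x -> Q x) /\ exists x, Q x /\ ~ P x.

Definition prime_chain (R : comNzRingType) (C : nat -> R -> Prop) (k : nat)
  (P : R -> Prop) : Prop :=
  (forall i, (i <= k)%N -> prime_ideal (C i)) /\
  (forall i, (i < k)%N -> strict_subset (C i) (C i.+1)) /\
  (forall x, C k x <-> P x).

Definition prime_height (R : comNzRingType) (P : R -> Prop) (h : nat) : Prop :=
  (exists C, prime_chain C h P) /\
  (forall C k, prime_chain C k P -> (k <= h)%N).

Definition ideal_height (R : comNzRingType) (I : R -> Prop) (h : nat) : Prop :=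
  (exists P, prime_ideal P /\ (forall x, I x -> P x) /\ prime_height P h) /\
  (forall Q h', prime_ideal Q -> (forall x, I x -> Q x) ->
     prime_height Q h' -> (h <= h')%N).

Definition generated_by_k (R : comNzRingType) (I : R -> Prop) (k : nat) : Prop :=
  exists g : 'I_k -> R, generated_by I (fun x => exists i, x = g i).

Definition min_num_gens (R : comNzRingType) (I : R -> Prop) (k : nat) : Prop :=
  generated_by_k I k /\ (forall k', generated_by_k I k' -> (k <= k')%N).

Definition complete_intersection (R : comNzRingType) (I : R -> Prop) : Prop :=
  exists k, min_num_gens I k /\ ideal_height I k.

(* Main.v *)
(** Number the generators from 0, so that [a_0 = e].  Write [I] for the toric
    ideal and [I*] for its initial ideal.  [I*] is spanned by the monomials
    [x^u] for which some [v] of the same weight has larger degree, and by the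
    differences [x^u - x^v] of equal weight and degree.  As [x_i^e] lies in
    [I*] (it has the weight of [x_0^(a_i)]), quadraticity gives for each
    [i > 0] a relation replacing [x_i^2] by another monomial [x^(r_i)] of the
    same weight and of degree at least 2.  By convexity of the square this
    rewriting terminates, so each weight is a multiple of [e] plus a sum over a
    subset of the [n-1] generators [a_i], [i > 0]: this yields
    [e <= 2^(n-1)], with equality iff the standard (squarefree outside [x_0])
    monomials are separated by their weights.

    (c) The degree 2 parts of any generators of [I], or of [I*], span [I*_2],
    which contains the [n-1] independent square relations; and both ideals have
    height [n-1].  So each is a complete intersection iff the square relations
    span [I*_2].  Their leading terms [x_i^2] are pairwise coprime, so the
    rewriting is confluent, and this happens iff the standard monomials are
    separated by their weights.

    (b) If [e = n], then [I*] has a basis of forms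
    [x_i x_j - x_0 x_k] (or [x_i x_j]) over which each element is uniquely a
    combination with coefficients in the first variables only.  Such a
    triangular basis passes on to the syzygies, which yields a linear
    resolution.  Conversely, a linear resolution has no terms beyond step
    [n-1], so the Hilbert function, which is eventually [e], is already
    constant from degree 2 on, where it is its value [n] in degree 1 minus the
    last possible Betti number; hence [e <= n]. *)

Require Import Defs.
From HB Require Import structures.
From mathcomp Require Import all_boot all_order all_algebra zify ring.
From mathcomp Require Import ssrcomplements mpoly.
From Stdlib Require Import Classical.

Set Implicit Arguments.
Unset Strict Implicit.
Unset Printing Implicit Defensive.

Import Order.TTheory GRing.Theory Num.Theory.

Local Open Scope ring_scope.

(** * Linear functionals given by their values on monomials; ideals *)

Section MonomialFunctionals.
Context (K : fieldType) (n : nat).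
Implicit Types (phi : 'X_{1..n} -> K) (f g : {mpoly K[n]}) (m : 'X_{1..n}).

Definition msum phi f : K := \sum_(m <- msupp f) f@_m * phi m.

Lemma msum_bound phi f k : (msize f <= k)%N ->
  msum phi f = \sum_(m : 'X_{1..n < k}) f@_m * phi m.
Proof.
move=> lt_pk; rewrite /msum (big_mksub 'X_{1..n < k}) //=; first last.
- by move=> x /msize_mdeg_lt /leq_trans /(_ lt_pk) ->.
- by rewrite msupp_uniq.
rewrite big_rmcond //= => m.
by move/memN_msupp_eq0 ->; rewrite mul0r.
Qed.

Lemma msum_is_scalar phi : scalar (msum phi).
Proof.
move=> c p q; set k := maxn (msize (c *: p + q)) (maxn (msize p) (msize q)).
rewrite !(@msum_bound _ _ k) ?leq_maxl ?leq_max ?leqnn ?orbT //.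
rewrite mulr_sumr -big_split /=; apply: eq_bigr => m _.
by rewrite mcoeffD mcoeffZ mulrDl mulrA.
Qed.

HB.instance Definition _ phi :=
  GRing.isLinear.Build K {mpoly K[n]} K _ (msum phi) (msum_is_scalar phi).

Lemma msumX phi m : msum phi 'X_[m] = phi m.
Proof. by rewrite /msum msuppX big_seq1 mcoeffX eqxx mul1r. Qed.

Lemma msumZX phi c m : msum phi (c *: 'X_[m]) = c * phi m.
Proof. by rewrite linearZ /= msumX. Qed.

Lemma msum_mul_eq0 phi g :
  (forall m, msum phi ('X_[m] * g) = 0) -> forall f, msum phi (f * g) = 0.
Proof.
move=> Hm f; rewrite [f]mpolyE mulr_suml raddf_sum /= big1 // => m _.
by rewrite -scalerAl linearZ /= Hm mulr0.
Qed.

(** By linearity only monomial multiples of the generators matter. Later, a suitable [phi] tests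
    membership in an ideal or reads off one coefficient. *)
Lemma msum_ideal_gen (P : {mpoly K[n]} -> Prop) phi :
  (forall g m, P g -> msum phi ('X_[m] * g) = 0) ->
  forall f, ideal_gen P f -> msum phi f = 0.
Proof.
move=> HP f [k [r [g [Pg ->]]]]; rewrite raddf_sum /= big1 // => i _.
by apply: msum_mul_eq0 => m; apply: HP.
Qed.

Lemma mcoeff_msum m f : f@_m = msum (fun u => (u == m)%:R) f.
Proof.
rewrite [in LHS](mpolyE f) raddf_sum /=; apply: eq_bigr => u _.
by rewrite mcoeffZ mcoeffX.
Qed.

Lemma eq_msum phi psi f :
  (forall m, m \in msupp f -> phi m = psi m) -> msum phi f = msum psi f.
Proof. by move=> E; apply: eq_big_seq => m fm; rewrite E. Qed.

End MonomialFunctionals.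

Section Ideals.
Context (R : comNzRingType).
Implicit Types (P Q I : R -> Prop).

Lemma ideal_gen_in P x : P x -> ideal_gen P x.
Proof.
move=> Px; exists 1%N, (fun=> 1), (fun=> x); split=> //.
by rewrite big_ord1 mul1r.
Qed.

Lemma ideal_gen0 P : ideal_gen P 0.
Proof. by exists 0%N, (fun=> 0), (fun=> 0); split=> [[]//|]; rewrite big_ord0. Qed.

Lemma ideal_genD P x y : ideal_gen P x -> ideal_gen P y -> ideal_gen P (x + y).
Proof.
move=> [k [r [g [Pg ->]]]] [l [s [h [Ph ->]]]].
exists (k + l)%N, (fun i => match split i with inl j => r j | inr j => s j end),
  (fun i => match split i with inl j => g j | inr j => h j end); split.
  by move=> i; case: (split i).
rewrite big_split_ord /=; congr (_ + _); apply: eq_bigr => i _.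
  by rewrite (unsplitK (inl i)).
by rewrite (unsplitK (inr i)).
Qed.

Lemma ideal_genM P r x : ideal_gen P x -> ideal_gen P (r * x).
Proof.
move=> [k [s [g [Pg ->]]]]; exists k, (fun i => r * s i), g; split=> //.
by rewrite mulr_sumr; apply: eq_bigr => i _; rewrite mulrA.
Qed.

Lemma ideal_genN P x : ideal_gen P x -> ideal_gen P (- x).
Proof. by move=> Px; rewrite -mulN1r; apply: ideal_genM. Qed.

Lemma ideal_genB P x y : ideal_gen P x -> ideal_gen P y -> ideal_gen P (x - y).
Proof. by move=> Px Py; apply: ideal_genD => //; apply: ideal_genN. Qed.

Lemma ideal_gen_sum P (T : Type) (s : seq T) (A : pred T) (F : T -> R) :
  (forall i, A i -> ideal_gen P (F i)) -> ideal_gen P (\sum_(i <- s | A i) F i).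
Proof.
move=> PF; elim/big_rec: _ => [|i x Ai Px]; first exact: ideal_gen0.
by apply: ideal_genD => //; apply: PF.
Qed.

Lemma ideal_gen_sub P Q : (forall x, P x -> ideal_gen Q x) ->
  forall x, ideal_gen P x -> ideal_gen Q x.
Proof.
move=> PQ x [k [r [g [Pg ->]]]]; apply: ideal_gen_sum => i _.
by apply: ideal_genM; apply: PQ.
Qed.

Lemma ideal_gen_finP (k : nat) (g : 'I_k -> R) x :
  ideal_gen (fun y => exists i, y = g i) x <-> exists r, x = \sum_i r i * g i.
Proof.
split=> [[l [r [h [hg ->]]]]|[r ->]]; last first.
  by apply: ideal_gen_sum => i _; apply/ideal_genM/ideal_gen_in; exists i.
have [j jP] : exists j : 'I_l -> 'I_k, forall i, h i = g (j i).
  exact: (fin_all_exists hg).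
exists (fun i => \sum_(l0 | j l0 == i) r l0).
under [RHS]eq_bigr => i _ do rewrite mulr_suml.
rewrite (exchange_big_dep predT) //=; apply: eq_bigr => i _.
by rewrite (eq_bigl (pred1 (j i))) ?big_pred1_eq ?jP // => i0; rewrite eq_sym.
Qed.

End Ideals.

(** * Prime chains and heights *)

Section PrimeIdeals.
Context (R : comNzRingType).
Implicit Types (P Q : R -> Prop).

Lemma prime_idealX P x k : prime_ideal P -> P (x ^+ k) -> P x.
Proof.
move=> [[P0 [PD PM]] [P1 PP]]; elim: k => [/P1//|k IH].
by rewrite exprS => /PP[//|/IH].
Qed.

Lemma prime_kernel (S : idomainType) (phi : {rmorphism R -> S}) :
  prime_ideal (fun x => phi x = 0).
Proof.
split; first split; first exact: rmorph0.
  split=> [x y fx fy|r x fx]; first by rewrite rmorphD fx fy addr0.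
  by rewrite rmorphM fx mulr0.
split; first by rewrite rmorph1; apply/eqP/oner_neq0.
move=> x y; rewrite rmorphM => /eqP; rewrite mulf_eq0.
by case/orP => /eqP; [left|right].
Qed.

Lemma ideal_height_uniq P h h' :
  ideal_height P h -> ideal_height P h' -> h = h'.
Proof.
move=> [[Q [Qp [PQ Qh]]] min] [[Q' [Qp' [PQ' Qh']]] min'].
by apply/eqP; rewrite eqn_leq (min Q') // (min' Q).
Qed.

End PrimeIdeals.

Section KrullDimension.
Context (K : fieldType) (n : nat).

(** Dimension count: the products with exponents below [D] outnumber the monomials that can occur in
    them, so they are linearly dependent. *)
Lemma algebraic_dependence (p : 'I_n.+1 -> {mpoly K[n]}) :
  exists D (c : {ffun 'I_n.+1 -> 'I_D} -> K),
    (exists u, c u != 0) /\ \sum_u c u *: \prod_j p j ^+ u j = 0.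
Proof.
pose M := (\max_j msize (p j))%N.
(* [D] exceeds ((n+1)M + 1)^n and [B] is at most D((n+1)M + 1), hence B^n < D^(n+1). *)
pose D := ((n.+1 * M).+1 ^ n).+1.
pose B := (n.+1 * D * M).+1.
pose U := {ffun 'I_n.+1 -> 'I_D}; pose V := {ffun 'I_n -> 'I_B}.
pose mon (v : V) : 'X_{1..n} := [multinom (v i : nat) | i < n].
pose A : 'M[K]_(#|U|, #|V|) :=
  \matrix_(i, j) (\prod_l p l ^+ (enum_val i : U) l)@_(mon (enum_val j)).
have cardUV : (#|V| < #|U|)%N.
  rewrite !card_ffun !card_ord.
  have le_B : (B <= D * (n.+1 * M).+1)%N.
    by rewrite /B mulnS (mulnC n.+1 D) -mulnA -add1n leq_add2r.
  apply: (@leq_ltn_trans ((D * (n.+1 * M).+1) ^ n)%N).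
    have lexp k : (B ^ k <= (D * (n.+1 * M).+1) ^ k)%N.
      by elim: k => // k IH; rewrite !expnS leq_mul.
    exact: lexp.
  rewrite expnMn [ltnRHS]expnSr ltn_pmul2l ?expn_gt0 //.
have [c c0 cA] : exists2 c : 'rV[K]_#|U|, c != 0 & c *m A = 0.
  have /rowV0Pn[c /sub_kermxP cA c0] : kermx A != 0.
    rewrite -mxrank_eq0 mxrank_ker subn_eq0 -ltnNge.
    by apply: leq_ltn_trans (rank_leq_col A) cardUV.
  by exists c.
exists D, (fun u => c 0 (enum_rank u)); split.
  have /rV0Pn[i ci] := c0.
  by exists (enum_val i); rewrite enum_valK.
(* Every product has degree below [B], so the columns of [A] cover all of its monomials. *)
have degp (u : U) m : m \in msupp (\prod_l p l ^+ u l) -> (mdeg m < B)%N.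
  move=> /msize_mdeg_lt/leq_trans; apply.
  suff bnd (s : seq 'I_n.+1) :
      (msize (\prod_(l <- s) p l ^+ u l) <= (size s * D * M).+1)%N.
    have := bnd (index_enum 'I_n.+1).
    by rewrite /index_enum /= -enumT size_enum_ord.
  have step (f g : {mpoly K[n]}) a b :
      (msize f <= a.+1 -> msize g <= b.+1 -> msize (f * g) <= (a + b).+1)%N.
    have [->|f0] := eqVneq f 0; first by rewrite mul0r msize0.
    have [->|g0] := eqVneq g 0; first by rewrite mulr0 msize0.
    move=> fa gb; rewrite msizeM // -ltnS.
    by move: (msize f) (msize g) fa gb => x y; lia.
  elim: s => [|l s IH]; first by rewrite big_nil msize1.
  rewrite big_cons /= mulSn mulnDl; apply: (step _ _ _ _ _ IH).
  apply: (@leq_trans (u l * M).+1); last first.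
    by rewrite ltnS leq_mul2r (ltnW (ltn_ord _)) orbT.
  elim: (nat_of_ord (u l)) => [|k IHk]; first by rewrite expr0 msize1.
  rewrite exprS mulSn; apply: (step _ _ _ _ _ IHk).
  by apply: leq_trans (leqnSn _); apply: (@leq_bigmax _ (fun j => msize (p j))).
apply/mpolyP => m; rewrite raddf_sum /= mcoeff0.
have [/forallP mB|mB] := boolP [forall i, (m i < B)%N]; last first.
  apply: big1 => u _; rewrite mcoeffZ memN_msupp_eq0 ?mulr0 //.
  apply: contra mB => /degp mB; apply/forallP => i.
  by apply: leq_ltn_trans mB; rewrite mdegE (bigD1 i) //= leq_addr.
pose v : V := [ffun i => Ordinal (mB i)].
have mv : m = mon v by apply/mnmP => i; rewrite mnmE ffunE.
have := congr1 (fun M : 'rV_#|V| => M 0 (enum_rank v)) cA.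
rewrite !mxE => E; rewrite -[RHS]E.
rewrite (reindex (@enum_val U predT)) /=; last exact/onW_bij/enum_val_bij.
apply: eq_bigr => i _.
by rewrite mcoeffZ enum_valK !mxE enum_rankK mv.
Qed.

(* Coquand and Lombardi: pick p_i in C_(i+1) but not in C_i.  In a polynomial
   relation between the p_i, the terms of least degree in p_0 give, after
   division, a relation modulo C_1 between the remaining ones, and so on. *)
Lemma prime_chain_length (C : nat -> {mpoly K[n]} -> Prop) P k :
  prime_chain C k P -> (k <= n)%N.
Proof.
move=> [Cp [Cs _]]; rewrite leqNgt; apply/negP => lt_nk.
have Cp' i : (i <= n.+1)%N -> prime_ideal (C i) by move=> le; apply: Cp; lia.
have [p pP] : exists p : 'I_n.+1 -> {mpoly K[n]},
    forall i : 'I_n.+1, C i.+1 (p i) /\ ~ C i (p i).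
  apply: (@fin_all_exists _ _ (fun (i : 'I_n.+1) x => C i.+1 x /\ ~ C i x)) => i.
  by have [//|_ [x ?]] := Cs i; [apply: leq_trans lt_nk; apply: ltn_ord|exists x].
have [D [c [[u0 cu0] rel]]] := algebraic_dependence p.
pose U := {ffun 'I_n.+1 -> 'I_D}.
suff [A [A0 [Ac [Am AC]]]] : exists A : {set U}, A != set0 /\
    (forall u, u \in A -> c u != 0) /\
    (forall u v, u \in A -> v \in A -> u = v) /\
    C n.+1 (\sum_(u in A) c u *: 1).
  have [[_ [CD CM]] [C1 _]] := Cp' n.+1 (leqnn _).
  have /set0Pn[u Au] := A0; apply: C1.
  have := CM (c u)^-1%:MP _ AC.
  rewrite (big_pred1 u); last first.
    by move=> v /=; apply/idP/eqP => [Av|->//]; apply: Am.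
  by rewrite mul_mpolyC scalerA mulVf ?Ac // scale1r.
(* Invariant: the exponents in [A] agree below index [i], and the combination of their remaining
   factors lies in [C i]. *)
suff step i : (i <= n.+1)%N -> exists A : {set U}, A != set0 /\
    (forall u, u \in A -> c u != 0) /\
    (forall u v (j : 'I_n.+1), u \in A -> v \in A -> (j < i)%N -> u j = v j) /\
    C i (\sum_(u in A) c u *: \prod_(j : 'I_n.+1 | (i <= j)%N) p j ^+ u j).
  have [A [A0 [Ac [Am AC]]]] := step n.+1 (leqnn _); exists A.
  split=> //; split=> //; split=> [u v Au Av|].
    by apply/ffunP => j; apply: Am.
  rewrite (eq_bigr (fun u => c u *: 1)) // in AC => u _.
  by rewrite big_pred0 // => j; rewrite leqNgt ltn_ord.
elim: i => [_|i IH lt_i].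
  exists [set u | c u != 0]; split; first by apply/set0Pn; exists u0; rewrite inE.
  split; first by move=> u; rewrite inE.
  split=> //; have [[C0 _] _] := Cp' 0%N isT.
  rewrite (_ : \sum_(u in _) _ = 0) // -[RHS]rel [RHS](bigID (fun u => c u != 0)) /=.
  rewrite [X in _ = _ + X]big1 ?addr0; last first.
    by move=> u; rewrite negbK => /eqP->; rewrite scale0r.
  by apply: eq_bigl => u; rewrite inE.
have [A [/set0Pn[u1 Au1] [Ac [Am AC]]]] := IH (ltnW lt_i).
pose o : 'I_n.+1 := Ordinal lt_i.
have [u2 Au2 u2min] := arg_minnP (fun u : U => nat_of_ord (u o)) Au1.
exists [set u in A | u o == u2 o]; split.
  by apply/set0Pn; exists u2; rewrite inE eqxx andbT.
split; first by move=> u; rewrite inE => /andP[/Ac].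
split.
  move=> u v j; rewrite !inE => /andP[Au /eqP uo] /andP[Av /eqP vo].
  rewrite ltnS leq_eqVlt => /orP[/eqP ji|]; last exact: Am.
  by rewrite (_ : j = o) ?uo ?vo //; apply: val_inj.
have [Cop Con] := pP o.
have [[_ [CD CM]] [_ CP]] := Cp' i (ltnW lt_i).
have [[C0' [CD' CM']] _] := Cp' i.+1 lt_i.
have sub x : C i x -> C i.+1 x by case: (Cs i) => [|s _]; [lia|apply: s].
pose T (u : U) := \prod_(j : 'I_n.+1 | (i.+1 <= j)%N) p j ^+ u j.
have prodE (u : U) : \prod_(j : 'I_n.+1 | (i <= j)%N) p j ^+ u j = p o ^+ u o * T u.
  rewrite (bigD1 o) //=; congr (_ * _); apply: eq_bigl => j.
  by rewrite ltn_neqAle andbC eq_sym -val_eqE.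
pose y := \sum_(u in A | u o != u2 o) c u *: (p o ^+ (u o - u2 o).-1 * T u).
(* [u2 o] is the least exponent of [p o] in [A]. This power can be cancelled modulo the prime [C i],
   which does not contain [p o]; the remaining multiple [p o * y] lies in [C i.+1]. *)
have E : \sum_(u in A) c u *: \prod_(j : 'I_n.+1 | (i <= j)%N) p j ^+ u j =
    p o ^+ u2 o * (\sum_(u in [set u in A | u o == u2 o]) c u *: T u + p o * y).
  rewrite mulrDr (bigID (fun u : U => u o == u2 o)) /=; congr (_ + _).
    rewrite mulr_sumr; apply: eq_big => [u|u /andP[_ /eqP uo]].
      by rewrite inE.
    by rewrite prodE uo scalerAr.
  rewrite !mulr_sumr; apply: eq_bigr => u /andP[Au uo].
  rewrite prodE -!scalerAr !mulrA -exprSr -exprD; congr (_ *: (_ ^+ _ * _)).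
  have := u2min u Au; have : (u o : nat) != u2 o by [].
  by move: (nat_of_ord (u o)) (nat_of_ord (u2 o)) => a b /eqP; lia.
move: AC; rewrite E => /CP[Cx|]; first by case: Con; apply: prime_idealX (Cp' i (ltnW lt_i)) Cx.
move/sub => Cx.
have := CD' _ _ Cx (CM' (- y) _ Cop).
by rewrite mulNr (mulrC y) addrK.
Qed.

End KrullDimension.

Section Substitution.
Context (K : fieldType) (n : nat).

Lemma rmorph_mmap (S T : comNzRingType) (f : {rmorphism K -> S})
    (h : 'I_n -> S) (g : {rmorphism S -> T}) (p : {mpoly K[n]}) :
  g (mmap f h p) = mmap (g \o f) (g \o h) p.
Proof.
rewrite /mmap rmorph_sum; apply: eq_bigr => m _.
rewrite rmorphM /= /mmap1 rmorph_prod; congr (_ * _).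
by apply: eq_bigr => i _; rewrite rmorphXn.
Qed.

Lemma eq_mmap (S : nzRingType) (f f' : K -> S) (h h' : 'I_n -> S) (p : {mpoly K[n]}) :
  f =1 f' -> h =1 h' -> mmap f h p = mmap f' h' p.
Proof.
move=> ff hh; apply: eq_bigr => m _; rewrite ff; congr (_ * _).
by apply: eq_bigr => i _; rewrite hh.
Qed.

Lemma mmap_mpolyX_id (p : {mpoly K[n]}) : mmap (@mpolyC n K) (fun i => 'X_i) p = p.
Proof.
rewrite /mmap [RHS]mpolyE; apply: eq_bigr => m _.
by rewrite mmap1_id mul_mpolyC.
Qed.

Lemma prime_max0 : prime_ideal (fun p : {mpoly K[n]} => p@_0%MM = 0).
Proof. exact: (@prime_kernel _ _ (mcoeff 0%MM : {rmorphism {mpoly K[n]} -> K})). Qed.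

End Substitution.

(** * Heights of kernels of monomial parametrizations *)

Section CurveHeight.
Context (K : fieldType) (n : nat).
Context (c : 'I_n.+1 -> K) (k : 'I_n.+1 -> nat).
Local Notation S := {mpoly K[n.+1]}.

(** A coordinate c_j t^(k_j) of a curve, with ['X_ord0] in the role of the parameter t, so that the
    ring stays the same. *)
Definition curve_var j : S := c j *: 'X_[U_(ord0) *+ k j].

Definition partial_subst i : S -> S :=
  mmap (@mpolyC n.+1 K) (fun j => if (j <= i)%N then curve_var j else 'X_j).

HB.instance Definition _ i := GRing.RMorphism.copy (partial_subst i)
  (mmap (@mpolyC n.+1 K) (fun j => if (j <= i)%N then curve_var j else 'X_j)).

Lemma partial_substX i j :
  partial_subst i 'X_j = if (j <= i)%N then curve_var j else 'X_j.
Proof. by rewrite /partial_subst mmapX mmap1U. Qed.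

Lemma partial_substC i x : partial_subst i x%:MP = x%:MP.
Proof. by rewrite /partial_subst mmapC. Qed.

(** The images [curve_var j] involve only ['X_ord0], which the additional substitution fixes. Hence
    the kernels of the stages increase. *)
Lemma partial_substS i (lt_i : (i.+1 < n.+1)%N) p :
  partial_subst i.+1 p =
  mmap (@mpolyC n.+1 K)
    (fun j => if j == Ordinal lt_i then curve_var j else 'X_j) (partial_subst i p).
Proof.
rewrite /partial_subst (rmorph_mmap _ _ (mmap _ _)); apply: eq_mmap => [x|j] /=.
  by rewrite mmapC.
case: (leqP j i) => ji.
  rewrite leqW // /curve_var mmapZ mmapX mul_mpolyC; congr (_ *: _).
  rewrite /mmap1 (bigD1 ord0) //= big1 ?mulr1; last first.
    by move=> l; rewrite eq_sym => /negbTE l0; rewrite mulmnE mnm1E l0 expr0.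
  by rewrite mulmnE mnm1E eqxx mul1n mpolyXn.
rewrite mmapX mmap1U -val_eqE /= eqn_leq ji andbT.
by case: ifP.
Qed.

Hypotheses (c0 : c ord0 = 1) (k0 : (0 < k ord0)%N).
Hypothesis ck : forall j, k j = 0%N -> c j = 0.

(* The kernels of the partial substitutions form a chain of length n ending at
   the ideal; the upper bound comes from appending the maximal ideal at 0. *)
Lemma curve_height :
  prime_height (fun p : S => mmap (@mpolyC n.+1 K) curve_var p = 0) n.
Proof.
have last_subst p : mmap (@mpolyC n.+1 K) curve_var p = partial_subst n p.
  by apply: eq_mmap => // j; rewrite -ltnS ltn_ord.
have sub0 p : partial_subst n p = 0 -> p@_0%MM = 0.
  move=> E; transitivity (mcoeff 0%MM (partial_subst n p)); last first.
    by rewrite E mcoeff0.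
  rewrite /partial_subst (rmorph_mmap _ _ (mcoeff 0%MM)).
  rewrite -[p in LHS]mmap_mpolyX_id (rmorph_mmap _ _ (mcoeff 0%MM)).
  apply: eq_mmap => // j /=; rewrite -ltnS ltn_ord mcoeffX mnm1_eq0.
  rewrite mcoeffZ mcoeffX; case: (posnP (k j)) => [/ck->|kj]; first by rewrite mul0r.
  rewrite [_ == _](_ : _ = false) ?mulr0 //; apply/negP => /eqP /mnmP /(_ ord0).
  by rewrite mulmnE mnm1E mnm0E mul1n => kj0; rewrite kj0 in kj.
split.
  exists (fun i p => partial_subst i p = 0); split; last split.
  - by move=> i _; apply: (@prime_kernel _ _ (partial_subst i)).
  - move=> i lt_i; split=> [p pi|].
      by rewrite (@partial_substS _ (lt_i : (i.+1 < n.+1)%N)) pi rmorph0.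
    pose o := Ordinal (lt_i : (i.+1 < n.+1)%N).
    (* On the curve both terms become c_o^(k_0) t^(k_0 k_o). Before ['X_o] is substituted, its power
       still has coefficient 1. *)
    exists ('X_o ^+ k ord0 - c o ^+ k ord0 *: 'X_ord0 ^+ k o); split.
      rewrite rmorphB -mul_mpolyC rmorphM !rmorphXn /= !partial_substX leqnn.
      rewrite partial_substC /curve_var c0 !scale1r exprZn !mpolyXn -rmorphXn.
      rewrite mul_mpolyC (_ : (_ *+ _)%MM = (U_(ord0) *+ k ord0 *+ k o)%MM).
        by rewrite subrr.
      by apply/mnmP => j; rewrite !mulmnE -!mulnA (mulnC (k o)).
    rewrite rmorphB -mul_mpolyC rmorphM !rmorphXn /= !partial_substX ltnn.
    rewrite partial_substC /curve_var c0 !scale1r !mpolyXn -rmorphXn.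
    move=> /(congr1 (mcoeff (U_(o) *+ k ord0)%MM)).
    rewrite mcoeffB mcoeffCM !mcoeffX eqxx mcoeff0.
    rewrite [_ == _](_ : _ = false) ?mulr0 ?subr0; first exact/eqP/oner_neq0.
    apply/negP => /eqP/mnmP/(_ o); rewrite !mulmnE !mnm1E eqxx.
    by rewrite (_ : (ord0 == o) = false) // !mul0n mul1n => E; move: k0; rewrite -E.
  - by move=> p; rewrite last_subst.
move=> C l [Cp [Cs Cl]].
suff : prime_chain (fun i => if (i <= l)%N then C i else fun p : S => p@_0%MM = 0)
   l.+1 (fun p : S => p@_0%MM = 0).
  by move/prime_chain_length; rewrite ltnS.
split; last split.
- move=> i _; case: ifP => [/Cp//|_]; exact: prime_max0.
- move=> i; rewrite ltnS => le_il; rewrite le_il.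
  case: (ltnP i l) => [/Cs//|le_li].
  have -> : i = l by apply/eqP; rewrite eqn_leq le_il.
  split=> [p /Cl|]; first by rewrite last_subst => /sub0.
  exists 'X_ord0; split; first by rewrite mcoeffX mnm1_eq0.
  move/Cl; rewrite last_subst partial_substX leq0n /curve_var c0 scale1r.
  move/(congr1 (mcoeff (U_(ord0) *+ k ord0)%MM)); rewrite mcoeffX eqxx mcoeff0.
  exact/eqP/oner_neq0.
- by move=> p; rewrite ltnn.
Qed.

End CurveHeight.

(** * Linear resolutions from triangular bases *)

Section PartialDegree.
Context (K : fieldType) (n : nat).
Implicit Types (f g : {mpoly K[n]}) (j : 'I_n) (D E c d : nat).

Definition deg_in_le j D f := forall m, m \in msupp f -> (m j <= D)%N.

Definition in_first c f := forall j, (c < j)%N -> deg_in_le j 0 f.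

Lemma deg_in_le0 j D : deg_in_le j D 0.
Proof. by move=> m; rewrite msupp0. Qed.

Lemma deg_in_leW j D E f : (D <= E)%N -> deg_in_le j D f -> deg_in_le j E f.
Proof. by move=> DE fD m /fD mD; apply: leq_trans DE. Qed.

Arguments deg_in_leW {j D E f}.

Lemma deg_in_leD j D f g :
  deg_in_le j D f -> deg_in_le j D g -> deg_in_le j D (f + g).
Proof.
by move=> fD gD m /msuppD_le; rewrite mem_cat => /orP[/fD|/gD].
Qed.

Lemma deg_in_leZ j D a f : deg_in_le j D f -> deg_in_le j D (a *: f).
Proof. by move=> fD m /msuppZ_le/fD. Qed.

Lemma deg_in_leN j D f : deg_in_le j D f -> deg_in_le j D (- f).
Proof. by rewrite -scaleN1r; apply: deg_in_leZ. Qed.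

Lemma deg_in_leM j D E f g :
  deg_in_le j D f -> deg_in_le j E g -> deg_in_le j (D + E) (f * g).
Proof.
move=> fD gE m /msuppM_le/allpairsP[/= [u v] [/= /fD uD /gE vE ->]].
by rewrite mnmDE leq_add.
Qed.

Lemma deg_in_leX j (m : 'X_{1..n}) : deg_in_le j (m j) 'X_[m].
Proof. by move=> u; rewrite msuppX inE => /eqP->. Qed.

Arguments deg_in_leX : clear implicits.

Lemma deg_in_le_sum j D (I : Type) (s : seq I) (P : pred I) (F : I -> {mpoly K[n]}) :
  (forall i, P i -> deg_in_le j D (F i)) -> deg_in_le j D (\sum_(i <- s | P i) F i).
Proof.
move=> FD; elim/big_rec: _ => [|i x Pi xD]; first exact: deg_in_le0.
by apply: deg_in_leD => //; apply: FD.
Qed.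

Lemma deg_in_le_msize j f : deg_in_le j (msize f) f.
Proof.
move=> m /msize_mdeg_lt; apply: leq_trans.
by rewrite mdegE (bigD1 j) //= leqW // leq_addr.
Qed.

Lemma deg_in_le_pihomog j D d f : deg_in_le j D f -> deg_in_le j D (pihomog mdeg d f).
Proof.
move=> fD; rewrite /pihomog big_seq_cond; apply: deg_in_le_sum => m /andP[fm _].
by apply/deg_in_leZ/(deg_in_leW (fD m fm))/deg_in_leX.
Qed.

Lemma deg_in_le_mulX j D f : deg_in_le j D ('X_j * f) ->
  if D is D'.+1 then deg_in_le j D' f else f = 0.
Proof.
move=> fD; have fD' m : m \in msupp f -> (m j < D)%N.
  move=> fm; have := fD (U_(j) + m)%MM.
  rewrite !mcoeff_msupp (mulrC 'X_j) mcoeffMX -mcoeff_msupp => /(_ fm).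
  by rewrite mnmDE mnm1E eqxx.
case: D fD fD' => [|D] _ fD' //.
by apply: msuppnil0; case: (msupp f) fD' => // m s /(_ m (mem_head _ _)).
Qed.

(** The monomials divisible by ['X_j] are separated from the others. As only ['X_j] is divided out,
    degree bounds in every variable pass to both parts. *)
Lemma deg_in_le_split j D f : deg_in_le j D.+1 f ->
  exists g h, [/\ f = 'X_j * g + h, deg_in_le j D g, deg_in_le j 0 h &
    forall i E, deg_in_le i E f -> deg_in_le i E g /\ deg_in_le i E h].
Proof.
move=> fD.
exists (\sum_(m <- msupp f | (0 < m j)%N) f@_m *: 'X_[m - U_(j)]).
exists (\sum_(m <- msupp f | ~~ (0 < m j)%N) f@_m *: 'X_[m]); split.
- rewrite {1}[f]mpolyE (bigID (fun m : 'X_{1..n} => 0 < m j)%N) /=; congr (_ + _).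
  rewrite mulr_sumr; apply: eq_bigr => m mj.
  by rewrite -scalerAr -mpolyXD addmC submK // lep1mP -lt0n.
- rewrite big_seq_cond; apply: deg_in_le_sum => m /andP[fm mj].
  apply/deg_in_leZ; apply: (deg_in_leW _ (deg_in_leX _ _)).
  by rewrite mnmBE mnm1E eqxx leq_subLR add1n; apply: fD.
- apply: deg_in_le_sum => m mj; apply/deg_in_leZ.
  by apply: (deg_in_leW _ (deg_in_leX _ _)); rewrite leqNgt.
- move=> i E fE; split; rewrite big_seq_cond; apply: deg_in_le_sum => m /andP[fm mj].
    apply/deg_in_leZ; apply: (deg_in_leW _ (deg_in_leX _ _)).
    by rewrite mnmBE (leq_trans (leq_subr _ _)) // fE.
  by apply/deg_in_leZ; apply: (deg_in_leW _ (deg_in_leX _ _)); apply: fE.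
Qed.

Lemma pihomogMl d e f g : g \is e.-homog ->
  pihomog mdeg (d + e) (f * g) = pihomog mdeg d f * g.
Proof.
move=> ge; rewrite [f]mpolyE mulr_suml !raddf_sum /= mulr_suml.
apply: eq_bigr => m _; rewrite -scalerAl !linearZ /= -scalerAl pihomogX.
congr (_ *: _); case: eqP => [<-|/eqP ne].
  by rewrite pihomog_dE // dhomogM // dhomogX.
rewrite mul0r (@pihomog_ne0 _ _ _ (mdeg m + e)) ?dhomogM ?dhomogX //.
by rewrite eqn_add2r.
Qed.

End PartialDegree.

Arguments deg_in_leW {K n j D E f}.
Arguments deg_in_leX {K n}.
Arguments deg_in_le_msize {K n}.
Arguments deg_in_leM {K n j D E f g}.

Section TriangularRepresentations.
Context (K : fieldType) (n r b : nat).
Local Notation S := {mpoly K[n]}.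
Implicit Types (c : 'I_r -> nat) (h : 'M[S]_(r, b)).

(* Row i of h may be multiplied by polynomials in the variables of index at most
   c i; multiplying it by another variable can be rewritten in that form.  This
   is the linear case of a Pommaret basis. *)
Definition free_rep c h := forall p : 'rV[S]_r,
  (forall i, in_first (c i) (p 0 i)) -> p *m h = 0 -> p = 0.

Definition linear_rep c h := forall i (j : 'I_n), (c i < j)%N ->
  exists p : 'rV[S]_r,
    (forall l, p 0 l \is 1.-homog /\ in_first (c l) (p 0 l)) /\
    'X_j *: row i h = p *m h.

End TriangularRepresentations.

Section SyzygyStep.
Context (K : fieldType) (n r b : nat).
Local Notation S := {mpoly K[n]}.
Context (c : 'I_r -> nat) (h : 'M[S]_(r, b)).
Context (p : 'I_r * 'I_n -> 'rV[S]_r).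
Local Notation A := [set x : 'I_r * 'I_n | (c x.1 < x.2)%N].
Hypothesis p_hom : forall x l, x \in A -> p x 0 l \is 1.-homog.
Hypothesis p_first : forall x l, x \in A -> in_first (c l) (p x 0 l).
Hypothesis pE : forall x, x \in A -> 'X_(x.2) *: row x.1 h = p x *m h.

(* The syzygy x_j e_i - p, of class j, for each row i and each j > c i. *)
Definition syz_entry (x : 'I_r * 'I_n) l : S := 'X_(x.2) *+ (x.1 == l) - p x 0 l.

Definition syz_mx : 'M[S]_(#|A|, r) := \matrix_(i, l) syz_entry (enum_val i) l.

Definition syz_class (i : 'I_#|A|) : nat := (enum_val i).2.

Lemma mul_syz_mx (w : 'rV_#|A|) (W : 'I_r * 'I_n -> S) l :
  (forall i, w 0 i = W (enum_val i)) ->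
  (w *m syz_mx) 0 l = \sum_(x in A) W x * syz_entry x l.
Proof.
move=> wW; rewrite mxE [RHS]big_enum_val /=.
by apply: eq_bigr => i _; rewrite mxE wW.
Qed.

Lemma syz_mx_homog i l : syz_mx i l \is 1.-homog.
Proof.
rewrite mxE /syz_entry rpredB ?p_hom ?enum_valP // rpredMn //.
by rewrite dhomogX /= mdeg1.
Qed.

Lemma syz_mx_mul : syz_mx *m h = 0.
Proof.
apply/row_matrixP => i; rewrite row_mul row0.
move xi: (enum_val i) (enum_valP i) => x xA.
have -> : row i syz_mx = 'X_(x.2) *: delta_mx 0 x.1 - p x.
  apply/rowP => l; rewrite !mxE xi /syz_entry; congr (_ - _).
  by rewrite eqxx /= eq_sym; case: eqP => _; rewrite ?mulr1 ?mulr0 ?mulr0n.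
by rewrite mulmxBl -scalemxAl -rowE pE // subrr.
Qed.

Lemma syz_reduce (v : 'rV[S]_r) : exists w : 'rV_#|A|,
  (forall i, in_first (syz_class i) (w 0 i)) /\
  (forall l, in_first (c l) ((v - w *m syz_mx) 0 l)).
Proof.
suff red k : forall v : 'rV[S]_r,
    (forall l (j : 'I_n), (k <= j)%N -> (c l < j)%N -> deg_in_le j 0 (v 0 l)) ->
    exists w : 'rV_#|A|,
    (forall i, in_first (syz_class i) (w 0 i)) /\
    (forall l, in_first (c l) ((v - w *m syz_mx) 0 l)).
  by apply: (red n) => l j; rewrite leqNgt ltn_ord.
elim: k => [|k IHk] {}v vk.
  exists 0; split=> [i j _|l j lj]; first by rewrite mxE; apply: deg_in_le0.
  by rewrite mul0mx subr0; apply: vk.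
have [lt_kn|le_nk] := ltnP k n; last first.
  by apply: IHk => l j le_kj; have := leq_trans le_nk le_kj; rewrite leqNgt ltn_ord.
pose J := Ordinal lt_kn.
suff redD D : forall v : 'rV[S]_r,
    (forall l (j : 'I_n), (k < j)%N -> (c l < j)%N -> deg_in_le j 0 (v 0 l)) ->
    (forall l, (c l < J)%N -> deg_in_le J D (v 0 l)) ->
    exists w : 'rV_#|A|,
    (forall i, in_first (syz_class i) (w 0 i)) /\
    (forall l, in_first (c l) ((v - w *m syz_mx) 0 l)).
  apply: (redD (\max_l msize (v 0%R l))%N v vk) => l _.
  apply: (deg_in_leW _ (deg_in_le_msize _ _)).
  exact: (leq_bigmax (F := fun l => msize (v 0 l)) l).
elim: D {v vk} => [|D IHD] v vk vJ.
  apply: IHk => l j; rewrite leq_eqVlt => /orP[/eqP kj|/vk]; last exact.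
  by rewrite (_ : j = J) => [/vJ//|]; apply: val_inj.
have [g gP] : exists g : 'I_r -> S * S, forall l, (c l < J)%N ->
    [/\ v 0 l = 'X_J * (g l).1 + (g l).2, deg_in_le J D (g l).1,
        deg_in_le J 0 (g l).2 &
        forall i E, deg_in_le i E (v 0 l) ->
          deg_in_le i E (g l).1 /\ deg_in_le i E (g l).2].
  apply: (@fin_all_exists _ _ (fun l x => (c l < J)%N ->
    [/\ v 0 l = 'X_J * x.1 + x.2, deg_in_le J D x.1, deg_in_le J 0 x.2 &
        forall i E, deg_in_le i E (v 0 l) ->
          deg_in_le i E x.1 /\ deg_in_le i E x.2])) => l.
  case: (ltnP (c l) J) => [/vJ/deg_in_le_split[x [y xy]]|_]; first by exists (x, y).
  by exists (0, 0).
pose W (x : 'I_r * 'I_n) := if x.2 == J then (g x.1).1 else 0.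
pose w1 : 'rV_#|A| := \row_i W (enum_val i).
have w1E l : (w1 *m syz_mx) 0 l =
    'X_J * (g l).1 *+ (c l < J)%N -
    \sum_(x in A | x.2 == J) (g x.1).1 * p x 0 l.
  rewrite (@mul_syz_mx _ W) => [|i]; last by rewrite mxE.
  under eq_bigr => x _ do rewrite mulrBr.
  rewrite sumrB; congr (_ - _); last first.
    rewrite [RHS]big_mkcondr; apply: eq_bigr => x _.
    by rewrite /W; case: ifP => _; rewrite ?mul0r.
  rewrite (bigID (pred1 (l, J))) /= [X in _ + X]big1 ?addr0; last first.
    move=> [x1 x2] /andP[_]; rewrite xpair_eqE /W /=.
    case: (x1 == l); case: (x2 == J) => //= _; rewrite ?mul0r ?mulr0n ?mulr0 //.
  case: (boolP (c l < J)%N) => lJ.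
    rewrite (big_pred1 (l, J)) ?eqxx /W /= ?eqxx 1?mulrC //.
    by move=> x; rewrite /= !inE andb_idl // => /eqP->.
  rewrite big_pred0 // => x; rewrite /= !inE.
  by case: eqP => [->|]; rewrite ?andbF //= (negbTE lJ).
have [|l lJ|w [wc wn]] := IHD (v - w1 *m syz_mx).
- move=> l j kj lj; rewrite mxE [X in _ + X]mxE w1E opprB addrA addrAC.
  apply: deg_in_leD; last first.
    apply: deg_in_le_sum => x /andP[xA /eqP xJ].
    have xJ' : (c x.1 < J)%N by move: xA; rewrite inE xJ.
    have [_ _ _ /(_ j 0%N) []] := gP _ xJ'.
      by apply: vk => //; apply: ltn_trans kj.
    by move=> gj _; apply: (@deg_in_leM _ _ j 0 0) => //; apply: p_first.
  case: (boolP (c l < J)%N) => lJ; last by rewrite subr0; apply: vk.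
  have [vE _ _ /(_ j 0%N (vk _ _ kj lj)) [_ ?]] := gP _ lJ.
  by rewrite vE mulr1n addrC addKr.
- rewrite mxE [X in _ + X]mxE w1E opprB addrA addrAC.
  apply: deg_in_leD; last first.
    apply: deg_in_le_sum => x /andP[xA /eqP xJ].
    have xJ' : (c x.1 < J)%N by move: xA; rewrite inE xJ.
    have [_ gJ _ _] := gP _ xJ'.
    by rewrite -[D]addn0; apply: deg_in_leM => //; apply: p_first.
  have [-> _ gJ _] := gP _ lJ.
  by rewrite lJ mulr1n addrC addKr; apply: (deg_in_leW _ gJ).
exists (w + w1); split=> [i j ij|l].
  rewrite mxE; apply: deg_in_leD; first exact: wc.
  rewrite mxE /W; case: eqP => [iJ|_]; last exact: deg_in_le0.
  have := enum_valP i; rewrite inE iJ => lJ.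
  rewrite /syz_class iJ in ij.
  have [_ _ _ /(_ j 0%N) []//] := gP _ lJ.
  by apply: vk => //; apply: ltn_trans ij.
by rewrite mulmxDl opprD addrA addrAC; apply: wn.
Qed.

Hypothesis h_free : free_rep c h.

(** The remainder left by [syz_reduce] is still a syzygy of [h], and being in reduced form it
    vanishes by [h_free]. *)
Lemma syz_mx_exact (v : 'rV[S]_r) : v *m h = 0 ->
  exists w : 'rV_#|A|, (forall i, in_first (syz_class i) (w 0 i)) /\ v = w *m syz_mx.
Proof.
move=> vh; have [w [wc wn]] := syz_reduce v; exists w; split=> //.
apply/eqP; rewrite -subr_eq0; apply/eqP; apply: h_free wn _.
by rewrite mulmxBl vh -mulmxA syz_mx_mul mulmx0 subr0.
Qed.

(** A variable times a syzygy is again a syzygy, so [syz_mx_exact] provides multipliers of the right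
    classes. Passing to their degree 1 parts makes them linear. *)
Lemma syz_mx_linear : linear_rep syz_class syz_mx.
Proof.
move=> i j ij.
have [|w [wc wE]] := @syz_mx_exact ('X_j *: row i syz_mx).
  by rewrite -scalemxAl -row_mul syz_mx_mul row0 scaler0.
exists (map_mx (pihomog mdeg 1) w); split=> [l|].
  rewrite mxE pihomogP; split=> // l' ll'; apply: deg_in_le_pihomog.
  exact: wc.
apply/rowP => l; have := congr1 (fun M : 'rV_r => pihomog mdeg 2 (M 0 l)) wE.
rewrite !mxE pihomog_dE; last first.
  rewrite (_ : 2%N = 1 + 1)%N // dhomogM ?dhomogX /= ?mdeg1 //.
  by have := syz_mx_homog i l; rewrite mxE.
move=> ->; rewrite raddf_sum /=; apply: eq_bigr => x _.
by rewrite [in RHS]mxE -(@pihomogMl _ _ 1 1) // syz_mx_homog.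
Qed.

(** Descent from the largest variable [J] whose entries are not yet known to vanish. The relation at
    [l] equates ['X_J * Q (l, J)] with terms whose degree in [J] is no larger than that of the
    entries [Q (l', J)], so a common bound on these degrees can be lowered until the entries
    vanish. *)
Lemma syz_mx_free : free_rep syz_class syz_mx.
Proof.
move=> q qc qs.
pose Q (x : 'I_r * 'I_n) := \sum_(i | enum_val i == x) q 0 i.
have qQ i : q 0 i = Q (enum_val i).
  by rewrite /Q (big_pred1 i) // => i'; rewrite /= (inj_eq enum_val_inj).
have QA (x : 'I_r * 'I_n) : x \notin A -> Q x = 0.
  move=> xA; rewrite /Q big1 // => i /eqP xi.
  by rewrite -xi enum_valP in xA.
have Qc (x : 'I_r * 'I_n) : in_first x.2 (Q x).
  move=> j xj; apply: deg_in_le_sum => i /eqP xi; apply: qc.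
  by rewrite /syz_class xi.
have rel l : \sum_x Q x * syz_entry x l = 0.
  have := congr1 (fun M : 'rV_r => M 0 l) qs.
  rewrite (mul_syz_mx _ qQ) mxE big_mkcond /= => E; rewrite -[RHS]E.
  by apply: eq_bigr => x _; case: ifPn => // /QA->; rewrite mul0r.
suff Q0 k : forall x : 'I_r * 'I_n, (n <= x.2 + k)%N -> Q x = 0.
  by apply/rowP => i; rewrite mxE qQ (Q0 n) // leq_addl.
elim: k => [|k IHk] x xk; first by have := ltn_ord x.2; lia.
have [|xk'] := leqP n ((x.2 : nat) + k)%N; first exact: IHk.
case: x xk xk' => a J /= xk xk'.
suff QJ D : (forall l, deg_in_le J D (Q (l, J))) -> forall l, Q (l, J) = 0.
  apply: (QJ (\max_l msize (Q (l, J)))%N) => l.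
  apply: (deg_in_leW _ (deg_in_le_msize _ _)).
  exact: (leq_bigmax (F := fun l => msize (Q (l, J))) l).
have deg_step E l : (c l < J)%N -> (forall l, deg_in_le J E (Q (l, J))) ->
    deg_in_le J E ('X_J * Q (l, J)).
  move=> lJ QD.
  have QD0 (x : 'I_r * 'I_n) : deg_in_le J E (Q x) /\ (x.2 != J -> deg_in_le J 0 (Q x)).
    case: x => x1 x2 /=; case: (ltngtP x2 J) => x2J.
    - have Q0 := Qc (x1, x2) J x2J; split=> //; exact: (deg_in_leW _ Q0).
    - by rewrite IHk /=; [split=> [|_]; exact: deg_in_le0|lia].
    - by rewrite (val_inj x2J) eqxx; split.
  have := rel l; under eq_bigr => x _ do rewrite mulrBr.
  rewrite sumrB => /eqP; rewrite subr_eq0 => /eqP.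
  rewrite (bigD1 (l, J)) //= eqxx mulr1n mulrC => /(canRL (addrK _)) ->.
  apply: deg_in_leD.
    apply: deg_in_le_sum => x _; have [xA|/QA->] := boolP (x \in A); last first.
      by rewrite mul0r; apply: deg_in_le0.
    rewrite -[E]addn0; apply: deg_in_leM; first by case: (QD0 x).
    exact: p_first.
  apply/deg_in_leN/deg_in_le_sum => -[x1 x2] xlJ /=.
  case: eqP => [x1l|_]; last by rewrite mulr0n mulr0; apply: deg_in_le0.
  move: xlJ; rewrite xpair_eqE x1l eqxx /= => x2J.
  apply: deg_in_leW (leq0n _) _; rewrite mulr1n -[0%N]addn0.
  apply: deg_in_leM; first by case: (QD0 (l, x2)) => _; apply.
  move=> m; rewrite msuppX inE => /eqP->; rewrite mnm1E.
  by rewrite (negbTE x2J).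
elim: D => [|D IHD] QD l; (case: (boolP (c l < J)%N) => lJ;
  last by apply: QA; rewrite inE).
  exact: (deg_in_le_mulX (deg_step _ _ lJ QD)).
apply: IHD => l'; case: (boolP (c l' < J)%N) => lJ'.
  exact: (deg_in_le_mulX (deg_step _ _ lJ' QD)).
by rewrite QA ?inE //; apply: deg_in_le0.
Qed.

End SyzygyStep.

Section LinearResolution.
Context (K : fieldType) (n : nat).
Local Notation S := {mpoly K[n]}.

(** By the last clause the least class rises strictly from one syzygy matrix to the next, which ends
    the iteration. *)
Lemma syzygies_linear r b (c : 'I_r -> nat) (h : 'M[S]_(r, b)) :
  free_rep c h -> linear_rep c h ->
  exists r' (c' : 'I_r' -> nat) (s : 'M[S]_(r', r)),
    [/\ free_rep c' s, linear_rep c' s, forall i j, s i j \is 1.-homog,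
        forall v : 'rV_r, v *m h = 0 <-> exists w, v = w *m s &
        forall i, (c' i < n)%N /\ exists j, (c j < c' i)%N].
Proof.
move=> hf hl.
have [p pP] : exists p : 'I_r * 'I_n -> 'rV[S]_r, forall x : 'I_r * 'I_n, (c x.1 < x.2)%N ->
    (forall l, p x 0 l \is 1.-homog /\ in_first (c l) (p x 0 l)) /\
    'X_(x.2) *: row x.1 h = p x *m h.
  apply: (@fin_all_exists _ _ (fun (x : 'I_r * 'I_n) (q : 'rV[S]_r) => (c x.1 < x.2)%N ->
    (forall l, q 0 l \is 1.-homog /\ in_first (c l) (q 0 l)) /\
    'X_(x.2) *: row x.1 h = q *m h)) => x.
  case: (boolP (c x.1 < x.2)%N) => [/hl[q qP]|_]; first by exists q.
  by exists 0.
have ph (x : 'I_r * 'I_n) l : x \in [set x : 'I_r * 'I_n | (c x.1 < x.2)%N] -> p x 0 l \is 1.-homog.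
  by rewrite inE => /pP[/(_ l)[]].
have pf (x : 'I_r * 'I_n) l : x \in [set x : 'I_r * 'I_n | (c x.1 < x.2)%N] -> in_first (c l) (p x 0 l).
  by rewrite inE => /pP[/(_ l)[]].
have pE (x : 'I_r * 'I_n) : x \in [set x : 'I_r * 'I_n | (c x.1 < x.2)%N] ->
    'X_(x.2) *: row x.1 h = p x *m h.
  by rewrite inE => /pP[].
exists _, (@syz_class n r c), (syz_mx c p); split.
- exact: syz_mx_free.
- exact: (syz_mx_linear ph pf pE hf).
- exact: syz_mx_homog.
- move=> v; split; first by case/(syz_mx_exact pf pE hf) => w [_ ->]; exists w.
  by case=> w ->; rewrite -mulmxA (syz_mx_mul pE) mulmx0.
- move=> i; split; first exact: ltn_ord.
  by have := enum_valP i; rewrite inE; exists (enum_val i).1.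
Qed.

(** Induction on a bound [m] for the distance of the classes to [n]. At [m = 0] every polynomial has
    the required form, so [h_free] style freeness means that there are no syzygies left. *)
Lemma linear_resolution_of m r b (c : 'I_r -> nat) (h : 'M[S]_(r, b)) :
  free_rep c h -> linear_rep c h -> (forall i, n <= c i + m)%N ->
  exists (B : nat -> nat) (F0 : 'M[S]_(B 0%N, r))
    (F : forall k, 'M[S]_(B k.+1, B k)),
    [/\ (forall i j, F0 i j \is 1.-homog) /\ (forall k i j, F k i j \is 1.-homog),
        exists l, B l = 0%N,
        forall v : 'rV_r, v *m h = 0 <-> exists w, v = w *m F0,
        forall v : 'rV_(B 0%N), v *m F0 = 0 <-> exists w, v = w *m F 0%N &
        forall k (v : 'rV_(B k.+1)), v *m F k = 0 <-> exists w, v = w *m F k.+1].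
Proof.
elim: m r b c h => [|m IH] r b c h hf hl cm.
  exists (fun=> 0%N), 0, (fun=> 0); split=> //.
  - by split=> [[i]|k [i]].
  - move=> v; split=> [vh|[w ->]]; last by rewrite mulmx0 mul0mx.
    exists 0; rewrite mulmx0; apply: hf vh => i j.
    by rewrite ltnNge (leq_trans (ltnW (ltn_ord j))) // -[c i]addn0.
  - by move=> v; split=> _; [exists 0; rewrite !thinmx0|rewrite [v]thinmx0 mul0mx].
  - by move=> k v; split=> _; [exists 0; rewrite !thinmx0|rewrite [v]thinmx0 mul0mx].
have [r' [c' [s [sf sl sh sE sc]]]] := syzygies_linear hf hl.
have cm' i : (n <= c' i + m)%N.
  by have [_ [j]] := sc i; have := cm j; lia.
have [B [F0 [F [[F0h Fh] [l Bl] E0 E1 E2]]]] := IH _ _ _ _ sf sl cm'.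
pose B' k := if k is k'.+1 then B k' else r'.
pose F' k : 'M[S]_(B' k.+1, B' k) :=
  match k with 0%N => F0 | k'.+1 => F k' end.
exists B', s, F'; split=> //.
- by split=> // -[|k] i j; [apply: F0h|apply: Fh].
- by exists l.+1.
- by case=> [|k] v; [apply: E1|apply: E2].
Qed.

End LinearResolution.

(** * Betti numbers and Hilbert functions *)

Section LinearComplex.
Context (K : fieldType) (n : nat).
Local Notation S := {mpoly K[n]}.
Local Notation lift := (map_mx (@mpolyC n K)).

Lemma dhomog1E (f : S) : f \is 1.-homog -> f = \sum_i f@_U_(i) *: 'X_i.
Proof.
move=> /dhomogP f1; apply/mpolyP => m; rewrite raddf_sum /=.
under eq_bigr => i _ do rewrite mcoeffZ mcoeffX.
have [/eqP/mdeg1P[i /eqP->]|m1] := eqVneq (mdeg m) 1%N.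
  rewrite (bigD1 i) //= eqxx mulr1 big1 ?addr0 // => j ji.
  by rewrite eq_mnm1 (negbTE ji) mulr0.
rewrite memN_msupp_eq0; last by apply: contra m1 => /f1->.
by rewrite big1 // => i _; case: (U_(i)%MM =P m) m1 => [<-|_ _]; rewrite ?mdeg1 ?mulr0.
Qed.

Definition restrict (A : {set 'I_n}) : S -> S :=
  mmap (@mpolyC n K) (fun i => if i \in A then 'X_i else 0).

HB.instance Definition _ A := GRing.RMorphism.copy (restrict A)
  (mmap (@mpolyC n K) (fun i => if i \in A then 'X_i else 0)).

Lemma restrictX A i : restrict A 'X_i = if i \in A then 'X_i else 0.
Proof. by rewrite /restrict mmapX mmap1U. Qed.

Lemma restrictC A x : restrict A x%:MP = x%:MP.
Proof. by rewrite /restrict mmapC. Qed.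

Lemma restrictT f : restrict setT f = f.
Proof.
rewrite -[RHS]mmap_mpolyX_id; apply: eq_mmap => // i; by rewrite inE.
Qed.

Lemma restrict_lift A p (u : 'rV[K]_p) : map_mx (restrict A) (lift u) = lift u.
Proof. by apply/rowP => i; rewrite !mxE restrictC. Qed.

Lemma linear_mxE p q (F : 'M[S]_(p, q)) (v : 'rV[K]_p) :
  (forall i j, F i j \is 1.-homog) ->
  lift v *m F = \sum_i 'X_i *: lift (v *m map_mx (mcoeff U_(i)) F).
Proof.
move=> F1; apply/rowP => j; rewrite summxE mxE.
under eq_bigr => l _ do rewrite [F l j]dhomog1E // mulr_sumr.
rewrite exchange_big /=; apply: eq_bigr => i _.
rewrite !mxE rmorph_sum mulr_sumr; apply: eq_bigr => l _.
rewrite !mxE rmorphM /= -mul_mpolyC; ring.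
Qed.

Lemma mcoeff_sumX_lift p (u : 'I_n -> 'rV[K]_p) (A : {set 'I_n}) i l :
  i \in A -> ((\sum_(j in A) 'X_j *: lift (u j)) 0 l)@_U_(i) = u i 0 l.
Proof.
move=> iA; rewrite summxE raddf_sum /= (bigD1 i) //= !mxE mulrC mcoeffCM.
rewrite mcoeffX eqxx mulr1 big1 ?addr0 // => j /andP[_ ji].
by rewrite !mxE mulrC mcoeffCM mcoeffX eq_mnm1 (negbTE ji) mulr0.
Qed.

(* The coefficient matrices of the differentials anticommute, so descending k
   steps from a nonzero constant vector consumes k distinct variables. *)
Lemma linear_complex_step p q l (F : 'M[S]_(p, q)) (M : 'M[S]_(q, l)) N k :
  (forall i j, F i j \is 1.-homog) -> F *m M = 0 ->
  (forall v : 'rV[K]_p, lift v *m F = 0 -> v = 0) ->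
  (forall (u : 'rV[K]_q) (A : {set 'I_n}), u != 0 ->
     map_mx (restrict A) (lift u *m M) = 0 -> (k + #|A| < N)%N) ->
  forall (v : 'rV[K]_p) (A : {set 'I_n}), v != 0 ->
     map_mx (restrict A) (lift v *m F) = 0 -> (k.+1 + #|A| < N)%N.
Proof.
move=> F1 FM Finj IH v A v0 vA.
pose u i := v *m map_mx (mcoeff U_(i)) F.
have resE B : map_mx (restrict B) (lift v *m F) = \sum_(j in B) 'X_j *: lift (u j).
  rewrite linear_mxE // raddf_sum /= [RHS]big_mkcond /=; apply: eq_bigr => j _.
  rewrite map_mxZ /= restrict_lift restrictX.
  by case: ifP => _; rewrite ?scale0r.
have uA i : i \in A -> u i = 0.
  move=> iA; apply/rowP => j; rewrite -(mcoeff_sumX_lift u j iA) -resE vA.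
  by rewrite !mxE mcoeff0.
have [i ui] : exists i, u i != 0.
  apply/existsP; apply: contraNT v0 => /existsPn u0; apply/eqP/Finj.
  rewrite linear_mxE // big1 // => i _.
  by have := u0 i; rewrite negbK => /eqP; rewrite /u => ->; rewrite map_mx0 scaler0.
have iA : i \notin A by apply: contra ui => /uA->.
have := IH (u i) (i |: A) ui; rewrite cardsU1 iA addnA addn1; apply.
(* On the variables of [i |: A] only the term ['X_i] times [u i] of [v *m F] survives, since [u j]
   vanishes for [j] in [A]. Cancelling ['X_i] shows that [M] kills [u i] there. *)
have : map_mx (restrict (i |: A)) (lift v *m F *m M) = 0.
  by rewrite -mulmxA FM mulmx0 map_mx0.
rewrite map_mxM resE (bigD1 i) ?setU11 //= big1 ?addr0; last first.
  by move=> j; rewrite !inE => /andP[/orP[->//|/uA->]]; rewrite map_mx0 scaler0.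
rewrite -scalemxAl => /rowP E.
rewrite map_mxM restrict_lift; apply/rowP => j.
have := E j; rewrite mxE [X in _ = X -> _]mxE => /eqP; rewrite mulf_eq0.
by rewrite -msupp_eq0 msuppX /= [RHS]mxE => /eqP.
Qed.

End LinearComplex.

(** * Generating functions by iterated partial sums *)

Section PartialSums.
Implicit Types (f g : nat -> int).

(** Multiplication of the generating function by 1/(1-X). The values are integers because of the
    alternating signs. *)
Definition psum f (d : nat) : int := \sum_(i < d.+1) f i.

(** Multiplication of the generating function by X^t. *)
Definition seq_shift (t : nat) f (d : nat) : int :=
  if (t <= d)%N then f (d - t)%N else 0.

Definition eventually_zero f := exists N, forall d, (N <= d)%N -> f d = 0.

Lemma psumS f d : psum f d.+1 = psum f d + f d.+1.
Proof. by rewrite /psum big_ord_recr. Qed.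

Lemma psum0 f : psum f 0 = f 0%N.
Proof. by rewrite /psum big_ord1. Qed.

Lemma psumB f g d : psum (fun i => f i - g i) d = psum f d - psum g d.
Proof. by rewrite /psum sumrB. Qed.

Lemma eq_psum f g : f =1 g -> psum f =1 psum g.
Proof. by move=> fg d; apply: eq_bigr. Qed.

Lemma psum_shift t f d : psum (seq_shift t f) d = seq_shift t (psum f) d.
Proof.
elim: d => [|d IH].
  by rewrite psum0 /seq_shift; case: t => [|t] //; rewrite subn0 psum0.
rewrite psumS IH /seq_shift.
case: (ltngtP t d.+1) => td.
- by rewrite -ltnS td subSn // psumS.
- by rewrite leqNgt (ltn_trans _ td).
- by rewrite td ltnn subnn psum0 add0r.
Qed.

Definition npsum m f := iter m psum f.

Lemma npsumSr m f : npsum m.+1 f = psum (npsum m f).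
Proof. by []. Qed.

Lemma npsumS m f : npsum m.+1 f = npsum m (psum f).
Proof. by rewrite /npsum iterSr. Qed.

Lemma eq_npsum m f g : f =1 g -> npsum m f =1 npsum m g.
Proof. by move=> fg; elim: m => //= m IH; apply: eq_psum. Qed.

Lemma npsumB m f g d : npsum m (fun i => f i - g i) d = npsum m f d - npsum m g d.
Proof.
elim: m d => // m IH d; rewrite /npsum /= -psumB.
by apply: eq_psum.
Qed.

Lemma npsumMl m (b : int) f d : npsum m (fun i => b * f i) d = b * npsum m f d.
Proof.
elim: m d => // m IH d; rewrite /npsum /= {2}/psum mulr_sumr.
by apply: eq_bigr => i _; apply: IH.
Qed.

Lemma npsum_shift m t f d : npsum m (seq_shift t f) d = seq_shift t (npsum m f) d.
Proof.
elim: m d => // m IH d; rewrite /npsum /= -psum_shift.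
by apply: eq_psum.
Qed.

(** The coefficients of 1/(1-X)^(m+1), that is, the Hilbert function of a polynomial ring in m+1
    variables. *)
Lemma npsum_delta m d : npsum m.+1 (fun i => (i == 0%N)%:R) d = ('C(d + m, d))%:R.
Proof.
elim: m d => [|m IH] d.
  rewrite /npsum /= /psum addn0 binn big_ord_recl /= big1 ?addr0 //.
rewrite npsumSr; elim: d => [|d IHd].
  by rewrite psum0 IH !bin0.
rewrite psumS IHd IH addnS addSn addnS binS -natrD addnC.
by congr (_ + _)%:R.
Qed.

Lemma psum_eventually_zero f : eventually_zero (psum f) -> eventually_zero f.
Proof.
move=> [N fN]; exists N.+1 => -[//|d] lt_Nd.
by have := psumS f d; rewrite !fN ?add0r // ltnW.
Qed.

Lemma npsum_eventually_zero m f : eventually_zero (npsum m f) -> eventually_zero f.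
Proof.
elim: m => // m IH; rewrite /npsum /= => /psum_eventually_zero; exact: IH.
Qed.

Lemma psum_const f N d : (forall i, (N < i)%N -> f i = 0) -> (N <= d)%N ->
  psum f d = psum f N.
Proof.
move=> fN; elim: d => [|d IH]; first by rewrite leqn0 => /eqP->.
rewrite leq_eqVlt => /orP[/eqP->//|Nd].
by rewrite psumS fN // addr0 IH.
Qed.

(** In generating functions: if P/(1-X)^m is a polynomial, division lowers the degree bound by m and
    multiplies the top coefficient by (-1)^m. *)
Lemma npsum_top m f N : (m <= N)%N -> (forall d, (N < d)%N -> f d = 0) ->
  eventually_zero (npsum m f) ->
  (forall d, (N - m < d)%N -> npsum m f d = 0) /\
  npsum m f (N - m)%N = (-1) ^+ m * f N.
Proof.
elim: m f N => [|m IH] f N; first by rewrite subn0 expr0 mul1r.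
case: N => // N le_mN fN; rewrite npsumS => ez.
have [D psD] := npsum_eventually_zero ez.
have ps0 d : (N < d)%N -> psum f d = 0.
  move=> Nd; rewrite (psum_const fN) // -(psD (maxn D N.+1)) ?leq_maxl //.
  by rewrite (psum_const fN) // leq_maxr.
have [IHz IHt] := IH (psum f) N le_mN (fun d Nd => ps0 d Nd) ez.
rewrite subSS; split; first exact: IHz.
rewrite IHt exprSr -mulrA mulN1r; congr (_ * _).
by apply/eqP; rewrite -subr_eq0 opprK -psumS ps0.
Qed.

(* The generating function of r is P(t)/(1-t)^(n+1), where P has degree at most
   t+n and nonpositive signed top coefficient; the value of r at infinity is
   Q(1) for Q = P(t)/(1-t)^n, which has degree at most t. *)
Lemma hilbert_bound n t (b : nat -> nat) (r : nat -> int) D0 e :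
  (0 < t)%N ->
  (forall d, r d = npsum n.+1 (fun d => (d == 0%N)%:R -
     seq_shift t (fun k => (-1) ^+ k * (b k)%:R) d) d) ->
  (forall k, (n < k)%N -> b k = 0%N) ->
  (forall d, (D0 <= d)%N -> r d = e) ->
  e <= r t.-1.
Proof.
move=> t0 rE bn re; set P := (fun d : nat => _ - _) in rE.
pose q := npsum n P.
have rq d : r d = psum q d by rewrite rE.
have Pz d : (t + n < d)%N -> P d = 0.
  move=> td; rewrite /P /seq_shift (_ : (d == 0)%N = false); last by lia.
  by case: ifP => // _; rewrite bn ?mulr0 ?subr0 //; lia.
have qz : eventually_zero q.
  exists D0.+1 => -[//|d] Dd; have := psumS q d; rewrite -!rq !re //; last exact: ltnW.
  by move/eqP; rewrite eq_sym addrC -subr_eq0 addrK => /eqP.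
have [q0 qt] := npsum_top (leq_addl t n) Pz qz.
rewrite addnK in q0 qt.
(* The coefficient of [P] in degree t+n is -(-1)^n b_n, so [q t] equals -b_n. *)
have qt0 : q t <= 0.
  rewrite /q qt /P /seq_shift leq_addr addKn (_ : (t + n == 0)%N = false); last by lia.
  by rewrite sub0r mulrN mulrA -expr2 sqrr_sign mul1r oppr_le0 ler0n.
rewrite -(re (maxn D0 t)) ?leq_maxl // rq (psum_const q0) ?leq_maxr //.
have -> : psum q t = r t.-1 + q t by rewrite rq -{1 3}(prednK t0) psumS.
by rewrite gerDl.
Qed.

End PartialSums.

(** * Graded pieces of free modules and their dimensions *)

Section GradedStrands.
Context (K : fieldType) (n : nat).
Local Notation S := {mpoly K[n.+1]}.
Local Notation strand p d := {ffun 'I_p -> dhomog n.+1 K d}.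

Definition strand_row p d (v : strand p d) : 'rV[S]_p := \row_i val (v i).

Lemma strand_row_inj p d (u v : strand p d) : strand_row u = strand_row v -> u = v.
Proof.
move=> E; apply/ffunP => i; apply: val_inj.
by have := congr1 (fun M : 'rV_p => M 0 i) E; rewrite !mxE.
Qed.

Definition strand_of p d (v : 'rV[S]_p) : strand p d :=
  [ffun i => DHomog (pihomogP mdeg d (v 0 i))].

Lemma strand_rowK p d (v : 'rV[S]_p) :
  strand_row (strand_of d v) = map_mx (pihomog mdeg d) v.
Proof. by apply/rowP => i; rewrite !mxE ffunE. Qed.

(** The projection to degree [t + d] makes the map well typed for every matrix; for entries of
    degree [t] it changes nothing. *)
Definition strand_mul p q t d (F : 'M[S]_(p, q)) (v : strand p d) : strand q (t + d) :=
  strand_of (t + d) (strand_row v *m F).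

Lemma strand_mul_is_linear p q t d (F : 'M[S]_(p, q)) : linear (@strand_mul p q t d F).
Proof.
move=> c u v; apply/ffunP => i; apply: val_inj; rewrite !ffunE /=.
rewrite -linearP /= !mxE scaler_sumr -big_split /=; congr (pihomog _ _ _).
by apply: eq_bigr => j _; rewrite !mxE !ffunE /= mulrDl scalerAl.
Qed.

HB.instance Definition _ p q t d F := GRing.isLinear.Build K _ _ _
  (@strand_mul p q t d F) (@strand_mul_is_linear p q t d F).

Lemma strand_mulE p q t d (F : 'M[S]_(p, q)) (v : strand p d) :
  (forall i j, F i j \is t.-homog) ->
  strand_row (strand_mul t F v) = strand_row v *m F.
Proof.
move=> Ft; rewrite strand_rowK; apply/rowP => j; rewrite !mxE.
rewrite pihomog_dE // rpred_sum // => i _; rewrite !mxE addnC dhomogM //.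
exact: valP.
Qed.

Definition strand_hom p q t d F := linfun (@strand_mul p q t d F).

Lemma strand_homE p q t d (F : 'M[S]_(p, q)) (v : strand p d) :
  strand_hom t d F v = strand_mul t F v.
Proof. by rewrite lfunE. Qed.

Lemma strand_ker p q t d (F : 'M[S]_(p, q)) (v : strand p d) :
  (forall i j, F i j \is t.-homog) ->
  reflect (strand_row v *m F = 0) (v \in lker (strand_hom t d F)).
Proof.
move=> Ft; rewrite memv_ker strand_homE; apply: (iffP eqP) => [E|E].
  by rewrite -(strand_mulE _ Ft) E; apply/rowP => i; rewrite !mxE ffunE.
by apply: strand_row_inj; rewrite strand_mulE // E; apply/rowP => i; rewrite !mxE ffunE.
Qed.

Lemma dim_dhomog d : \dim {: dhomog n.+1 K d} = 'C(d + n, d).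
Proof. by rewrite dimvf. Qed.

Lemma dim_strand p d : \dim {: strand p d} = (p * 'C(d + n, d))%N.
Proof. by rewrite dimvf /dim /= card_ord. Qed.

(** Rank-nullity in a single degree: a homogeneous kernel vector of [F] has a homogeneous preimage
    under [F'], namely the degree [d] part of any preimage. *)
Lemma strand_exact p' p q t d (F' : 'M[S]_(p', p)) (F : 'M[S]_(p, q)) :
  (forall i j, F i j \is t.-homog) -> (forall i j, F' i j \is 1.-homog) ->
  (forall v : 'rV_p, v *m F = 0 <-> exists w, v = w *m F') ->
  (\dim (lker (strand_hom t (1 + d) F)) + \dim (lker (strand_hom 1 d F')))%N =
  (p' * 'C(d + n, d))%N.
Proof.
move=> Ft F1 FE; rewrite -dim_strand -[RHS](limg_ker_dim (strand_hom 1 d F')) capfv.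
rewrite addnC; congr (_ + \dim _)%N; apply/vspaceP => v.
apply/(strand_ker _ Ft)/memv_imgP.
  move/FE => [w wE]; exists (strand_of d w); first exact: memvf.
  apply: strand_row_inj; rewrite strand_homE strand_mulE // strand_rowK.
  apply/rowP => j; rewrite [LHS](_ : _ = pihomog mdeg (1 + d) (strand_row v 0 j)); last first.
    by rewrite pihomog_dE // mxE; apply: valP.
  rewrite wE !mxE raddf_sum; apply: eq_bigr => i _.
  by rewrite /= addnC (@pihomogMl _ _ d 1) // mxE.
move=> [w _ ->]; apply/FE; exists (strand_row w).
by rewrite strand_homE strand_mulE.
Qed.

(** A kernel vector is a combination of rows of linear forms, so it has no constant part. *)
Lemma strand_ker0 p' p q t (F' : 'M[S]_(p', p)) (F : 'M[S]_(p, q)) :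
  (forall i j, F i j \is t.-homog) -> (forall i j, F' i j \is 1.-homog) ->
  (forall v : 'rV_p, v *m F = 0 <-> exists w, v = w *m F') ->
  \dim (lker (strand_hom t 0 F)) = 0%N.
Proof.
move=> Ft F1 FE; apply/eqP; rewrite dimv_eq0 -subv0; apply/subvP => v.
move/(strand_ker _ Ft)/FE => [w wE]; rewrite memv0; apply/eqP/strand_row_inj.
apply/rowP => j; rewrite [LHS](_ : _ = pihomog mdeg 0 (strand_row v 0 j)); last first.
  by rewrite pihomog_dE // mxE; apply: valP.
rewrite wE !mxE raddf_sum ffunE big1 // => i _ /=.
rewrite mulrC; apply/mpolyP => m; rewrite mcoeff0.
apply: memN_msupp_eq0; apply/negP => mm.
have /dhomogP/(_ _ mm) m0 := pihomogP mdeg 0 (F' i j * w 0 i).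
have m0' : m = 0%MM by apply/eqP; rewrite -mdeg_eq0 m0.
move: mm; rewrite m0' mcoeff_msupp /pihomog; apply/negP; rewrite negbK.
rewrite raddf_sum big1_seq //= => u /andP[/eqP u0 /msuppM_le/allpairsP[/= [x y] [/= xF _ uE]]].
have /dhomogP/(_ _ xF) x1 := F1 i j.
by move: u0; rewrite uE /= mdegD x1.
Qed.

Lemma ideal_strand b t D (g : 'cV[S]_b) (U : {vspace dhomog n.+1 K (t + D)}) :
  (forall i j, g i j \is t.-homog) ->
  (forall f, f \in U <-> exists v : 'rV_b, val f = (v *m g) 0 0) ->
  (\dim U + \dim (lker (strand_hom t D g)) = b * 'C(D + n, D))%N.
Proof.
move=> gt UE; rewrite -dim_strand -[RHS](limg_ker_dim (strand_hom t D g)) capfv addnC.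
congr (_ + _)%N.
(* The image consists of vectors with one component; [pr] identifies them with forms. *)
pose pr (v : strand 1 (t + D)) := v 0.
have prl : linear pr by move=> c u v; rewrite /pr !ffunE.
pose prL : {linear _ -> _} := HB.pack pr (GRing.isLinear.Build K _ _ _ pr prl).
have prE v : linfun prL v = v 0 by rewrite lfunE.
have <- : (linfun prL @: limg (strand_hom t D g))%VS = U.
  apply/vspaceP => f; apply/memv_imgP/idP.
    move=> [v /memv_imgP[w _ ->] ->]; apply/UE; exists (strand_row w).
    by rewrite prE strand_homE -(strand_mulE _ gt) mxE.
  move/UE => [v vE]; exists (strand_mul t g (strand_of D v)).
    by rewrite -strand_homE memv_img ?memvf.
  apply: val_inj; rewrite prE.
  have -> (u : strand 1 (t + D)) : val (u 0) = strand_row u 0 0 by rewrite mxE.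
  rewrite strand_mulE // strand_rowK mxE.
  rewrite -[LHS](pihomog_dE (valP f)) vE mxE raddf_sum; apply: eq_bigr => i _.
  by rewrite /= addnC pihomogMl // mxE.
rewrite (@limg_dim_eq _ _ _ (linfun prL)) //; apply/eqP; rewrite -subv0; apply/subvP => v.
rewrite memv_cap memv_ker prE memv0 => /andP[_ /eqP v0]; apply/eqP/ffunP => i.
by rewrite ord1 v0 ffunE.
Qed.

End GradedStrands.

Section LinearResolutionBound.
Context (K : fieldType) (n : nat).
Local Notation S := {mpoly K[n.+1]}.

Section Betti.
Context (t : nat) (b : nat -> nat) (g : 'cV[S]_(b 0%N)).
Context (F : forall k, 'M[S]_(b k.+1, b k)).
Hypothesis t0 : (0 < t)%N.
Hypothesis gt : forall i j, g i j \is t.-homog.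
Hypothesis F1 : forall k i j, F k i j \is 1.-homog.
Hypothesis gE : forall v : 'rV_(b 0%N), v *m g = 0 <-> exists w, v = w *m F 0%N.
Hypothesis FE : forall k (v : 'rV_(b k.+1)), v *m F k = 0 <-> exists w, v = w *m F k.+1.

(** Minimality of the complex: kernel vectors are combinations of linear forms and hence have zero
    constant terms. *)
Lemma const_row_ker p q q' (M : 'M[S]_(p, q)) (M' : 'M[S]_(q', p)) :
  (forall i j, M' i j \is 1.-homog) ->
  (forall v : 'rV_p, v *m M = 0 <-> exists w, v = w *m M') ->
  forall v : 'rV[K]_p, map_mx (@mpolyC n.+1 K) v *m M = 0 -> v = 0.
Proof.
move=> M1 ME v /ME[w wE]; apply/rowP => i.
have := congr1 (fun N : 'rV_p => (N 0 i)@_0%MM) wE.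
rewrite !mxE mcoeffC eqxx mulr1 => ->; rewrite raddf_sum big1 // => j _ /=.
rewrite rmorphM /= (memN_msupp_eq0 (m := 0%MM) (p := M' j i)) ?mulr0 //.
by apply/negP => /(dhomogP _ _ _ (M1 j i)) /=; rewrite mdeg0.
Qed.

Lemma mul_rows0 p q q' (M : 'M[S]_(p, q)) (M' : 'M[S]_(q', p)) :
  (forall v : 'rV_p, v *m M = 0 <-> exists w, v = w *m M') -> M' *m M = 0.
Proof.
move=> ME; apply/row_matrixP => i; rewrite row_mul row0; apply/ME.
by exists (delta_mx 0 i); rewrite rowE.
Qed.

(** Descending from a nonzero constant vector at step [k] to [g] consumes [k] distinct variables,
    and at [g] not all variables can be used up. With n+1 variables this leaves [k] at most [n]. *)
Lemma betti_bound k : (n < k)%N -> b k = 0%N.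
Proof.
have ginj := const_row_ker (@F1 0%N) gE.
have Finj k' := const_row_ker (@F1 k'.+1) (@FE k').
have base (u : 'rV[K]_(b 0%N)) (A : {set 'I_n.+1}) : u != 0 ->
    map_mx (restrict A) (map_mx (@mpolyC _ _) u *m g) = 0 -> (0 + #|A| < n.+1)%N.
  move=> u0 uA; rewrite add0n ltnNge; apply: contra u0 => cA.
  have AT : A = setT.
    by apply/eqP; rewrite eqEcard subsetT cardsT card_ord.
  apply/eqP/ginj; rewrite -[RHS]uA AT; apply/rowP => i.
  by rewrite [in RHS]mxE restrictT.
have steps k' : forall (v : 'rV[K]_(b k'.+1)) (A : {set 'I_n.+1}), v != 0 ->
    map_mx (restrict A) (map_mx (@mpolyC _ _) v *m F k') = 0 ->
    (k'.+1 + #|A| < n.+1)%N.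
  elim: k' => [|k' IH].
    by apply: linear_complex_step base; [apply: F1|apply: mul_rows0 gE|apply: Finj].
  by apply: linear_complex_step IH; [apply: F1|apply: mul_rows0 (@FE k')|apply: Finj].
case: k => // k lt_nk; apply/eqP; rewrite -leqn0 leqNgt; apply/negP => b0.
(* With all variables set to zero the linear differential vanishes, so the descent may start from
   [set0]. *)
suff : (k.+1 + #|@set0 'I_n.+1| < n.+1)%N by rewrite cards0 addn0 ltnNge lt_nk.
apply: (steps k (delta_mx 0 (Ordinal b0)) set0).
  by apply/eqP => /rowP/(_ (Ordinal b0)); rewrite !mxE !eqxx => /eqP; rewrite oner_eq0.
rewrite linear_mxE; last exact: F1.
rewrite raddf_sum big1 //= => i _.
by rewrite map_mxZ /= restrictX inE scale0r.
Qed.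

Definition ker_dim k d : nat :=
  match k with
  | 0 => \dim (lker (strand_hom t d g))
  | k'.+1 => \dim (lker (strand_hom 1 d (F k')))
  end.

Lemma ker_dimS k d :
  (ker_dim k d.+1 + ker_dim k.+1 d)%N = (b k.+1 * 'C(d + n, d))%N.
Proof.
case: k => [|k] /=.
  exact: strand_exact gE.
exact: strand_exact (@FE k).
Qed.

Lemma ker_dim0 k : ker_dim k 0 = 0%N.
Proof.
case: k => [|k] /=; first exact: strand_ker0 gE.
exact: strand_ker0 (@FE k).
Qed.

Lemma alternating_betti k d : (b k.+1)%:R * npsum n.+1 (fun i => (i == 0%N)%:R) d -
    npsum n.+1 (seq_shift 1 (fun j => (-1) ^+ j * (b (k.+1 + j).+1)%:R)) d =
  npsum n.+1 (fun j => (-1) ^+ j * (b (k + j).+1)%:R) d :> int.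
Proof.
rewrite -npsumMl -npsumB; apply: eq_npsum => -[|j].
  by rewrite /seq_shift /= mulr1 subr0 addn0 mul1r.
by rewrite /seq_shift /= mulr0 sub0r subn1 /= exprS mulN1r mulNr addSnnS.
Qed.

(** Unrolling [ker_dimS] gives an alternating sum of Betti numbers weighted by the Hilbert function
    of the ring. *)
Lemma ker_dimE k d : (ker_dim k d)%:R =
  npsum n.+1 (seq_shift 1 (fun j => (-1) ^+ j * (b (k + j).+1)%:R)) d :> int.
Proof.
elim: d k => [|d IH] k; first by rewrite ker_dim0 npsum_shift.
have shiftS f : seq_shift 1 f d.+1 = f d by rewrite /seq_shift subn1.
have E := ker_dimS k d; rewrite npsum_shift shiftS.
rewrite -alternating_betti npsum_delta -natrM -E natrD IH.
by rewrite addrK.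
Qed.

End Betti.

(** Here [r] is the Hilbert function of the quotient by [I]. The resolution brings it into the shape
    required by [hilbert_bound]. *)
Lemma linear_resolution_bound (I : S -> Prop) t (f0 : S) (r : nat -> nat) D0 e :
  has_linear_resolution I ->
  (0 < t)%N -> I f0 -> f0 != 0 -> f0 \is t.-homog ->
  (forall f m, I f -> m \in msupp f -> (t <= mdeg m)%N) ->
  (forall D, exists U : {vspace dhomog n.+1 K D},
     (forall f, f \in U <-> I (val f)) /\ (\dim U + r D)%N = 'C(D + n, D)) ->
  (forall D, (D0 <= D)%N -> r D = e) -> (e <= r t.-1)%N.
Proof.
move=> [d [b [g [F [gd [F1 [_ [IE [gE FE]]]]]]]]] t0 If0 f00 f0t It HU re.
(* A nonzero generator lies in [I], so [d] is at least [t]; the form [f0] of degree [t] is a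
   combination of generators, so [d] is at most [t]. *)
have dt : d = t.
  have [v f0E] := (IE f0).1 If0.
  have [i gi] : exists i, g i 0 != 0.
    apply/existsP; apply: contraNT f00 => /existsPn g0.
    rewrite f0E mxE big1 // => i _.
    by have := g0 i; rewrite negbK => /eqP->; rewrite mulr0.
  have Igi : I (g i 0).
    by apply/IE; exists (delta_mx 0 i); rewrite -rowE mxE.
  have [m mg] : exists m, m \in msupp (g i 0).
    by case E: (msupp (g i 0)) => [|m s]; [rewrite -msupp_eq0 E in gi|exists m; rewrite mem_head].
  apply/eqP; rewrite eqn_leq; apply/andP; split; last first.
    by have /= <- := dhomogP _ _ _ (gd i) _ mg; apply: It mg.
  have [u uf] : exists u, u \in msupp f0.
    by case E: (msupp f0) => [|m' s]; [rewrite -msupp_eq0 E in f00|exists m'; rewrite mem_head].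
  have /= ut := dhomogP _ _ _ f0t _ uf.
  have := uf; rewrite f0E mxE => /msupp_sum_le; rewrite filter_predT.
  move=> /flattenP[s /mapP[j _ ->]] /msuppM_le/allpairsP[/= [x y] [_ /= yg uE]].
  have /= yd := dhomogP _ _ _ (gd j) _ yg.
  by rewrite -ut uE mdegD yd leq_addl.
rewrite {}dt in gd.
have gt i j : g i j \is t.-homog by rewrite ord1.
have rE D : ((r D)%:R : int) = npsum n.+1 (fun d => (d == 0%N)%:R -
     seq_shift t (fun k => (-1) ^+ k * (b k)%:R) d) D.
  rewrite npsumB npsum_delta npsum_shift /seq_shift.
  have [U [UI Ur]] := HU D.
  case: (leqP t D) => tD; last first.
    rewrite subr0 -Ur (_ : U = 0%VS) ?dimv0 //.
    apply/eqP; rewrite -subv0; apply/subvP => f /UI If; rewrite memv0.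
    apply/eqP/val_inj/msuppnil0; case E: (msupp (val f)) => [//|m s].
    have mf : m \in msupp (val f) by rewrite E mem_head.
    have /= mD := dhomogP _ _ _ (valP f) _ mf.
    by have := It _ _ If mf; rewrite mD leqNgt tD.
  move: (D - t)%N (subnKC tD) => D' ED; move: U UI Ur; rewrite -{}ED => U UI Ur.
  have := @ideal_strand _ _ _ t D' g U gt (fun f => iff_trans (UI f) (IE _)).
  rewrite -/(ker_dim t g F 0 D') => Uk.
  have -> : npsum n.+1 (fun k => (-1) ^+ k * (b k)%:R) D' =
     (b 0%N)%:R * npsum n.+1 (fun i => (i == 0%N)%:R) D' - (ker_dim t g F 0 D')%:R :> int.
    rewrite (ker_dimE gt F1 gE FE) -npsumMl -npsumB; apply: eq_npsum => -[|j].
      by rewrite /seq_shift /= mulr1 subr0 mul1r.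
    by rewrite /seq_shift /= mulr0 sub0r subn1 /= exprS mulN1r mulNr add0n.
  rewrite npsum_delta -natrM -Uk -Ur !natrD; ring.
have := @hilbert_bound n t b (fun D => (r D)%:R) D0 e%:R t0 rE.
rewrite ler_nat; apply.
  by move=> k; apply: (betti_bound F1 gE FE).
by move=> D /re->.
Qed.

End LinearResolutionBound.

(** * Weights and the toric ideal *)

Section Weights.
Context (n : nat) (a : 'I_n -> nat).
Implicit Types m u v : 'X_{1..n}.

Definition weight m : nat := (\sum_i m i * a i)%N.

Lemma wt0 : weight 0%MM = 0%N.
Proof. by rewrite /weight big1 // => i _; rewrite mnm0E mul0n. Qed.

Lemma wtD u v : weight (u + v)%MM = (weight u + weight v)%N.
Proof. by rewrite /weight -big_split; apply: eq_bigr => i _; rewrite mnmDE mulnDl. Qed.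

Lemma wtU i : weight U_(i)%MM = a i.
Proof.
rewrite /weight (bigD1 i) //= mnm1E eqxx mul1n big1 ?addn0 // => j ji.
by rewrite mnm1E eq_sym (negbTE ji).
Qed.

Lemma wtMn m k : weight (m *+ k)%MM = (weight m * k)%N.
Proof.
elim: k => [|k IH]; first by rewrite mulm0n wt0 muln0.
by rewrite mulmS wtD IH mulnS.
Qed.

Lemma wt_sum (I : Type) (s : seq I) (P : pred I) (F : I -> 'X_{1..n}) :
  weight (\sum_(i <- s | P i) F i)%MM = (\sum_(i <- s | P i) weight (F i))%N.
Proof. by apply: (big_morph weight wtD wt0). Qed.

Lemma mdeg_le_wt m : (forall i, 0 < a i)%N -> (mdeg m <= weight m)%N.
Proof.
move=> a0; rewrite mdegE; apply: leq_sum => i _.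
by rewrite -[X in (X <= _)%N]muln1 leq_mul2l a0 orbT.
Qed.

Lemma wt_le m k : (forall i, a i <= k)%N -> (weight m <= k * mdeg m)%N.
Proof.
move=> ak; rewrite mdegE big_distrr; apply: leq_sum => i _.
by rewrite mulnC leq_mul2r ak orbT.
Qed.

End Weights.

Section MinimalGenerators.
Implicit Types A B : nat -> Prop.

Definition sums_of A h := exists (k : nat) (g : 'I_k -> nat),
  (forall i, A (g i)) /\ h = (\sum_(i < k) g i)%N.

Lemma sums_of0 A : sums_of A 0.
Proof. by exists 0%N, (fun=> 0%N); split=> [[]|] //; rewrite big_ord0. Qed.

Lemma sums_of1 A x : A x -> sums_of A x.
Proof. by move=> Ax; exists 1%N, (fun=> x); split=> //; rewrite big_ord1. Qed.

Lemma sums_ofD A x y : sums_of A x -> sums_of A y -> sums_of A (x + y)%N.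
Proof.
move=> [k [g [Ag ->]]] [l [h [Ah ->]]].
exists (k + l)%N, (fun i => match split i with inl j => g j | inr j => h j end).
split; first by move=> i; case: (split i).
rewrite big_split_ord /=; congr (_ + _)%N; apply: eq_bigr => i _.
  by rewrite (unsplitK (inl i)).
by rewrite (unsplitK (inr i)).
Qed.

Lemma sums_ofMn A x k : sums_of A x -> sums_of A (k * x)%N.
Proof.
move=> Ax; elim: k => [|k IH]; first exact: sums_of0.
by rewrite mulSn; apply: sums_ofD.
Qed.

Lemma sums_of_sum A (I : Type) (s : seq I) (P : pred I) (F : I -> nat) :
  (forall i, P i -> sums_of A (F i)) -> sums_of A (\sum_(i <- s | P i) F i)%N.
Proof.
move=> AF; elim/big_rec: _ => [|i x Pi Ax]; first exact: sums_of0.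
by apply: sums_ofD => //; apply: AF.
Qed.

Context (n : nat) (a : 'I_n -> nat) (H : nat -> Prop).
Hypothesis Hsg : numerical_semigroup H.
Hypothesis Hmin : minimal_generating_set H (fun x => exists i, a i = x).
Hypothesis a_inj : injective a.

Lemma semigroup_wt h : H h <-> exists m, weight a m = h.
Proof.
have [Hg _] := Hmin; split.
  move/Hg => [k [g [gA ->]]].
  have [f fP] := fin_all_exists gA.
  exists (\sum_i U_(f i))%MM; rewrite wt_sum.
  by apply: eq_bigr => i _; rewrite wtU fP.
case=> m <-; apply/Hg.
suff : sums_of (fun x => exists i, a i = x) (weight a m) by [].
rewrite /weight; apply: sums_of_sum => i _.
by apply/sums_ofMn/sums_of1; exists i.
Qed.

(** Otherwise [a i] would be a sum of other generators, and these alone would generate [H]. *)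
Lemma generator_irredundant i m : weight a m = a i -> m i <> 0%N.
Proof.
move=> mi mi0; have [Hg Hm] := Hmin.
pose B x := (exists j, a j = x) /\ x <> a i.
have Bgen (m' : 'X_{1..n}) : m' i = 0%N -> sums_of B (weight a m').
  move=> m'i; rewrite /weight; apply: sums_of_sum => j _; have [->|/eqP ji] := eqVneq j i.
    by rewrite m'i; apply: sums_of0.
  by apply/sums_ofMn/sums_of1; split; [exists j|move=> /a_inj].
have HB : generates H B.
  move=> h; split=> [/semigroup_wt[m' <-]|[k [g [gB E]]]].
    rewrite /weight (bigD1 i) //=; apply: sums_ofD.
      by apply: sums_ofMn; rewrite -mi; apply: Bgen.
    apply: sums_of_sum => j /eqP ji; apply/sums_ofMn/sums_of1.
    by split; [exists j|move=> /a_inj].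
  by apply/Hg; exists k, g; split=> // j; case: (gB j).
have [] // := Hm B _ HB (a i) (ex_intro _ i erefl).
by move=> x [].
Qed.

Lemma generator_pos i : (0 < a i)%N.
Proof.
rewrite lt0n; apply/eqP => ai0.
have := @generator_irredundant i 0%MM; rewrite wt0 mnm0E => /(_ (esym ai0)).
exact.
Qed.

Lemma wt_generator i m : weight a m = a i -> m = U_(i)%MM.
Proof.
move=> mi; have /eqP := generator_irredundant mi; rewrite -lep1mP => /submK E.
have : weight a (m - U_(i))%MM = 0%N.
  by have := mi; rewrite -{1}E wtD wtU; lia.
have := mdeg_le_wt (m - U_(i))%MM generator_pos => le0 w0; move: le0.
rewrite w0 leqn0 mdeg_eq0 => /eqP m0.
by rewrite -E m0 add0m.
Qed.

Lemma wt_cofinite : exists N, forall h, (N <= h)%N -> exists m, weight a m = h.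
Proof. by have [_ [_ [N HN]]] := Hsg; exists N => h /HN/semigroup_wt. Qed.

End MinimalGenerators.

Section ToricIdeal.
Context (K : fieldType) (n : nat) (a : 'I_n -> nat).
Local Notation S := {mpoly K[n]}.
Local Notation wt := (weight a).
Local Notation I := (sg_ideal (K := K) a).
Local Notation Is := (initial_ideal I).
Implicit Types (m u v : 'X_{1..n}) (f g : S).

HB.instance Definition _ := GRing.RMorphism.copy (@sg_map K n a)
  (mmap (@polyC K) (fun i => 'X^(a i))).

Lemma sg_mapX m : sg_map a 'X_[K, m] = 'X^(wt m).
Proof.
rewrite /sg_map mmapX /mmap1 /weight.
rewrite (big_morph _ (exprD 'X) (expr0 'X)); apply: eq_bigr => i _.
by rewrite -exprM mulnC.
Qed.

Lemma coef_sg_map f w : (sg_map a f)`_w = msum (fun m => (wt m == w)%:R) f.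
Proof.
rewrite {1}[f]mpolyE raddf_sum coef_sum; apply: eq_bigr => m _ /=.
rewrite -mul_mpolyC rmorphM /= sg_mapX [sg_map _ _]mmapC coefCM coefXn.
by rewrite eq_sym.
Qed.

Lemma sg_idealP f : I f <-> forall w, msum (fun m => (wt m == w)%:R) f = 0.
Proof.
split=> [If w|fw]; first by rewrite -coef_sg_map If coef0.
by apply/polyP => w; rewrite coef_sg_map fw coef0.
Qed.

Lemma sg_ideal_is_ideal : is_ideal I.
Proof. by case: (@prime_kernel _ _ (sg_map a : {rmorphism S -> _})). Qed.

Lemma sg_ideal_binom u v : wt u = wt v -> I ('X_[u] - 'X_[v]).
Proof. by move=> E; rewrite /sg_ideal rmorphB /= !sg_mapX E subrr. Qed.

Lemma low_deg_le f m : m \in msupp f -> (low_deg f <= mdeg m)%N.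
Proof.
rewrite /low_deg; elim: (msupp f) => // u s IH; rewrite inE big_cons geq_min.
by case/orP => [/eqP->|/IH->]; rewrite ?leqnn ?orbT.
Qed.

Lemma low_deg_eq f m d : m \in msupp f -> mdeg m = d ->
  (forall u, u \in msupp f -> (d <= mdeg u)%N) -> low_deg f = d.
Proof.
move=> mf md fd; apply/eqP; rewrite eqn_leq -{1}md low_deg_le //=.
rewrite /low_deg big_seq; elim/big_rec: _ => [|u x uf dx].
  by rewrite -md ltnW // msize_mdeg_lt.
by rewrite leq_min dx fd.
Qed.

Lemma initial_form_eq f d m : m \in msupp f -> mdeg m = d ->
  (forall u, u \in msupp f -> (d <= mdeg u)%N) -> initial_form f = pihomog mdeg d f.
Proof. by move=> mf md fd; rewrite /initial_form (low_deg_eq mf md fd). Qed.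

Lemma initial_ideal_in f : I f -> f != 0 -> Is (initial_form f).
Proof. by move=> If /eqP f0; apply: ideal_gen_in; exists f. Qed.

Lemma msupp_binom u v : u != v -> perm_eq (msupp ('X_[K, u] - 'X_[K, v])) [:: u; v].
Proof.
move=> uv; apply: uniq_perm; rewrite ?msupp_uniq //= ?inE ?uv // => m.
rewrite mcoeff_msupp mcoeffB !mcoeffX !inE [m == u]eq_sym [m == v]eq_sym.
case: (eqVneq u m) => [<-|_]; case: (eqVneq v _) => [E|_] //.
- by rewrite E eqxx in uv.
- by rewrite subr0 oner_eq0.
- by rewrite sub0r oppr_eq0 oner_eq0.
- by rewrite subrr eqxx.
Qed.

Lemma initial_ideal_mono u v : wt u = wt v -> (mdeg u < mdeg v)%N -> Is 'X_[u].
Proof.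
move=> E lt_uv; have uv : u != v by apply: contraTneq lt_uv => ->; rewrite ltnn.
have mem m : (m \in msupp ('X_[K, u] - 'X_[K, v])) = (m \in [:: u; v]).
  exact/perm_mem/msupp_binom.
have uS : u \in msupp ('X_[K, u] - 'X_[K, v]) by rewrite mem mem_head.
have -> : 'X_[u] = initial_form ('X_[K, u] - 'X_[K, v]).
  rewrite (initial_form_eq uS erefl) => [|m]; last first.
    by rewrite mem !inE => /orP[/eqP->//|/eqP->]; apply: ltnW.
  by rewrite raddfB /= !pihomogX eqxx gtn_eqF ?subr0.
apply: initial_ideal_in; first exact: sg_ideal_binom.
by rewrite -msupp_eq0; case: (msupp _) uS.
Qed.

Lemma initial_ideal_binom u v : wt u = wt v -> mdeg u = mdeg v ->
  Is ('X_[u] - 'X_[v]).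
Proof.
move=> E d; have [->|uv] := eqVneq u v; first by rewrite subrr; apply: ideal_gen0.
have mem m : (m \in msupp ('X_[K, u] - 'X_[K, v])) = (m \in [:: u; v]).
  exact/perm_mem/msupp_binom.
have uS : u \in msupp ('X_[K, u] - 'X_[K, v]) by rewrite mem mem_head.
have -> : 'X_[u] - 'X_[v] = initial_form ('X_[K, u] - 'X_[K, v]).
  rewrite (initial_form_eq uS erefl) => [|m]; last first.
    by rewrite mem !inE => /orP[/eqP->//|/eqP->]; rewrite d.
  by rewrite raddfB /= !pihomogX eqxx d eqxx.
apply: initial_ideal_in; first exact: sg_ideal_binom.
by rewrite -msupp_eq0; case: (msupp _) uS.
Qed.

Definition deg_wt d w : 'X_{1..n} -> K := fun m => ((mdeg m == d) && (wt m == w))%:R.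

(** For [w] in the semigroup: [d] is at least the order of t^w with respect to powers of the maximal
    ideal. *)
Definition max_deg d w := forall v, wt v = w -> (mdeg v <= d)%N.

(** Let m be a monomial and g in the toric ideal, with m times the initial form of g in degree [d].
    By maximality of [d], all terms of g of weight w - wt m already belong to the initial form. So
    the functional returns the coefficient of t^(w - wt m) in the image of g, which is zero. *)
Lemma msum_initial_ideal f d w : max_deg d w -> Is f -> msum (deg_wt d w) f = 0.
Proof.
move=> dw; apply: msum_ideal_gen => _ m [g [Ig [_ ->]]].
rewrite /initial_form /pihomog mulr_sumr raddf_sum /=.
under eq_bigr => u _ do rewrite -scalerAr -mpolyXD msumZX /deg_wt mdegD wtD.
have [E|] := eqVneq (mdeg m + low_deg g)%N d; last first.
  move=> ne; rewrite big1 // => u /eqP->.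
  by rewrite (negbTE ne) mulr0.
have [le_mw|lt_wm] := leqP (wt m) w; last first.
  rewrite big1 // => u _; rewrite [(_ == w)](_ : _ = false) ?andbF ?mulr0 //.
  by apply/negbTE; rewrite neq_ltn orbC (leq_trans lt_wm) // leq_addr.
have /sg_idealP/(_ (w - wt m)%N) := Ig; rewrite /msum => Eg; rewrite -[RHS]Eg.
rewrite big_mkcond /= !big_seq; apply: eq_bigr => u ug.
rewrite -(eqn_add2l (wt m) (wt u)) subnKC //.
have [wE|_] := eqVneq (wt m + wt u)%N w; last by rewrite andbF mulr0; case: ifP.
suff -> : mdeg u = low_deg g by rewrite eqxx E eqxx.
apply/eqP; rewrite eqn_leq low_deg_le // andbT.
by rewrite -(leq_add2l (mdeg m)) E -mdegD; apply: dw; rewrite wtD.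
Qed.

Hypothesis a_pos : forall i, (0 < a i)%N.

(** The bounded quantifier makes this boolean; it is enough because degree is at most weight when
    all [a i] are positive. *)
Definition is_max_deg m :=
  [forall v : 'X_{1..n < (wt m).+1}, (wt v == wt m) ==> (mdeg v <= mdeg m)%N].

Lemma is_max_degP m : reflect (max_deg (mdeg m) (wt m)) (is_max_deg m).
Proof.
apply: (iffP forallP) => [H v vm|H v]; last by apply/implyP => /eqP/H.
have lt_v : (mdeg v < (wt m).+1)%N by rewrite ltnS -vm mdeg_le_wt.
by have /implyP := H (BMultinom lt_v); apply; apply/eqP.
Qed.

Lemma is_max_degPn m : ~~ is_max_deg m -> exists2 v, wt v = wt m & (mdeg m < mdeg v)%N.
Proof.
by case/forallPn => v; rewrite negb_imply -ltnNge => /andP[/eqP E lt]; exists v.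
Qed.

(** For the converse each monomial is reduced to a chosen representative of its degree and weight,
    or to 0 if its degree is not maximal for its weight. The functionals are exactly the
    coefficients of the reduced polynomial. *)
Lemma initial_idealP f :
  Is f <-> forall d w, max_deg d w -> msum (deg_wt d w) f = 0.
Proof.
split=> [If d w dw|fE]; first exact: msum_initial_ideal.
pose P m v := (mdeg v == mdeg m) && (wt v == wt m).
pose rep m := choose (P m) m.
have Pm m : P m m by rewrite /P !eqxx.
have repP m : P m (rep m) by apply: chooseP.
have repE u m : P u m -> rep m = rep u.
  move=> /andP[/eqP ud /eqP uw]; rewrite /rep (@eq_choose _ _ (P u)).
    by apply: choose_id; rewrite // /P ud uw !eqxx.
  by move=> v; rewrite /P ud uw.
pose red m : S := if is_max_deg m then 'X_[rep m] else 0.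
have redI m : Is ('X_[m] - red m).
  rewrite /red; case: ifPn => [_|/is_max_degPn[v E lt]].
    by have /andP[/eqP d /eqP w] := repP m; apply: initial_ideal_binom.
  by rewrite subr0; apply: initial_ideal_mono lt.
have -> : f = \sum_(m <- msupp f) f@_m *: ('X_[m] - red m).
  under eq_bigr => m _ do rewrite scalerBr.
  rewrite sumrB -mpolyE [X in _ - X](_ : _ = 0) ?subr0 //.
  apply/mpolyP => u; rewrite raddf_sum mcoeff0 /=.
  have [/is_max_degP um|um] := boolP (is_max_deg u); last first.
    rewrite big1 // => m _; rewrite mcoeffZ /red.
    case: ifP => mm; last by rewrite mcoeff0 mulr0.
    rewrite mcoeffX; case: eqP => E; last by rewrite mulr0.
    have /andP[/eqP d /eqP w] := repP m; rewrite E in d w.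
    by move: um; rewrite /is_max_deg d w -/(is_max_deg m) mm.
  case: (eqVneq (rep u) u) => ru; last first.
    rewrite big1 // => m _; rewrite mcoeffZ /red.
    case: ifP => mm; last by rewrite mcoeff0 mulr0.
    rewrite mcoeffX; case: eqP => E; last by rewrite mulr0.
    have := repE _ _ (repP m); rewrite E => E'.
    by rewrite E' eqxx in ru.
  rewrite -[RHS](fE _ _ um); apply: eq_bigr => m _; rewrite mcoeffZ; congr (_ * _).
  rewrite /red /deg_wt; case: (boolP (_ && _)) => [/andP[/eqP md /eqP mw]|Pum].
    rewrite /is_max_deg md mw -/(is_max_deg u).
    have -> : is_max_deg u by apply/is_max_degP.
    rewrite (repE u) ?ru ?mcoeffX ?eqxx //.
    by rewrite /P md mw !eqxx.
  case: ifP => _; rewrite ?mcoeff0 // mcoeffX.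
  case: eqP => // E; move: Pum; have /andP[d w] := repP m.
  by rewrite E in d w; rewrite eq_sym d eq_sym w.
apply: ideal_gen_sum => m _; rewrite -mul_mpolyC; apply: ideal_genM.
exact: redI.
Qed.

Hypothesis a_gen : forall i m, wt m = a i -> m = U_(i)%MM.

(** The weights 0 and [a i] have a unique factorization. Hence elements of the toric ideal and of
    its initial ideal have no terms of degree below 2. *)
Lemma wt_low_deg m u : (mdeg m < 2)%N -> wt u = wt m -> u = m.
Proof.
case: (posnP (mdeg m)) => [/eqP|m0 m1].
  rewrite mdeg_eq0 => /eqP-> _; rewrite wt0 => u0.
  by apply/eqP; rewrite -mdeg_eq0 -leqn0 -u0 mdeg_le_wt.
have /eqP/mdeg1P[i /eqP->] : mdeg m = 1%N by lia.
by rewrite wtU => /a_gen.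
Qed.

Lemma sg_ideal_mdeg f m : I f -> m \in msupp f -> (2 <= mdeg m)%N.
Proof.
move=> /sg_idealP/(_ (wt m)) fm mf; rewrite leqNgt; apply/negP => m1.
move: mf; rewrite mcoeff_msupp mcoeff_msum -{}[X in _ != X]fm.
rewrite (@eq_msum _ _ _ (fun u => (wt u == wt m)%:R)) ?eqxx // => u _.
congr (nat_of_bool _)%:R; apply/eqP/eqP => [->//|]; exact: wt_low_deg.
Qed.

Lemma initial_ideal_mdeg f m : Is f -> m \in msupp f -> (2 <= mdeg m)%N.
Proof.
move=> If mf; rewrite leqNgt; apply/negP => m1.
have : max_deg (mdeg m) (wt m) by move=> v /(wt_low_deg m1)->.
move/msum_initial_ideal/(_ If) => fm.
move: mf; rewrite mcoeff_msupp mcoeff_msum -{}[X in _ != X]fm.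
rewrite (@eq_msum _ _ _ (deg_wt (mdeg m) (wt m))) ?eqxx // => u _.
congr (nat_of_bool _)%:R; apply/eqP/andP => [->|[_ /eqP]]; first by rewrite !eqxx.
exact: wt_low_deg.
Qed.

End ToricIdeal.

Lemma mdeg2P n (m : 'X_{1..n}) : mdeg m = 2 -> exists j k, m = (U_(j) + U_(k))%MM.
Proof.
move=> m2; have [j mj] : exists j, m j != 0%N.
  apply/existsP; apply: contraT => /existsPn m0.
  have : mdeg m = 0%N by rewrite mdegE big1 // => i _; apply/eqP; rewrite -[_ == _]negbK m0.
  by rewrite m2.
have /submK E : (U_(j) <= m)%MM by rewrite lep1mP.
have /eqP/mdeg1P[k /eqP mk] : mdeg (m - U_(j))%MM = 1%N.
  by have := m2; rewrite -{1}E mdegD mdeg1; lia.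
by exists k, j; rewrite -mk E.
Qed.

(** * Square relations *)

Section Squares.
Context (n : nat) (a : 'I_n.+1 -> nat).
Local Notation wt := (weight a).
Local Notation e := (a ord0).
Implicit Types (m u v s : 'X_{1..n.+1}).
Hypothesis a_pos : forall i, (0 < a i)%N.
Hypothesis a_gen : forall i m, wt m = a i -> m = U_(i)%MM.
Hypothesis a_inc : forall i j : 'I_n.+1, (i < j)%N -> (a i < a j)%N.

Lemma gen_inj : injective a.
Proof.
move=> i j E; apply: val_inj; apply/eqP; rewrite eqn_leq.
by apply/andP; split; rewrite leqNgt; apply/negP => /a_inc; rewrite E ltnn.
Qed.

Lemma gen_gt_mult i : i != ord0 -> (e < a i)%N.
Proof. by rewrite -val_eqE /= -lt0n => /(@a_inc ord0). Qed.

(** If a_j = a_i + c e, then x_i x_0^c is a factorization of a_j, which forces c = 0. *)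
Lemma generators_distinct_mod i j : a i = a j %[mod e] -> i = j.
Proof.
wlog le_ij : i j / (a i <= a j)%N => [W|/eqP E].
  by case: (leqP (a i) (a j)) => [/W|/ltnW/W] H E; [apply: H|apply/esym/H].
move: E; rewrite eq_sym eqn_mod_dvd // => /dvdnP[c E].
have : wt (U_(i) + U_(ord0) *+ c)%MM = a j.
  by rewrite wtD wtMn !wtU mulnC -E subnKC.
move/a_gen/(congr1 (@mdeg _)); rewrite mdegD mdegMn !mdeg1 mul1n.
move=> E1; have c0 : c = 0%N by lia.
move: E; rewrite c0 mul0n => E.
by apply: gen_inj; apply/eqP; rewrite eqn_leq le_ij -subn_eq0 E.
Qed.

Lemma embdim_le_mult : (n.+1 <= e)%N.
Proof.
pose f (i : 'I_n.+1) : 'I_e := Ordinal (ltn_pmod (a i) (a_pos ord0)).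
have f_inj : injective f by move=> i j [/generators_distinct_mod].
by have := leq_card f f_inj; rewrite !card_ord.
Qed.

Definition standard m := [forall i, (i != ord0) ==> (m i <= 1)%N].

Lemma standardP m : reflect (forall i, i != ord0 -> (m i <= 1)%N) (standard m).
Proof. by apply: (iffP forallP) => H i; have /implyP := H i. Qed.

Definition sqfree_wt (A : {set 'I_n}) : nat := (\sum_(i in A) a (lift ord0 i))%N.

Definition sqfree_mon c (A : {set 'I_n}) : 'X_{1..n.+1} :=
  (U_(ord0) *+ c + \sum_(i in A) U_(lift ord0 i))%MM.

Lemma wt_sqfree_mon c A : wt (sqfree_mon c A) = (c * e + sqfree_wt A)%N.
Proof.
rewrite wtD wtMn wtU mulnC wt_sum; congr (_ + _)%N.
by apply: eq_bigr => i _; rewrite wtU.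
Qed.

Lemma sqfree_mon_lift c A i : sqfree_mon c A (lift ord0 i) = (i \in A) :> nat.
Proof.
rewrite mnmDE mulmnE mnm1E mnm_sumE /= mul0n add0n.
case: (boolP (i \in A)) => iA.
  rewrite (bigD1 i) //= mnm1E eqxx big1 // => j /andP[_ ji].
  by rewrite mnm1E (inj_eq lift_inj) (negbTE ji).
rewrite big1 // => j jA; rewrite mnm1E (inj_eq lift_inj).
by case: eqP jA iA => // -> ->.
Qed.

Lemma sqfree_mon_ord0 c A : sqfree_mon c A ord0 = c.
Proof.
rewrite mnmDE mulmnE mnm1E mnm_sumE eqxx mul1n big1 ?addn0 // => j _.
by rewrite mnm1E.
Qed.

Lemma standard_sqfree_mon c A : standard (sqfree_mon c A).
Proof.
apply/standardP => i; case: (unliftP ord0 i) => [j ->|->]; last by rewrite eqxx.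
by rewrite sqfree_mon_lift; case: (_ \in _).
Qed.

Lemma standardE m : standard m ->
  m = sqfree_mon (m ord0) [set i | m (lift ord0 i) == 1%N].
Proof.
move/standardP => mS; apply/mnmP => i; case: (unliftP ord0 i) => [j ->|->].
  rewrite sqfree_mon_lift inE; have := mS (lift ord0 j) isT.
  by case: (m _) => [|[]].
by rewrite sqfree_mon_ord0.
Qed.

Definition standard_separated := forall s s',
  standard s -> standard s' -> wt s = wt s' -> s = s'.

Lemma card_sets : #|{set 'I_n}| = (2 ^ n)%N.
Proof. by rewrite -cardsT -powersetT card_powerset cardsT card_ord. Qed.

Definition sqfree_residue (A : {set 'I_n}) : 'I_e :=
  Ordinal (ltn_pmod (sqfree_wt A) (a_pos ord0)).

Lemma residue_inj_separated : injective sqfree_residue -> standard_separated.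
Proof.
move=> inj s s' /standardE-> /standardE->; rewrite !wt_sqfree_mon => E.
have AA : [set i | s (lift ord0 i) == 1%N] = [set i | s' (lift ord0 i) == 1%N].
  apply: inj; apply: val_inj => /=.
  by have := congr1 (modn^~ e) E; rewrite !modnMDl.
move: E; rewrite AA => /eqP; rewrite eqn_add2r eqn_pmul2r // => /eqP->//.
Qed.

(** Two subsets with congruent sums give, after multiplying one side by a power of x_0, two standard
    monomials of equal weight. So the subsets have distinct residues. *)
Lemma separated_mult_ge : standard_separated -> (2 ^ n <= e)%N.
Proof.
move=> sep; have inj : injective sqfree_residue.
  suff W A B : (sqfree_wt A <= sqfree_wt B)%N -> sqfree_residue A = sqfree_residue B -> A = B.
    move=> A B E; case: (leqP (sqfree_wt A) (sqfree_wt B)) => [/W|/ltnW/W] H; first exact: H.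
    by apply/esym/H.
  move=> le_AB [/eqP]; rewrite eq_sym eqn_mod_dvd // => /dvdnP[c E].
  have : sqfree_mon c A = sqfree_mon 0 B.
    apply: sep; rewrite ?standard_sqfree_mon // !wt_sqfree_mon -E mul0n add0n.
    by rewrite subnK.
  move=> EE; apply/setP => i; have := congr1 (fun m : 'X_{1..n.+1} => m (lift ord0 i)) EE.
  by rewrite /= !sqfree_mon_lift; case: (_ \in A); case: (_ \in B).
by have := leq_card _ inj; rewrite card_ord card_sets.
Qed.

Section Rewriting.
Context (K : fieldType) (r : 'I_n.+1 -> 'X_{1..n.+1}).
Local Notation S := {mpoly K[n.+1]}.
Hypothesis r_wt : forall i, i != ord0 -> wt (r i) = (a i * 2)%N.
Hypothesis r_deg : forall i, i != ord0 -> (2 <= mdeg (r i))%N.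
Hypothesis r_ne : forall i, i != ord0 -> r i != (U_(i) *+ 2)%MM.
Hypothesis a_cof : exists N, forall h, (N <= h)%N -> exists m, wt m = h.

Local Notation wt2 := (weight (fun i => a i ^ 2)%N).

(* Strict convexity of the square: a_j + a_k = 2 a_i with a_j <> a_k. *)
Lemma rule_wt2 i : i != ord0 -> mdeg (r i) = 2 -> (a i ^ 2 * 2 < wt2 (r i))%N.
Proof.
move=> i0 /mdeg2P[j [k E]]; have := r_wt i0; have := r_ne i0; rewrite E !wtD !wtU => ne S2.
have ajk : a j != a k.
  apply: contra ne => /eqP/gen_inj jk; move: S2; rewrite -jk => S2.
  have -> : i = j by apply: gen_inj; lia.
  exact/eqP.
move: (a i) (a j) (a k) S2 ajk => x y z S2 yz.
have [lt|lt|E'] := ltngtP y z; last by rewrite E' eqxx in yz.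
  have [d zE] : exists d, z = (y + d)%N by exists (z - y)%N; lia.
  by rewrite zE in S2 lt *; nia.
have [d zE] : exists d, y = (z + d)%N by exists (y - z)%N; lia.
by rewrite zE in S2 lt *; nia.
Qed.

Definition rule_binom i : S := 'X_[U_(i) *+ 2] - 'X_[r i].

Definition rule_ideal : S -> Prop :=
  ideal_gen (fun f => exists2 i, i != ord0 & f = rule_binom i).

Lemma not_standard m : ~~ standard m ->
  exists2 i, i != ord0 & exists u, m = (u + U_(i) *+ 2)%MM.
Proof.
case/forallPn => i; rewrite negb_imply -ltnNge => /andP[i0 mi]; exists i => //.
exists (m - U_(i) *+ 2)%MM; rewrite submK //; apply/mnm_lepP => j.
by rewrite mulmnE mnm1E; case: eqP => [<-|].
Qed.

(** Each rewriting step keeps the weight and strictly increases [Phi]: either the degree grows, or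
    it stays and the sum of squares grows by convexity. [Phi] is bounded in terms of the weight. *)
Lemma rewrite_standard u : exists s,
  [/\ standard s, wt s = wt u, (mdeg u <= mdeg s)%N & rule_ideal ('X_[u] - 'X_[s])].
Proof.
(* [B] exceeds twice the square of every generator, so one more degree outweighs any loss in
   [wt2]. *)
pose A := (\max_i a i)%N; pose B := (2 * A ^ 2).+1.
have aA i : (a i <= A)%N by apply: leq_bigmax.
pose Phi m := (B * mdeg m + wt2 m)%N.
have PhiD m m' : Phi (m + m')%MM = (Phi m + Phi m')%N.
  by rewrite /Phi mdegD wtD mulnDr; lia.
have Phi_le m : (Phi m <= (B + A ^ 2) * wt m)%N.
  rewrite mulnDl; apply: leq_add; first by rewrite leq_mul2l mdeg_le_wt ?orbT.
  apply: (@leq_trans (A ^ 2 * mdeg m)); last by rewrite leq_mul2l mdeg_le_wt ?orbT.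
  by apply: wt_le => i; rewrite leq_exp2r.
have Phi_lt i : i != ord0 -> (Phi (U_(i) *+ 2)%MM < Phi (r i))%N.
  move=> i0; rewrite /Phi mdegMn mdeg1 wtMn wtU mul1n.
  have := r_deg i0; rewrite leq_eqVlt => /orP[/eqP E|lt].
    by rewrite -E ltn_add2l rule_wt2.
  apply: (@leq_trans (B * 3)).
    have : (a i ^ 2 <= A ^ 2)%N by rewrite leq_exp2r.
    by rewrite /B; lia.
  by rewrite -[X in (X <= _)%N]addn0 leq_add // leq_mul2l lt orbT.
have [k] := ubnP ((B + A ^ 2) * wt u - Phi u)%N.
elim: k u => // k IH u; rewrite ltnS => uk.
have [su|/not_standard[i i0 [m mE]]] := boolP (standard u).
  by exists u; split=> //; rewrite subrr; apply: ideal_gen0.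
have wE : wt (m + r i)%MM = wt u by rewrite mE !wtD r_wt // !wtU; lia.
have [|s [ss sw sd sI]] := IH (m + r i)%MM.
  apply: leq_trans uk; rewrite wE; apply: ltn_sub2l; last first.
    by rewrite mE (PhiD m (r i)) (PhiD m (U_(i) *+ 2)%MM) ltn_add2l Phi_lt.
  rewrite -wE; apply: leq_trans (Phi_le (m + r i)%MM).
  by rewrite mE (PhiD m (r i)) (PhiD m (U_(i) *+ 2)%MM) ltn_add2l Phi_lt.
exists s; split=> //; first by rewrite sw wE.
  by apply: leq_trans sd; rewrite mE !mdegD leq_add2l !mdeg1 r_deg.
have -> : 'X_[K, u] - 'X_[s] = 'X_[m] * rule_binom i + ('X_[m + r i] - 'X_[s]).
  by rewrite mE /rule_binom mulrBr -!mpolyXD addrA subrK.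
by apply: ideal_genD sI; apply/ideal_genM/ideal_gen_in; exists i.
Qed.

(** A large element of the semigroup in the given class is rewritten to a standard monomial; without
    its power of x_0 the residue is a subset sum. *)
Lemma residue_surj (x : 'I_e) : exists A, sqfree_residue A = x.
Proof.
have [N HN] := a_cof; have [|m mw] := HN (N * e + x)%N.
  by rewrite (leq_trans (leq_pmulr N (a_pos ord0))) // leq_addr.
have [s [/standardE ss sw _ _]] := rewrite_standard m.
exists [set i | s (lift ord0 i) == 1%N]; apply: val_inj => /=.
have : wt s = (N * e + x)%N by rewrite sw.
rewrite {1}ss wt_sqfree_mon => /(congr1 (modn^~ e)); rewrite !modnMDl => ->.
by rewrite modn_small.
Qed.

Lemma mult_le_pow2 : (e <= 2 ^ n)%N.
Proof.
have [g gP] := fin_all_exists residue_surj.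
have inj : injective g by move=> x y E; rewrite -(gP x) E gP.
by have := leq_card _ inj; rewrite card_ord card_sets.
Qed.

Lemma mult_pow2_separated : e = (2 ^ n)%N -> standard_separated.
Proof.
move=> E; apply: residue_inj_separated.
have [g gP] := fin_all_exists residue_surj.
have inj : injective g by move=> x y E'; rewrite -(gP x) E' gP.
have [h hg gh] : bijective g.
  by apply: inj_card_bij inj _; rewrite card_ord card_sets E.
by move=> A B; rewrite -[A]gh -[B]gh !gP => ->.
Qed.

(** Rewriting does not lower the degree and ends in a standard monomial of the same weight, which
    can only be [s]. *)
Lemma separated_max_deg s : standard_separated -> standard s ->
  max_deg a (mdeg s) (wt s).
Proof.
move=> sep ss v vs; have [s' [ss' sw' vd _]] := rewrite_standard v.
by rewrite -(sep s' s) // sw'.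
Qed.

(** After rewriting all monomials of [f], the coefficient of a standard monomial is the sum of the
    coefficients of [f] of its weight, which is zero on the toric ideal. *)
Lemma separated_rule_ideal f : standard_separated ->
  sg_ideal (K := K) a f -> rule_ideal f.
Proof.
move=> sep /sg_idealP fI.
have exs m : exists s, standard s && (wt s == wt m).
  by have [s [ss sw _ _]] := rewrite_standard m; exists s; rewrite ss sw /=.
pose nf m := xchoose (exs m).
have nfP m : standard (nf m) /\ wt (nf m) = wt m.
  by have /andP[? /eqP] := xchooseP (exs m).
have nfI m : rule_ideal ('X_[m] - 'X_[nf m]).
  have [s [ss sw _ sI]] := rewrite_standard m.
  by have [ns nw] := nfP m; rewrite (sep (nf m) s) // nw sw.
have -> : f = \sum_(m <- msupp f) f@_m *: ('X_[m] - 'X_[nf m]).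
  under eq_bigr => m _ do rewrite scalerBr.
  rewrite sumrB -mpolyE [X in _ - X](_ : _ = 0) ?subr0 //.
  apply/mpolyP => u; rewrite raddf_sum mcoeff0 /=.
  have [su|su] := boolP (standard u); last first.
    rewrite big1 // => m _; rewrite mcoeffZ mcoeffX.
    case: eqP => [E|]; last by rewrite mulr0.
    by have [] := nfP m; rewrite E (negbTE su).
  rewrite -[RHS](fI (wt u)); apply: eq_bigr => m _; rewrite mcoeffZ mcoeffX.
  congr (_ * (nat_of_bool _)%:R); have [ns nw] := nfP m.
  by apply/eqP/eqP => [<-//|mu]; apply: sep; rewrite // nw.
apply: ideal_gen_sum => m _; rewrite -mul_mpolyC; apply: ideal_genM.
exact: nfI.
Qed.

End Rewriting.
End Squares.

(** * Quadrics and numbers of generators *)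

Section LowestDegree.
Context (K : fieldType) (n t : nat).
Local Notation S := {mpoly K[n]}.

(** Only the constant term of [p] can contribute in degree [t]. Thus the lowest degree part of an
    ideal is spanned by that of its generators. *)
Lemma pihomog_low (p g : S) : (forall m, m \in msupp g -> (t <= mdeg m)%N) ->
  pihomog mdeg t (p * g) = p@_0%MM *: pihomog mdeg t g.
Proof.
move=> gt; rewrite [p in LHS]mpolyE [g in LHS]mpolyE mulr_suml raddf_sum /=.
rewrite (bigID (pred1 0%MM)) /= [X in _ + X]big1_seq ?addr0; last first.
  move=> m /andP[m0 _]; rewrite mulr_sumr raddf_sum big1_seq //= => u ug.
  rewrite -scalerAl -scalerAr -mpolyXD !linearZ /= pihomogX ifN ?scaler0 //.
  by rewrite /= mdegD gtn_eqF // -addn1 addnC leq_add ?gt // lt0n mdeg_eq0.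
rewrite -[RHS]linearZ -mpolyE /=.
have [p0|p0] := boolP (0%MM \in msupp p).
  rewrite -big_filter filter_pred1_uniq ?msupp_uniq // big_seq1.
  by rewrite mpolyX0 -scalerAl mul1r.
rewrite big1_seq; first by rewrite (memN_msupp_eq0 p0) scale0r raddf0.
by move=> m /andP[/eqP-> pm]; rewrite pm in p0.
Qed.

End LowestDegree.

Section SpanExchange.
Context (K : fieldType) (V : lmodType K).

(** The coefficient matrix expressing the [f i] by the [g j] has independent rows; if it is square,
    it can be inverted. *)
Lemma span_exchange k l (f : 'I_k -> V) (g : 'I_l -> V) :
  (forall c : 'I_k -> K, \sum_i c i *: f i = 0 -> forall i, c i = 0) ->
  (forall i, exists c : 'I_l -> K, f i = \sum_j c j *: g j) ->
  (k <= l)%N /\ (k = l -> forall j, exists c : 'I_k -> K, g j = \sum_i c i *: f i).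
Proof.
move=> f_free fg; have [c cP] := fin_all_exists fg.
pose C : 'M[K]_(k, l) := \matrix_(i, j) c i j.
have C_free : row_free C.
  rewrite -kermx_eq0; apply/eqP/row_matrixP => i0; rewrite row0.
  suff ker0 (u : 'rV[K]_k) : u *m C = 0 -> u = 0.
    by apply: ker0; rewrite -row_mul mulmx_ker row0.
  move=> uC; apply/rowP => i; rewrite mxE; apply: (f_free (fun i => u 0 i)).
  under eq_bigr => j _ do rewrite cP scaler_sumr.
  rewrite exchange_big /= big1 // => j _.
  under eq_bigr => i' _ do rewrite scalerA.
  rewrite -scaler_suml.
  have := congr1 (fun M : 'rV_l => M 0 j) uC; rewrite !mxE => E.
  rewrite (eq_bigr (fun i => u 0 i * C i j)) ?E ?scale0r // => i' _.
  by rewrite mxE.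
split; first by rewrite -(eqP C_free) rank_leq_col.
have CE i j : C i j = c i j by rewrite mxE.
move=> kl; case: l / kl g fg c cP C C_free CE => g fg c cP C C_free CE j.
exists (fun i => invmx C j i).
under eq_bigr => i _ do rewrite cP scaler_sumr.
rewrite exchange_big /=.
have Cu : C \in unitmx by rewrite -row_free_unit.
under eq_bigr => j' _.
  under eq_bigr => i _ do rewrite scalerA.
  rewrite -scaler_suml (_ : \sum_i _ = (invmx C *m C) j j'); last first.
    by rewrite mxE; apply: eq_bigr => i _; rewrite CE.
  rewrite mulVmx // mxE.
  over.
rewrite (bigD1 j) //= eqxx scale1r big1 ?addr0 // => j' jj'.
by rewrite eq_sym (negbTE jj') scale0r.
Qed.

End SpanExchange.

Section Quadrics.
Context (K : fieldType) (n : nat) (a : 'I_n.+1 -> nat).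
Local Notation S := {mpoly K[n.+1]}.
Local Notation wt := (weight a).
Local Notation e := (a ord0).
Local Notation I := (sg_ideal (K := K) a).
Local Notation Is := (initial_ideal I).
Implicit Types (m u v s : 'X_{1..n.+1}) (f g : S).
Hypothesis a_pos : forall i, (0 < a i)%N.
Hypothesis a_gen : forall i m, wt m = a i -> m = U_(i)%MM.
Hypothesis a_inc : forall i j : 'I_n.+1, (i < j)%N -> (a i < a j)%N.
Hypothesis a_cof : exists N, forall h, (N <= h)%N -> exists m, wt m = h.
Hypothesis Is_quad : quadratic_ideal Is.

(** Without such [r], the coefficient at x_i^2 is a functional vanishing on the initial ideal. Then
    no quadratic generator contains x_i^2 and no combination of them contains x_i^e, although x_i^e
    lies in the ideal. *)
Lemma quadratic_square i : i != ord0 ->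
  exists r, [/\ wt r = (a i * 2)%N, (2 <= mdeg r)%N & r != (U_(i) *+ 2)%MM].
Proof.
move=> i0; apply: NNPP => no_r.
have sq0 f : Is f -> f@_(U_(i) *+ 2)%MM = 0.
  move=> If; rewrite mcoeff_msum.
  have top : max_deg a 2 (a i * 2)%N.
    move=> v vw; rewrite leqNgt; apply/negP => v3; apply: no_r; exists v.
    split=> //; first exact: ltnW.
    by apply: contraTneq v3 => ->; rewrite mdegMn mdeg1.
  rewrite -[RHS](msum_initial_ideal top If); apply: eq_msum => u _.
  congr (nat_of_bool _)%:R; apply/eqP/andP => [->|[/eqP u2 /eqP uw]].
    by rewrite mdegMn mdeg1 wtMn wtU.
  by apply/eqP; apply: contraT => ne; case: no_r; exists u; rewrite u2.
have [P [Phom PE]] := Is_quad.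
have : Is 'X_[U_(i) *+ e].
  apply: (@initial_ideal_mono _ _ _ _ (U_(ord0) *+ a i)%MM).
    by rewrite !wtMn !wtU mulnC.
  by rewrite !mdegMn !mdeg1 !mul1n gen_gt_mult.
move/PE/(@msum_ideal_gen _ _ _ (fun u => (u == U_(i) *+ e)%MM%:R)).
rewrite msumX eqxx => H; suff /eqP : (1 : K) = 0 by rewrite oner_eq0.
apply: H => g m Pg; rewrite -mcoeff_msum; apply: memN_msupp_eq0.
apply/negP => /msuppM_le/allpairsP[/= [x y] [/= _ yg E]].
have /= y2 := dhomogP _ _ _ (Phom _ Pg) _ yg.
suff yE : y = (U_(i) *+ 2)%MM.
  move: yg; rewrite yE mcoeff_msupp sq0 ?eqxx //.
  by apply/PE/ideal_gen_in.
have yj j : j != i -> y j = 0%N.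
  move=> ji; have := congr1 (fun m : 'X_{1..n.+1} => m j) E.
  by rewrite mnmDE mulmnE mnm1E eq_sym (negbTE ji) mul0n => /esym/eqP; rewrite addn_eq0 => /andP[_ /eqP].
apply/mnmP => j; rewrite mulmnE mnm1E.
have [<-|ij] := eqVneq i j; last by rewrite yj // eq_sym.
rewrite mul1n -y2 mdegE (bigD1 i) //= big1 ?addn0 // => l; exact: yj.
Qed.

Context (r : 'I_n.+1 -> 'X_{1..n.+1}).
Hypothesis r_wt : forall i, i != ord0 -> wt (r i) = (a i * 2)%N.
Hypothesis r_deg : forall i, i != ord0 -> (2 <= mdeg (r i))%N.
Hypothesis r_ne : forall i, i != ord0 -> r i != (U_(i) *+ 2)%MM.

(** The initial form of the binomial x_i^2 - x^(r i): the second term counts only if it has degree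
    2. *)
Definition square_form i : S :=
  'X_[U_(i) *+ 2] - (if mdeg (r i) == 2 then 'X_[r i] else 0).

Lemma square_form_in i : i != ord0 -> Is (square_form i).
Proof.
move=> i0; rewrite /square_form; case: eqP => [r2|/eqP r2].
  by apply: initial_ideal_binom; rewrite ?wtMn ?wtU ?r_wt // mdegMn mdeg1 r2.
rewrite subr0; apply: (@initial_ideal_mono _ _ _ _ (r i)).
  by rewrite wtMn wtU r_wt.
by rewrite mdegMn mdeg1 mul1n ltn_neqAle eq_sym r2 r_deg.
Qed.

Lemma square_form_homog i : square_form i \is 2.-homog.
Proof.
rewrite /square_form rpredB ?dhomogX /= ?mdegMn ?mdeg1 //.
by case: eqP => r2; rewrite ?dhomogX /= ?r2 ?eqxx ?rpred0.
Qed.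

Lemma square_form_coeff i j : i != ord0 ->
  (square_form i)@_(U_(j) *+ 2)%MM = (i == j)%:R.
Proof.
move=> i0; rewrite /square_form mcoeffB mcoeffX.
have -> : (U_(i) *+ 2 == U_(j) *+ 2)%MM = (i == j).
  apply/eqP/eqP => [/mnmP/(_ i)|->//]; rewrite !mulmnE !mnm1E eqxx.
  by case: eqP.
rewrite [X in _ - X](_ : _ = 0) ?subr0 //.
case: ifP => _; last by rewrite mcoeff0.
rewrite mcoeffX; case: eqP => // E.
have := r_wt i0; rewrite E wtMn wtU => /eqP; rewrite eqn_pmul2r // => /eqP/(gen_inj a_inc) ij.
by have := r_ne i0; rewrite E ij eqxx.
Qed.

Lemma square_form_free (c : 'I_n -> K) :
  \sum_i c i *: square_form (lift ord0 i) = 0 -> forall i, c i = 0.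
Proof.
move=> E i; have := congr1 (mcoeff (U_(lift ord0 i) *+ 2)%MM) E.
rewrite raddf_sum mcoeff0 (bigD1 i) //= mcoeffZ square_form_coeff // eqxx mulr1.
rewrite big1 ?addr0 // => j ji.
by rewrite mcoeffZ square_form_coeff // (inj_eq lift_inj) (negbTE ji) mulr0.
Qed.

(** In degree 2 the initial forms of degree 2 enter with constant coefficients only, so the same
    combination of the underlying elements is a lift. *)
Lemma initial_quadric_lift f : Is f -> f \is 2.-homog ->
  exists2 g, I g & f = pihomog mdeg 2 g.
Proof.
have [I0 [ID IM]] := sg_ideal_is_ideal K a.
move=> [k [p [g [gP E]]]] f2; rewrite -(pihomog_dE f2) E raddf_sum /=.
have [h hP] : exists h : 'I_k -> S, forall i, I (h i) /\ pihomog mdeg 2 (g i) = pihomog mdeg 2 (h i).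
  apply: (@fin_all_exists _ _ (fun i h => I h /\ pihomog mdeg 2 (g i) = pihomog mdeg 2 h)) => i.
  have [h [Ih [_ gE]]] := gP i; rewrite gE /initial_form.
  have [->|ne] := eqVneq (low_deg h) 2%N; first by exists h; rewrite pihomog_id.
  (* An initial form of another degree has no part of degree 2, so 0 serves as its lift. *)
  exists 0; split=> //; rewrite raddf0; apply: pihomog_ne0 ne _.
  exact: pihomogP.
exists (\sum_i (p i)@_0%MM *: h i).
  elim/big_ind: _ => // i _; rewrite -mul_mpolyC; apply: IM.
  by case: (hP i).
rewrite raddf_sum; apply: eq_bigr => i _ /=; rewrite linearZ /=.
have [_ <-] := hP i; apply: pihomog_low => m.
apply: (initial_ideal_mdeg a_pos a_gen).
by apply: ideal_gen_in; apply: gP.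
Qed.

Section Generators.
Context (J : S -> Prop) (k : nat) (g : 'I_k -> S).
Hypothesis JI : J = I \/ J = Is.
Hypothesis Jg : generated_by J (fun x => exists i, x = g i).

Lemma quadric_in_span f : Is f -> f \is 2.-homog ->
  exists c : 'I_k -> K, f = \sum_i c i *: pihomog mdeg 2 (g i).
Proof.
move=> If f2.
have Jdeg h m : J h -> m \in msupp h -> (2 <= mdeg m)%N.
  by case: JI => ->; [apply: sg_ideal_mdeg|apply: initial_ideal_mdeg].
have [h Jh ->] : exists2 h, J h & f = pihomog mdeg 2 h.
  case: JI => ->; first exact: initial_quadric_lift.
  by exists f; rewrite ?pihomog_dE.
have /ideal_gen_finP[p ->] := (Jg h).1 Jh.
exists (fun i => (p i)@_0%MM); rewrite raddf_sum; apply: eq_bigr => i _ /=.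
apply: pihomog_low => m; apply: Jdeg.
by apply/Jg/ideal_gen_in; exists i.
Qed.

(** The [n] independent square forms lie in the span of the degree 2 parts of the [k] generators, so
    [span_exchange] applies. *)
Lemma num_gens_ge : (n <= k)%N /\
  (n = k -> forall f, Is f -> f \is 2.-homog ->
     exists c : 'I_n -> K, f = \sum_i c i *: square_form (lift ord0 i)).
Proof.
have [|le_nk ex] := span_exchange square_form_free
   (g := fun i => pihomog mdeg 2 (g i)).
  move=> i; apply: quadric_in_span; [exact: square_form_in|exact: square_form_homog].
split=> // nk f If f2; have [c ->] := quadric_in_span If f2.
have [d dP] := fin_all_exists (ex nk).
exists (fun i => \sum_j c j * d j i).
under eq_bigr => j _ do rewrite dP scaler_sumr.
rewrite exchange_big; apply: eq_bigr => i _ /=.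
by rewrite scaler_suml; apply: eq_bigr => j _; rewrite scalerA.
Qed.

End Generators.

Lemma quadric_span_generated :
  (forall f, Is f -> f \is 2.-homog ->
     exists c : 'I_n -> K, f = \sum_i c i *: square_form (lift ord0 i)) ->
  generated_by Is (fun x => exists i : 'I_n, x = square_form (lift ord0 i)).
Proof.
move=> span; have [P [Phom PE]] := Is_quad.
move=> f; split.
  move/PE; apply: ideal_gen_sub => p Pp.
  have [|c ->] := span p _ (Phom p Pp); first by apply/PE/ideal_gen_in.
  apply: ideal_gen_sum => i _; rewrite -mul_mpolyC; apply/ideal_genM/ideal_gen_in.
  by exists i.
apply: ideal_gen_sub => p [i ->]; exact: square_form_in.
Qed.

(** Subtracting square forms removes every x_i^2 with i > 0. The remainder has only standard
    monomials; each is alone in its weight and of maximal degree there, so its coefficient is a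
    functional that vanishes. *)
Lemma separated_quadric_span : standard_separated a ->
  forall f, Is f -> f \is 2.-homog ->
  exists c : 'I_n -> K, f = \sum_i c i *: square_form (lift ord0 i).
Proof.
move=> sep f If f2.
exists (fun i => f@_(U_(lift ord0 i) *+ 2)%MM).
pose f' := f - \sum_i f@_(U_(lift ord0 i) *+ 2)%MM *: square_form (lift ord0 i).
suff f'0 : f' = 0 by apply/eqP; rewrite -subr_eq0; apply/eqP.
have f'I : Is f'.
  apply: ideal_genB => //; apply: ideal_gen_sum => i _.
  by rewrite -mul_mpolyC; apply/ideal_genM/square_form_in.
have f'2 : f' \is 2.-homog.
  by rewrite rpredB // rpred_sum // => i _; rewrite rpredZ // square_form_homog.
have f'std m : m \in msupp f' -> standard m.
  move=> mf; apply: contraT => /not_standard[i i0 [u uE]].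
  have /= m2 := dhomogP _ _ _ f'2 _ mf.
  have u0 : u = 0%MM.
    by apply/eqP; rewrite -mdeg_eq0; move: m2; rewrite uE mdegD mdegMn mdeg1; lia.
  move: mf i0; rewrite uE u0 add0m mcoeff_msupp.
  case: (unliftP ord0 i) => [j ->|->]; last by rewrite eqxx.
  rewrite mcoeffB raddf_sum (bigD1 j) //= mcoeffZ square_form_coeff // eqxx mulr1.
  rewrite big1 ?addr0 ?subrr ?eqxx // => l lj.
  by rewrite mcoeffZ square_form_coeff // (inj_eq lift_inj) (negbTE lj) mulr0.
apply: msuppnil0; case E: (msupp f') => [//|m l].
have mf : m \in msupp f' by rewrite E mem_head.
have := mf; rewrite mcoeff_msupp mcoeff_msum.
have top := separated_max_deg a_pos a_inc K r_wt r_deg r_ne sep (f'std _ mf).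
rewrite -[X in _ != X](msum_initial_ideal top f'I).
rewrite (@eq_msum _ _ _ (deg_wt K a (mdeg m) (wt m))) ?eqxx // => u uf.
congr (nat_of_bool _)%:R; apply/eqP/andP => [->//|[_ /eqP uw]].
by apply: sep => //; apply: f'std.
Qed.

End Quadrics.

(** * Confluence of the square rules *)

Section NormalForm.
Context (n : nat) (a : 'I_n.+1 -> nat) (r : 'I_n.+1 -> 'X_{1..n.+1}).
Local Notation wt := (weight a).
Implicit Types (m u v s : 'X_{1..n.+1}).
Hypothesis a_inc : forall i j : 'I_n.+1, (i < j)%N -> (a i < a j)%N.
Hypothesis r_wt : forall i, i != ord0 -> wt (r i) = (a i * 2)%N.
Hypothesis r_ne : forall i, i != ord0 -> r i != (U_(i) *+ 2)%MM.
Local Notation wt2 := (weight (fun i => a i ^ 2)%N).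

Definition reducible u i := (i != ord0) && (1 < u i)%N.

Definition reduct u i := (u - U_(i) *+ 2 + r i)%MM.

Lemma reducibleE u i : reducible u i -> u = (u - U_(i) *+ 2 + U_(i) *+ 2)%MM.
Proof.
move=> /andP[_ ui]; rewrite submK //; apply/mnm_lepP => j.
by rewrite mulmnE mnm1E; case: eqP => [<-|].
Qed.

(* [None] is the zero normal form, reached when x_i^2 itself lies in the initial
   ideal. *)
Fixpoint fuel_nf k u : option 'X_{1..n.+1} :=
  if [pick i | reducible u i] is Some i then
    if mdeg (r i) == 2 then
      if k is k'.+1 then fuel_nf k' (reduct u i) else None
    else None
  else Some u.

(** Sufficient fuel: rules of degree 2 preserve the degree and strictly increase [wt2], which never
    exceeds the first term. *)
Definition nf_height u := ((\max_i a i) ^ 2 * mdeg u - wt2 u)%N.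

Definition normal_form u := fuel_nf (nf_height u) u.

Lemma nf_height_reduct u i : reducible u i -> mdeg (r i) == 2 ->
  (nf_height (reduct u i) < nf_height u)%N.
Proof.
move=> ui /eqP r2; have /andP[i0 _] := ui.
have wt2_le v : (wt2 v <= (\max_i a i) ^ 2 * mdeg v)%N.
  by apply: wt_le => j; rewrite leq_exp2r //; apply: leq_bigmax.
have := wt2_le (reduct u i); rewrite /nf_height /reduct.
have := reducibleE ui; set v := (u - U_(i) *+ 2)%MM => uE.
have -> : mdeg u = (mdeg v + 2)%N by rewrite uE mdegD mdegMn mdeg1.
have -> : wt2 u = (wt2 v + a i ^ 2 * 2)%N by rewrite uE wtD wtMn wtU.
have := rule_wt2 a_inc r_wt r_ne i0 r2.
by rewrite mdegD wtD r2; lia.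
Qed.

Lemma fuel_nf_stable k k' u : (nf_height u <= k)%N -> (nf_height u <= k')%N ->
  fuel_nf k u = fuel_nf k' u.
Proof.
elim: k k' u => [|k IH] [|k'] u uk uk' //=; case: pickP => // i ui;
  case: ifP => // r2; have := nf_height_reduct ui r2; try lia.
by move=> lt; apply: IH; lia.
Qed.

Lemma normal_form_standard u : standard u -> normal_form u = Some u.
Proof.
move/standardP => su; rewrite /normal_form.
have irr : reducible u =1 pred0.
  move=> i; rewrite /reducible; case: eqVneq => //= /su.
  by rewrite ltnNge => ->.
by case: (nf_height u) => [|k] /=; case: pickP => // i; rewrite irr.
Qed.

(* Confluence: reductions at distinct variables commute. *)
Lemma normal_form_reduct u i : reducible u i ->
  normal_form u = if mdeg (r i) == 2 then normal_form (reduct u i) else None.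
Proof.
have [k] := ubnP (nf_height u); elim: k u i => // k IH u i; rewrite ltnS => uk ui.
(* [p] is the variable picked by [fuel_nf]. If it is not [i], the two reductions are joined by
   applying the other rule next. *)
have [p up ->] : exists2 p, reducible u p &
    normal_form u = if mdeg (r p) == 2 then normal_form (reduct u p) else None.
  case P: [pick i | reducible u i] => [p|]; last first.
    by move: P; case: pickP => // irr; rewrite irr in ui.
  have up : reducible u p by move: P; case: pickP => // q uq [<-].
  exists p; rewrite // /normal_form; case E: (nf_height u) => [|l] /=; rewrite P.
    by case: ifP => // /(nf_height_reduct up); rewrite E.
  case: ifP => // /(nf_height_reduct up); rewrite E => lt.
  by apply: fuel_nf_stable; rewrite // -ltnS.
have [->//|pi] := eqVneq p i.
have redC q l : reducible u l -> q != l -> reducible (reduct u q) l.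
  move=> /andP[l0 ul] ql; rewrite /reducible l0 /= mnmDE mnmBE mulmnE mnm1E.
  by rewrite (negbTE ql) mul0n subn0 ltn_addr.
have IHr q l : reducible u q -> mdeg (r q) == 2 -> reducible (reduct u q) l ->
    normal_form (reduct u q) = if mdeg (r l) == 2
      then normal_form (reduct (reduct u q) l) else None.
  by move=> uq rq; apply: IH; apply: leq_trans uk; apply: nf_height_reduct.
(* Each rule removes only its own square and otherwise adds exponents, so the order does not
   matter. *)
have comm : reduct (reduct u p) i = reduct (reduct u i) p.
  move/andP: up => [_ up]; move/andP: ui => [_ ui].
  apply/mnmP => l; rewrite !(mnmDE, mnmBE, mulmnE, mnm1E).
  move: pi up ui; case: (p =P l) => [->|_]; case: (i =P l) => [->|_]; rewrite ?eqxx //; lia.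
have ip : i != p by rewrite eq_sym.
case: ifP => rp.
  rewrite (IHr p i) ?redC //; case: ifP => // ri.
  by rewrite comm (IHr i p) ?redC // rp.
by case: ifP => // ri; rewrite (IHr i p) ?redC // rp.
Qed.

Lemma normal_formD u i : i != ord0 ->
  normal_form (u + U_(i) *+ 2)%MM =
  if mdeg (r i) == 2 then normal_form (u + r i)%MM else None.
Proof.
move=> i0; rewrite (@normal_form_reduct _ i) ?/reduct ?addmK //.
by rewrite /reducible i0 mnmDE mulmnE mnm1E eqxx addn2.
Qed.

Section Separation.
Context (K : fieldType).
Local Notation S := {mpoly K[n.+1]}.
Local Notation Is := (initial_ideal (sg_ideal (K := K) a)).
Hypothesis Is_gen :
  generated_by Is (fun x => exists i : 'I_n, x = square_form K r (lift ord0 i)).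

Definition nf_coeff s u : K := (normal_form u == Some s)%:R.

(** By confluence the normal form is unchanged by any rule applied anywhere, so [nf_coeff s] kills
    all monomial multiples of the square forms. *)
Lemma nf_coeff_initial_ideal s f : Is f -> msum (nf_coeff s) f = 0.
Proof.
move/Is_gen; apply: msum_ideal_gen => _ m [i ->].
rewrite /square_form mulrBr raddfB /= -mpolyXD msumX /nf_coeff normal_formD //.
case: ifP => _; first by rewrite -mpolyXD msumX subrr.
by rewrite mulr0 (raddf0 (msum _)) subr0.
Qed.

(** Standard monomials are their own normal forms, so the initial ideal contains neither one of them
    nor a difference of two distinct ones. Two distinct standard monomials of equal weight would put
    one of these into it. *)
Lemma complete_intersection_separated : standard_separated a.
Proof.
move=> s s' ss ss' E.
have notI u : standard u -> ~ Is 'X_[u].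
  move=> su /(nf_coeff_initial_ideal u) /eqP.
  by rewrite msumX /nf_coeff normal_form_standard // eqxx oner_eq0.
have d : mdeg s = mdeg s'.
  case: (ltngtP (mdeg s) (mdeg s')) => // lt.
    by case: (notI s ss); apply: initial_ideal_mono E lt.
  by case: (notI s' ss'); apply: initial_ideal_mono (esym E) lt.
have := nf_coeff_initial_ideal s (initial_ideal_binom K E d).
rewrite raddfB /= !msumX /nf_coeff !normal_form_standard // eqxx.
by case: eqP => [[->]//|_] /eqP; rewrite subr0 oner_eq0.
Qed.

End Separation.
End NormalForm.

(** * The heights of the toric ideal and of its initial ideal *)

Section Heights.
Context (K : fieldType) (n : nat) (a : 'I_n.+1 -> nat).
Local Notation S := {mpoly K[n.+1]}.
Local Notation I := (sg_ideal (K := K) a).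
Local Notation Is := (initial_ideal I).
Hypothesis n_pos : (0 < n)%N.
Hypothesis a_pos : forall i, (0 < a i)%N.
Hypothesis a_inc : forall i j : 'I_n.+1, (i < j)%N -> (a i < a j)%N.

Lemma prime_height_ext (P Q : S -> Prop) h :
  (forall x, P x <-> Q x) -> prime_height P h -> prime_height Q h.
Proof.
move=> PQ [[C [Cp [Cs CP]]] max]; split.
  by exists C; split=> //; split=> // x; rewrite CP.
move=> C' k [Cp' [Cs' CQ]]; apply: (max C'); split=> //; split=> // x.
by rewrite CQ PQ.
Qed.

(** In a chain of length [h] ending at [P], the last term can be replaced by any prime containing
    [P]. *)
Lemma prime_ideal_height (P : S -> Prop) h :
  prime_ideal P -> (0 < h)%N -> prime_height P h -> ideal_height P h.
Proof.
move=> Pp h0 Ph; split; first by exists P.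
move=> Q h' Qp PQ [_ max]; have [[C [Cp [Cs CP]]] _] := Ph.
apply: (max (fun i => if (i < h)%N then C i else Q)); split; last split.
- by move=> i _; case: ifP => // ih; apply: Cp; apply: ltnW.
- move=> i ih; rewrite ih; case: ifP => [ih'|]; first exact: Cs.
  move/negbT; rewrite -leqNgt => hi.
  have E : i.+1 = h by apply/eqP; rewrite eqn_leq ih.
  have [CC [x [Cx nCx]]] := Cs i ih; rewrite E in CC Cx.
  by split=> [y /CC/CP/PQ//|]; exists x; split=> //; apply/PQ/CP.
- by move=> x; rewrite ltnn.
Qed.

Lemma sg_ideal_prime : prime_ideal I.
Proof. exact: (@prime_kernel _ _ (sg_map a : {rmorphism S -> _})). Qed.

(** The toric ideal is the kernel of the substitution of x_0^(a_j) for x_j, so [curve_height] gives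
    its height. *)
Lemma sg_ideal_height : ideal_height I n.
Proof.
apply: prime_ideal_height => //; first exact: sg_ideal_prime.
have := @curve_height K n (fun=> 1) a erefl (a_pos ord0) _.
have a0 j : a j = 0%N -> (1 : K) = 0 by move=> E; have := a_pos j; rewrite E.
move=> /(_ a0); apply: prime_height_ext => f.
pose cv : 'I_n.+1 -> S := curve_var (fun=> 1 : K) a.
rewrite -/cv.
have mono m : mmap1 cv m = 'X_[U_(ord0) *+ weight a m].
  rewrite /mmap1 -mpolyXn /weight.
  rewrite (big_morph _ (exprD _) (expr0 _)); apply: eq_bigr => i _.
  by rewrite /cv /curve_var scale1r -mpolyXn -exprM mulnC.
have cf g w : (mmap (@mpolyC n.+1 K) cv g)@_(U_(ord0) *+ w)%MM =
    msum (fun m => (weight a m == w)%:R) g.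
  rewrite /mmap raddf_sum; apply: eq_bigr => m _ /=.
  rewrite mono mcoeffCM mcoeffX; congr (_ * (nat_of_bool _)%:R).
  apply/eqP/eqP => [/mnmP/(_ ord0)|->//].
  by rewrite !mulmnE mnm1E eqxx !mul1n.
split=> [E|/sg_idealP E].
  by apply/sg_idealP => w; rewrite -cf E mcoeff0.
transitivity (\sum_(m <- msupp f) f@_m *: ('X_[K, U_((ord0 : 'I_n.+1)) *+ weight a m])).
  by apply: eq_bigr => m _; rewrite mono mul_mpolyC.
apply/mpolyP => u; rewrite mcoeff0 raddf_sum /=.
have [uE|uE] := eqVneq u (U_(ord0) *+ u ord0)%MM.
  rewrite -[RHS](E (u ord0)); apply: eq_bigr => m _; rewrite mcoeffZ mcoeffX.
  congr (_ * (nat_of_bool _)%:R); apply/eqP/eqP => [<-|->]; last by rewrite -uE.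
  by rewrite mulmnE mnm1E eqxx mul1n.
rewrite big1 // => m _; rewrite mcoeffZ mcoeffX; case: ((U_(ord0) *+ weight a m)%MM =P u) uE => [<-|]; last by rewrite mulr0.
by rewrite mulmnE mnm1E eqxx mul1n eqxx.
Qed.

(** The prime ideal of the x_0-axis, generated by the other variables, in the form required by
    [curve_height]. *)
Definition axis_ideal (f : S) : Prop :=
  mmap (@mpolyC n.+1 K)
    (curve_var (fun i => (i == ord0)%:R : K) (fun=> 1%N)) f = 0.

(** The axis ideal is the least prime over the initial ideal: the latter contains x_i^e for i > 0,
    and none of its elements involves a pure power of x_0. *)
Lemma initial_ideal_height : ideal_height Is n.
Proof.
have axh : prime_height axis_ideal n.
  by apply: curve_height; rewrite ?eqxx.
have axp : prime_ideal axis_ideal.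
  exact: (@prime_kernel _ _ (mmap (@mpolyC n.+1 K) _ : {rmorphism S -> S})).
have [axi [ax1 axm]] := axp.
pose cv : 'I_n.+1 -> S := curve_var (fun i => (i == ord0)%:R : K) (fun=> 1%N).
have mono m : mmap1 cv m = (m == U_(ord0) *+ m ord0)%MM%:R *: 'X_[U_(ord0) *+ m ord0].
  have [mE|mE] := eqVneq m (U_(ord0) *+ m ord0)%MM.
    rewrite scale1r /mmap1 (bigD1 ord0) //= big1 ?mulr1 => [|i i0].
      by rewrite /cv /curve_var eqxx scale1r mpolyXn mulm1n.
    by rewrite mE mulmnE mnm1E eq_sym (negbTE i0) mul0n expr0.
  rewrite scale0r /mmap1.
  have [i i0 mi] : exists2 i, i != ord0 & m i != 0%N.
    apply: NNPP => no; move/eqP: mE; apply; apply/mnmP => i.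
    rewrite mulmnE mnm1E; have [<-|i0] := eqVneq ord0 i; first by rewrite mul1n.
    rewrite mul0n; apply/eqP; apply: contraT => mi; case: no; exists i => //.
    by rewrite eq_sym.
  rewrite (bigD1 i) //= /cv /curve_var (negbTE i0) scale0r expr0n (negbTE mi).
  by rewrite mul0r.
have axisP f : axis_ideal f <-> forall c, f@_(U_(ord0) *+ c)%MM = 0.
  have axE u : (mmap (@mpolyC n.+1 K) cv f)@_u =
      (u == U_(ord0) *+ u ord0)%MM%:R * f@_u.
    rewrite /mmap raddf_sum /= [f@_u]mcoeff_msum /msum mulr_sumr.
    apply: eq_bigr => m _; rewrite mono mcoeffCM mcoeffZ mcoeffX [RHS]mulrCA.
    congr (_ * _); rewrite -!natrM !mulnb; congr (nat_of_bool _)%:R.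
    apply/andP/andP => [[/eqP mE /eqP mu]|[/eqP uE /eqP mu]].
      by rewrite -mu -mE eqxx; split=> //; rewrite {1}mE.
    by rewrite mu -uE !eqxx.
  split=> [f0 c|fc].
    have := axE (U_(ord0) *+ c)%MM; rewrite [mmap _ _ _]f0 mcoeff0.
    by rewrite mulmnE mnm1E eqxx mul1n eqxx mul1r.
  apply/mpolyP => u; rewrite axE mcoeff0; case: eqP => [->|_]; last by rewrite mul0r.
  by rewrite fc mulr0.
have axP (Q : S -> Prop) : prime_ideal Q -> (forall x, Is x -> Q x) ->
    forall x, axis_ideal x -> Q x.
  move=> Qp IQ x /axisP xc; have [[Q0 [QD QM]] _] := Qp.
  have QX i : i != ord0 -> Q 'X_i.
    move=> i0; apply: (@prime_idealX _ _ _ (a ord0) Qp).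
    rewrite mpolyXn; apply: IQ.
    apply: (@initial_ideal_mono _ _ _ _ (U_(ord0) *+ a i)%MM).
      by rewrite !wtMn !wtU mulnC.
    by rewrite !mdegMn !mdeg1 !mul1n; apply: gen_gt_mult.
  rewrite [x]mpolyE big_seq; elim/big_ind: _ => // m mx.
  have [i i0 mi] : exists2 i, i != ord0 & m i != 0%N.
    apply: NNPP => no; move: mx; rewrite mcoeff_msupp => /eqP; apply.
    suff -> : m = (U_(ord0) *+ m ord0)%MM by apply: xc.
    apply/mnmP => i; rewrite mulmnE mnm1E; have [<-|i0] := eqVneq ord0 i.
      by rewrite mul1n.
    rewrite mul0n; apply/eqP; apply: contraT => mi; case: no; exists i => //.
    by rewrite eq_sym.
  rewrite -lep1mP in mi; rewrite -(submK mi) mpolyXD -mul_mpolyC mulrA.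
  by apply: QM; apply: QX.
have IsAx x : Is x -> axis_ideal x.
  move=> Ix; apply/axisP => c; rewrite mcoeff_msum.
  have a_ge i : (a ord0 <= a i)%N.
    by have [->//|/(gen_gt_mult a_inc)/ltnW] := eqVneq i ord0.
  (* Equality holds only for powers of x_0, so x_0^c is the only monomial of its weight and degree,
     and this degree is maximal. *)
  have wt_ge u : (a ord0 * mdeg u <= weight a u)%N.
    rewrite mdegE big_distrr; apply: leq_sum => i _.
    by rewrite /= mulnC leq_mul2l a_ge orbT.
  have top : max_deg a c (a ord0 * c)%N.
    move=> v vw; rewrite -(@leq_pmul2l (a ord0)) // -vw; exact: wt_ge.
  rewrite -[RHS](msum_initial_ideal top Ix); apply: eq_msum => u _.
  congr (nat_of_bool _)%:R; apply/eqP/andP => [->|[/eqP uc /eqP uw]].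
    by rewrite mdegMn mdeg1 wtMn wtU mul1n !eqxx.
  have u0 i : i != ord0 -> u i = 0%N.
    move=> i0; apply/eqP; apply: contraT => ui.
    have : (U_(i) <= u)%MM by rewrite lep1mP.
    move/submK => uE; have := wt_ge (u - U_(i))%MM.
    have := gen_gt_mult a_inc i0.
    have : mdeg u = (mdeg (u - U_(i)) + 1)%N by rewrite -{1}uE mdegD mdeg1.
    have : weight a u = (weight a (u - U_(i)) + a i)%N by rewrite -{1}uE wtD wtU.
    by rewrite uc uw; nia.
  apply/mnmP => i; rewrite mulmnE mnm1E; have [<-|i0] := eqVneq ord0 i.
    by rewrite -uc mdegE (bigD1 ord0) //= big1 ?addn0 ?mul1n // => j; apply: u0.
  by rewrite u0 // eq_sym.
split; first by exists axis_ideal; split=> //; split.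
move=> Q h' Qp IQ Qh.
have [_ H] := prime_ideal_height axp n_pos axh.
exact: H _ _ Qp (axP _ Qp IQ) Qh.
Qed.

End Heights.

(** * The two directions of (b) *)

Section HilbertFunction.
Context (K : fieldType) (n : nat) (a : 'I_n.+1 -> nat).
Local Notation S := {mpoly K[n.+1]}.
Local Notation wt := (weight a).
Local Notation e := (a ord0).
Local Notation I := (sg_ideal (K := K) a).
Local Notation Is := (initial_ideal I).
Implicit Types (m u v : 'X_{1..n.+1}).
Hypothesis a_pos : forall i, (0 < a i)%N.
Hypothesis a_gen : forall i m, wt m = a i -> m = U_(i)%MM.
Hypothesis a_inc : forall i j : 'I_n.+1, (i < j)%N -> (a i < a j)%N.
Hypothesis a_cof : exists N, forall h, (N <= h)%N -> exists m, wt m = h.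

Local Notation A := (\max_i a i)%N.

(** The weights of order exactly [D]; they index a monomial basis of the degree [D] part of the
    associated graded ring. The bound [A * D] makes the set finite. *)
Definition order_set D : {set 'I_(A * D).+1} :=
  [set w : 'I_(A * D).+1 | [exists m : 'X_{1..n.+1 < D.+1},
     [&& mdeg m == D, wt m == w & is_max_deg a m]]].

Lemma order_setP D (w : 'I_(A * D).+1) :
  reflect (exists m, [/\ mdeg m = D, wt m = w & is_max_deg a m]) (w \in order_set D).
Proof.
rewrite inE; apply: (iffP existsP) => [[m /and3P[/eqP md /eqP mw mm]]|[m [md mw mm]]].
  by exists m.
have lt : (mdeg m < D.+1)%N by rewrite md.
by exists (BMultinom lt); rewrite /= md mw mm !eqxx.
Qed.

Lemma wt_bound m : (wt m < (A * mdeg m).+1)%N.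
Proof. by rewrite ltnS; apply: wt_le => i; apply: leq_bigmax. Qed.

(** The functionals [deg_wt] for the weights in [order_set D] cut out the degree [D] part.
    Evaluating them at one monomial per weight shows their independence. *)
Lemma initial_ideal_strand D : exists U : {vspace dhomog n.+1 K D},
  (forall f, f \in U <-> Is (val f)) /\ (\dim U + #|order_set D|)%N = 'C(D + n, D).
Proof.
pose ow (i : 'I_#|order_set D|) : nat := (enum_val i : 'I_(A * D).+1).
pose psi (f : dhomog n.+1 K D) : 'rV[K]_#|order_set D| :=
  \row_i msum (deg_wt K a D (ow i)) (val f).
have psi_lin : linear psi.
  by move=> c f g; apply/rowP => i; rewrite !mxE /= linearP.
pose Psi : {linear _ -> _} := HB.pack psi (GRing.isLinear.Build K _ _ _ psi psi_lin).
have PsiE f : linfun Psi f = psi f by rewrite lfunE.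
exists (lker (linfun Psi)); split=> [f|].
  rewrite memv_ker PsiE; split=> [/eqP f0|If]; last first.
    apply/eqP/rowP => i; rewrite !mxE; apply: msum_initial_ideal If.
    have /order_setP[m [md mw /(is_max_degP a_pos)]] := enum_valP i.
    by rewrite md mw.
  apply/(initial_idealP a_pos) => d w dw.
  case: (classic (exists2 m, m \in msupp (val f) & (mdeg m == d) && (wt m == w))).
    case=> m mf /andP[/eqP md /eqP mw].
    have /= mD := dhomogP _ _ _ (valP f) _ mf.
    have mm : is_max_deg a m by apply/(is_max_degP a_pos); rewrite md mw.
    have mS : (wt m < (A * D).+1)%N by rewrite -mD wt_bound.
    have mo : Ordinal mS \in order_set D by apply/order_setP; exists m.
    have := congr1 (fun M : 'rV__ => M 0 (enum_rank_in mo (Ordinal mS))) f0.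
    have dD : d = D by rewrite -md mD.
    by rewrite !mxE /ow enum_rankK_in //= mw dD.
  move=> no; rewrite /msum big1_seq // => m /= mf.
  rewrite /deg_wt; case: (boolP (_ && _)) => [H|_]; last by rewrite mulr0.
  by case: no; exists m.
have -> : 'C(D + n, D) = \dim {: dhomog n.+1 K D} by rewrite dim_dhomog.
rewrite -(limg_ker_dim (linfun Psi) fullv) capfv; congr (_ + _)%N.
have -> : limg (linfun Psi) = fullv.
  apply/vspaceP => v; rewrite memvf; apply/memv_imgP.
  have [m mP] : exists m : 'I_#|order_set D| -> 'X_{1..n.+1}, forall i,
      mdeg (m i) = D /\ wt (m i) = ow i.
    apply: (@fin_all_exists _ _ (fun (i : 'I_#|order_set D|) m =>
      mdeg m = D /\ wt m = ow i)) => i.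
    by have /order_setP[m [md mw _]] := enum_valP i; exists m.
  have fD : \sum_i v 0 i *: 'X_[K, m i] \is D.-homog.
    by rewrite rpred_sum // => i _; rewrite rpredZ // dhomogX /= (mP i).1.
  exists (DHomog fD); rewrite ?memvf // PsiE; apply/rowP => i.
  rewrite mxE /= raddf_sum (bigD1 i) //= msumZX /deg_wt (mP i).1 (mP i).2 !eqxx mulr1.
  rewrite [X in _ + X]big1 ?addr0 // => j ji; rewrite msumZX (mP j).1 (mP j).2 eqxx /=.
  by rewrite /ow val_eqE (inj_eq enum_val_inj) (negbTE ji) mulr0.
by rewrite dimvf /= dim_matrix mul1r.
Qed.

(** Weights of order [D] are distinct modulo [e]: adding c e to a weight raises the order by at
    least c. *)
Lemma card_order_set_le D : (#|order_set D| <= e)%N.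
Proof.
pose f (w : 'I_(A * D).+1) : 'I_e := Ordinal (ltn_pmod w (a_pos ord0)).
suff inj : {in order_set D &, injective f}.
  by rewrite -(card_in_imset inj) (leq_trans (max_card _)) // card_ord.
suff W (w w' : 'I_(A * D).+1) : (w <= w')%N -> w \in order_set D -> w' \in order_set D ->
    f w = f w' -> w = w'.
  move=> w w' wD wD' E; case: (leqP w w') => [/W H|/ltnW/W H]; first exact: H.
  by apply/esym/H.
move=> le /order_setP[m [md mw _]] /order_setP[m' [md' mw' /(is_max_degP a_pos) mm]].
move=> [/eqP]; rewrite eq_sym eqn_mod_dvd // => /dvdnP[c E].
have : (mdeg (m + U_(ord0) *+ c)%MM <= mdeg m')%N.
  by apply: mm; rewrite wtD wtMn wtU mw mw' (mulnC e) -E subnKC.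
rewrite mdegD mdegMn mdeg1 md md' mul1n -{2}[D]addn0 leq_add2l leqn0 => /eqP c0.
by apply/val_inj/eqP; rewrite eqn_leq le -subn_eq0 E c0.
Qed.

Lemma max_deg_monomial m : exists v,
  [/\ wt v = wt m, is_max_deg a v & (mdeg m <= mdeg v)%N].
Proof.
have lt u : wt u = wt m -> (mdeg u < (wt m).+1)%N.
  by move=> <-; rewrite ltnS mdeg_le_wt.
pose P (u : 'X_{1..n.+1 < (wt m).+1}) := wt u == wt m.
have m0 : P (BMultinom (lt m erefl)) by exact/eqP.
have [v /eqP vw vmax] := @arg_maxnP _ _ P (fun u : 'X_{1..n.+1 < (wt m).+1} => mdeg u) m0.
exists v; split=> //; last exact: (vmax (BMultinom (lt m erefl))).
apply/(is_max_degP a_pos) => u uw; rewrite vw in uw.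
by apply: (vmax (BMultinom (lt u uw))); apply/eqP.
Qed.

(* Otherwise e copies of some x_i could be traded for a_i > e copies of x_0. *)
Lemma max_deg_ord0 v : is_max_deg a v -> (n * e < mdeg v)%N -> (0 < v ord0)%N.
Proof.
move=> /(is_max_degP a_pos) vmax; rewrite mdegE big_ord_recl.
case: (posnP (v ord0)) => // -> lt; move: lt; rewrite ltnNge add0n => /negP[].
rewrite -[n in (_ <= n * _)%N]card_ord -sum_nat_const leq_sum // => i _.
rewrite leqNgt; apply/negP => lt.
have uE : (U_(lift ord0 i) *+ e <= v)%MM.
  apply/mnm_lepP => j; rewrite mulmnE mnm1E; case: eqP => [<-|//].
  by rewrite mul1n ltnW.
have := vmax (v - U_(lift ord0 i) *+ e + U_(ord0) *+ a (lift ord0 i))%MM.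
rewrite -{2 4}(submK uE) !wtD !wtMn !wtU mulnC => /(_ erefl).
by rewrite !mdegD !mdegMn !mdeg1 !mul1n leq_add2l leqNgt gen_gt_mult.
Qed.

Lemma max_deg_subU0 v : is_max_deg a v -> (0 < v ord0)%N ->
  is_max_deg a (v - U_(ord0))%MM.
Proof.
move=> /(is_max_degP a_pos) vmax v0; apply/(is_max_degP a_pos) => u uw.
have vE : (U_(ord0) <= v)%MM by rewrite lep1mP -lt0n.
have vw : wt v = (wt (v - U_(ord0)) + e)%N by rewrite -{1}(submK vE) wtD wtU.
have vd : mdeg v = (mdeg (v - U_(ord0)) + 1)%N by rewrite -{1}(submK vE) mdegD mdeg1.
have := vmax (u + U_(ord0))%MM; rewrite wtD wtU uw -vw => /(_ erefl).
by rewrite mdegD mdeg1 vd leq_add2r.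
Qed.

(** Every residue class occurs: from a monomial of maximal degree in the class, factors x_0 are
    removed until the degree is [D]. They are available as long as the degree exceeds n e. *)
Lemma card_order_set D : (n * e < D)%N -> #|order_set D| = e.
Proof.
move=> ltD; apply/eqP; rewrite eqn_leq card_order_set_le /=.
pose f (w : 'I_(A * D).+1) : 'I_e := Ordinal (ltn_pmod w (a_pos ord0)).
have desc k v : is_max_deg a v -> mdeg v = (D + k)%N -> exists v',
    [/\ is_max_deg a v', mdeg v' = D & wt v' = wt v %[mod e]].
  elim: k v => [|k IH] v vm vd; first by exists v; rewrite vd addn0.
  have v0 : (0 < v ord0)%N by apply: max_deg_ord0 => //; rewrite vd ltn_addr.
  have vE : (U_(ord0) <= v)%MM by rewrite lep1mP -lt0n.
  have [||v' [v'm v'd v'w]] := IH (v - U_(ord0))%MM; first exact: max_deg_subU0.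
    by have := vd; rewrite -{1}(submK vE) mdegD mdeg1; lia.
  exists v'; split=> //; rewrite v'w -[in RHS](submK vE) wtD wtU.
  by rewrite -[X in (_ + X)%N]mul1n addnC modnMDl.
rewrite -[e in (e <= _)%N]card_ord.
apply: leq_trans (leq_imset_card f (order_set D)).
apply/subset_leq_card/subsetP => x _.
have [N HN] := a_cof; have [|m mw] := HN (N * e + x)%N.
  by rewrite (leq_trans (leq_pmulr N (a_pos ord0))) // leq_addr.
have [v [vw vm vd]] := max_deg_monomial (m + U_(ord0) *+ D)%MM.
have [|v' [v'm v'd v'w]] := desc (mdeg v - D)%N v vm.
  rewrite subnKC //; apply: leq_trans vd.
  by rewrite mdegD mdegMn mdeg1 mul1n leq_addl.
apply/imsetP; have vS : (wt v' < (A * D).+1)%N by rewrite -v'd wt_bound.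
exists (Ordinal vS); first by apply/order_setP; exists v'.
apply: val_inj => /=; rewrite v'w vw wtD wtMn wtU mw addnC (mulnC e) modnMDl.
by rewrite modnMDl modn_small.
Qed.

Lemma card_order_set1 : (#|order_set 1| <= n.+1)%N.
Proof.
have aS i : (a i < (A * 1).+1)%N by rewrite muln1 ltnS; apply: leq_bigmax.
have := leq_imset_card (fun i => Ordinal (aS i)) setT.
rewrite cardsT card_ord; apply: leq_trans.
apply/subset_leq_card/subsetP => w /order_setP[m [/eqP/mdeg1P[i /eqP->] wE _]].
by apply/imsetP; exists i => //; apply: val_inj; rewrite /= -wE wtU.
Qed.

(** [linear_resolution_bound] at [t = 2] compares the eventual value [e] of the Hilbert function
    with its value in degree 1. A square form is the required nonzero quadric. *)
Lemma linear_resolution_mult_le :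
  (0 < n)%N -> quadratic_ideal Is -> has_linear_resolution Is -> (e <= n.+1)%N.
Proof.
move=> n0 Is_quad lin; apply: leq_trans card_order_set1.
pose i : 'I_n.+1 := lift ord0 (Ordinal n0).
have [r [rw rd rn]] := quadratic_square a_inc Is_quad (i := i) isT.
pose R (_ : 'I_n.+1) := r.
have fI : Is (square_form K R i).
  rewrite /square_form; case: eqP => [r2|/eqP r2].
    by apply: initial_ideal_binom; rewrite ?wtMn ?wtU ?rw // mdegMn mdeg1 r2.
  rewrite subr0; apply: (@initial_ideal_mono _ _ _ _ r).
    by rewrite wtMn wtU rw.
  by rewrite mdegMn mdeg1 mul1n ltn_neqAle eq_sym r2 rd.
apply: (linear_resolution_bound lin (t := 2) (r := fun D => #|order_set D|)
  (D0 := (n * e).+1) isT fI).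
- apply/eqP => /(congr1 (mcoeff (U_(i) *+ 2)%MM)) /eqP.
  rewrite /square_form mcoeff0 mcoeffB mcoeffX eqxx; case: ifP => _.
    by rewrite mcoeffX /R (negbTE rn) subr0 oner_eq0.
  by rewrite mcoeff0 subr0 oner_eq0.
- exact: square_form_homog.
- by move=> f m; apply: initial_ideal_mdeg.
- exact: initial_ideal_strand.
- by move=> D; apply: card_order_set.
Qed.

End HilbertFunction.

(** * A linear resolution when [e] equals the embedding dimension *)

Section MaximalEmbeddingDimension.
Context (K : fieldType) (n : nat) (a : 'I_n.+1 -> nat).
Local Notation S := {mpoly K[n.+1]}.
Local Notation wt := (weight a).
Local Notation e := (a ord0).
Local Notation I := (sg_ideal (K := K) a).
Local Notation Is := (initial_ideal I).
Implicit Types (m u v : 'X_{1..n.+1}) (i j : 'I_n.+1).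
Hypothesis a_pos : forall i, (0 < a i)%N.
Hypothesis a_gen : forall i m, wt m = a i -> m = U_(i)%MM.
Hypothesis a_inc : forall i j : 'I_n.+1, (i < j)%N -> (a i < a j)%N.
Hypothesis e_max : e = n.+1.

Definition off_degree m : nat := (\sum_(i | i != ord0) m i)%N.

Lemma off_degreeD u v : off_degree (u + v)%MM = (off_degree u + off_degree v)%N.
Proof. by rewrite /off_degree -big_split; apply: eq_bigr => i _; rewrite mnmDE. Qed.

Lemma off_degreeU i : off_degree U_(i)%MM = (i != ord0).
Proof.
rewrite /off_degree; case: (boolP (i == ord0)) => [/eqP->|i0].
  by rewrite big1 // => j; rewrite mnm1E eq_sym => /negbTE->.
rewrite (bigD1 i) //= mnm1E eqxx big1 // => j /andP[_ ji].
by rewrite mnm1E eq_sym (negbTE ji).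
Qed.

Lemma off_degreeU0 c : off_degree (U_(ord0) *+ c)%MM = 0%N.
Proof.
by rewrite /off_degree big1 // => j; rewrite mulmnE mnm1E eq_sym => /negbTE->.
Qed.

Lemma residue_generator h : exists k, a k = h %[mod e].
Proof.
pose f i : 'I_e := Ordinal (ltn_pmod (a i) (a_pos ord0)).
have f_inj : injective f by move=> i j [/(generators_distinct_mod a_gen a_inc)].
have [g _ gK] : bijective f by apply: inj_card_bij f_inj _; rewrite !card_ord e_max.
exists (g (Ordinal (ltn_pmod h (a_pos ord0)))).
by have := congr1 val (gK (Ordinal (ltn_pmod h (a_pos ord0)))).
Qed.

(** As [e] generators fill all residues, some a_k is congruent to a_i + a_j. It must be smaller,
    since otherwise a_k would decompose; so x_k times a positive power of x_0 has the right
    weight. *)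
Lemma product_rule i j : i != ord0 -> j != ord0 ->
  exists t, [/\ wt t = (a i + a j)%N, (2 <= mdeg t)%N & (off_degree t <= 1)%N].
Proof.
move=> i0 j0; have [k kE] := residue_generator (a i + a j).
have [le|lt] := leqP (a i + a j)%N (a k).
  move/eqP: kE; rewrite eqn_mod_dvd // => /dvdnP[c cE].
  have : wt (U_(i) + U_(j) + U_(ord0) *+ c)%MM = a k.
    by rewrite !wtD wtMn !wtU mulnC -cE subnKC.
  by move/a_gen/(congr1 (@mdeg _)); rewrite !mdegD !mdeg1 mdegMn mdeg1; lia.
move/esym/eqP: kE; rewrite eqn_mod_dvd ?(ltnW lt) // => /dvdnP[c cE].
have c0 : (0 < c)%N by case: c cE => //; rewrite mul0n; lia.
exists (U_(k) + U_(ord0) *+ c)%MM; split.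
- by rewrite wtD wtMn !wtU mulnC -cE subnKC // ltnW.
- by rewrite mdegD mdegMn !mdeg1; lia.
- by rewrite off_degreeD off_degreeU0 off_degreeU addn0 leq_b1.
Qed.

(** The extra factor x_0 lets the shapes x_0^c and x_0^c x_k be written uniformly, with [k] equal to
    [ord0] in the first case. *)
Lemma off_degree_normal m : (off_degree m <= 1)%N ->
  exists c k, (m + U_(ord0))%MM = (U_(ord0) *+ c + U_(k))%MM.
Proof.
move=> m1.
have off0 u : off_degree u = 0%N -> u = (U_(ord0) *+ u ord0)%MM.
  move=> u0; apply/mnmP => l; rewrite mulmnE mnm1E.
  have [<-|l0] := eqVneq ord0 l; first by rewrite mul1n.
  move/eqP: u0; rewrite sum_nat_eq0 => /forallP/(_ l).
  by rewrite eq_sym l0 => /eqP->.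
case: (posnP (off_degree m)) => [/off0 mE|m0].
  by exists (m ord0), ord0; rewrite {1}mE.
have [i i0 mi] : exists2 i, i != ord0 & m i != 0%N.
  apply/exists_inP; apply: contraTT m0 => /exists_inPn no.
  by rewrite -leqNgt leqn0 sum_nat_eq0; apply/forall_inP => i /no; rewrite negbK.
rewrite -lep1mP in mi; exists (m ord0).+1, i.
have /off0 E : off_degree (m - U_(i))%MM = 0%N.
  by have := m1; rewrite -{1}(submK mi) off_degreeD off_degreeU i0; lia.
rewrite -{1}(submK mi) {1}E mnmBE mnm1E (negbTE i0) subn0 mulmSr.
by rewrite -!addmA (addmC U_(i)%MM).
Qed.

Lemma normal_wt_inj u v : (off_degree u <= 1)%N -> (off_degree v <= 1)%N ->
  wt u = wt v -> u = v.
Proof.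
move=> /off_degree_normal[c [k uE]] /off_degree_normal[d [l vE]] E.
have := congr1 wt uE; have := congr1 wt vE; rewrite !wtD !wtMn !wtU E => -> E'.
have kl : k = l.
  apply: (generators_distinct_mod a_gen a_inc).
  by have := congr1 (modn^~ e) E'; rewrite !(mulnC e) !modnMDl.
apply: (@addIm _ U_(ord0)%MM); rewrite uE vE -kl; congr (_ *+ _ + _)%MM.
move: E'; rewrite kl => /eqP; rewrite eqn_add2r eqn_pmul2l // => /eqP->//.
Qed.

(** [i] and [j] are the two largest variables of [m], so the cofactor uses only variables up to [i].
    This is the class of the pair. *)
Lemma off_degree_split m : (2 <= off_degree m)%N -> exists i j u,
  [/\ m = (u + (U_(i) + U_(j)))%MM, i != ord0, (i <= j)%N &
      forall l : 'I_n.+1, (i < l)%N -> u l = 0%N].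
Proof.
have top v : (1 <= off_degree v)%N -> exists i,
    [/\ (U_(i) <= v)%MM, i != ord0 & forall l : 'I_n.+1, (i < l)%N -> v l = 0%N].
  move=> v0; have [i0 i00 vi0] : exists2 i, i != ord0 & v i != 0%N.
    apply/exists_inP; apply: contraTT v0 => /exists_inPn no.
    by rewrite -leqNgt leqn0 sum_nat_eq0; apply/forall_inP => i /no; rewrite negbK.
  pose P i := v i != 0%N.
  have [i vi imax] := @arg_maxnP _ i0 P (fun i => nat_of_ord i) vi0.
  exists i; split; first by rewrite lep1mP.
    rewrite -val_eqE /= -lt0n; apply: leq_trans (imax _ vi0).
    by rewrite lt0n.
  move=> l il; apply/eqP; apply: contraT => /(imax l) /=.
  by rewrite leqNgt il.
move=> m2; have [j [jm j0 jtop]] := top m (ltnW m2).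
have [i [im i0 itop]] : exists i, [/\ (U_(i) <= m - U_(j))%MM, i != ord0 &
    forall l : 'I_n.+1, (i < l)%N -> (m - U_(j))%MM l = 0%N].
  apply: top; have := m2; rewrite -{1}(submK jm) off_degreeD off_degreeU j0; lia.
exists i, j, (m - U_(j) - U_(i))%MM; split=> //.
- by rewrite addmA !submK.
- rewrite leqNgt; apply/negP => ji; move: im; rewrite lep1mP mnmBE.
  by rewrite (jtop i ji).
- by move=> l il; rewrite mnmBE itop.
Qed.

Lemma off_degree_split_inj i j u i' j' u' :
  (i <= j)%N -> (i' <= j')%N ->
  (forall l : 'I_n.+1, (i < l)%N -> u l = 0%N) ->
  (forall l : 'I_n.+1, (i' < l)%N -> u' l = 0%N) ->
  (u + (U_(i) + U_(j)))%MM = (u' + (U_(i') + U_(j')))%MM -> i = i' /\ j = j'.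
Proof.
move=> ij ij' ui ui' E.
have coord l : (u l + ((i == l) + (j == l)) = u' l + ((i' == l) + (j' == l)))%N.
  by have := congr1 (fun m : 'X_{1..n.+1} => m l) E; rewrite !mnmDE !mnm1E.
have jj : j = j'.
  apply/val_inj/eqP; rewrite eqn_leq; apply/andP; split; rewrite leqNgt; apply/negP => lt.
    have := coord j; rewrite eqxx ui'; last by apply: leq_ltn_trans lt.
    have -> : (i' == j) = false by rewrite -val_eqE; apply: ltn_eqF (leq_ltn_trans ij' lt).
    have -> : (j' == j) = false by rewrite -val_eqE; apply: ltn_eqF lt.
    by lia.
  have := coord j'; rewrite eqxx ui; last by apply: leq_ltn_trans lt.
  have -> : (i == j') = false by rewrite -val_eqE; apply: ltn_eqF (leq_ltn_trans ij lt).
  have -> : (j == j') = false by rewrite -val_eqE; apply: ltn_eqF lt.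
  by lia.
split=> //; subst j'; apply/val_inj/eqP; rewrite eqn_leq; apply/andP.
split; rewrite leqNgt; apply/negP => lt.
  have := coord i; rewrite eqxx ui' //.
  have -> : (i' == i) = false by rewrite -val_eqE; apply: ltn_eqF lt.
  by lia.
have := coord i'; rewrite eqxx ui //.
have -> : (i == i') = false by rewrite -val_eqE; apply: ltn_eqF lt.
by lia.
Qed.

Context (t : 'I_n.+1 * 'I_n.+1 -> 'X_{1..n.+1}).
Local Notation T := [set x : 'I_n.+1 * 'I_n.+1 | (x.1 != ord0) && (x.1 <= x.2)%N].
Hypothesis t_wt : forall x, x \in T -> wt (t x) = (a x.1 + a x.2)%N.
Hypothesis t_deg : forall x, x \in T -> (2 <= mdeg (t x))%N.
Hypothesis t_off : forall x, x \in T -> (off_degree (t x) <= 1)%N.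

Definition tail_form x : S := if mdeg (t x) == 2 then 'X_[t x] else 0.

Definition pair_form x : S := 'X_[U_(x.1) + U_(x.2)] - tail_form x.

Lemma pair_form_in x : x \in T -> Is (pair_form x).
Proof.
move=> xT; rewrite /pair_form /tail_form; case: eqP => [x2|/eqP x2].
  by apply: initial_ideal_binom; rewrite ?mdegD ?mdeg1 ?x2 // wtD !wtU t_wt.
rewrite subr0; apply: (@initial_ideal_mono _ _ _ _ (t x)).
  by rewrite wtD !wtU t_wt.
by rewrite mdegD !mdeg1 ltn_neqAle eq_sym x2 t_deg.
Qed.

Lemma pair_form_homog x : pair_form x \is 2.-homog.
Proof.
rewrite /pair_form /tail_form rpredB ?dhomogX /= ?mdegD ?mdeg1 //.
by case: eqP => x2; rewrite ?dhomogX /= ?x2 ?rpred0.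
Qed.

Lemma off_degree_top m : exists v,
  [/\ (off_degree v <= 1)%N, wt v = wt m & (mdeg m <= mdeg v)%N].
Proof.
have [k] := ubnP (off_degree m); elim: k m => // k IH m; rewrite ltnS => mk.
case: (leqP (off_degree m) 1) => [m1|]; first by exists m.
case/off_degree_split => i [j [u [mE i0 ij _]]].
have xT : (i, j) \in T by rewrite inE /= i0.
have j0 : j != ord0 by move: i0; rewrite -!val_eqE /=; lia.
have [|v [v1 vw vd]] := IH (u + t (i, j))%MM.
  apply: leq_trans mk; rewrite mE !off_degreeD !off_degreeU i0 j0.
  by have := t_off xT; lia.
exists v; split=> //; first by rewrite vw mE !wtD t_wt // !wtU.
by apply: leq_trans vd; rewrite mE !mdegD !mdeg1 leq_add2l t_deg.
Qed.

(** Monomials of off-degree at most 1 have distinct weights and maximal degree for their weight, so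
    each coefficient is a functional vanishing on the initial ideal. *)
Lemma initial_ideal_normal f : Is f ->
  (forall m, m \in msupp f -> (off_degree m <= 1)%N) -> f = 0.
Proof.
move=> If fn; apply: msuppnil0; case E: (msupp f) => [//|m l].
have mf : m \in msupp f by rewrite E mem_head.
have top : max_deg a (mdeg m) (wt m).
  move=> v vw; have [v' [v'1 v'w v'd]] := off_degree_top v.
  suff -> : m = v' by [].
  by apply: normal_wt_inj => //; [apply: fn|rewrite v'w vw].
have := mf; rewrite mcoeff_msupp mcoeff_msum.
rewrite -[X in _ != X](msum_initial_ideal top If).
rewrite (@eq_msum _ _ _ (deg_wt K a (mdeg m) (wt m))) ?eqxx // => u uf.
congr (nat_of_bool _)%:R; apply/eqP/andP => [->//|[_ /eqP uw]].
by apply: normal_wt_inj => //; apply: fn.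
Qed.

Definition pair_class (x : 'I_#|T|) : nat := (enum_val x).1.

Definition pair_mx : 'M[S]_(#|T|, 1) := \matrix_(x, _) pair_form (enum_val x).

(** Division by the pair forms: the two largest variables are split off, and the tail has smaller
    off-degree. *)
Lemma pair_reduce f0 : exists p : 'rV[S]_#|T|,
  (forall x, in_first (pair_class x) (p 0 x)) /\
  (forall m, m \in msupp (f0 - (p *m pair_mx) 0 0) -> (off_degree m <= 1)%N).
Proof.
pose red f := exists p : 'rV[S]_#|T|,
  (forall x, in_first (pair_class x) (p 0 x)) /\
  (forall m, m \in msupp (f - (p *m pair_mx) 0 0) -> (off_degree m <= 1)%N).
have redD f g : red f -> red g -> red (f + g).
  move=> [p [pf pn]] [q [qf qn]]; exists (p + q); split=> [x l xl|m].
    by rewrite mxE; apply: deg_in_leD; [apply: pf|apply: qf].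
  rewrite mulmxDl mxE opprD addrACA => /msuppD_le; rewrite mem_cat.
  by case/orP => [/pn|/qn].
have redZ c f : red f -> red (c *: f).
  move=> [p [pf pn]]; exists (map_mx ( *:%R c) p); split=> [x l xl|m].
    by rewrite mxE; apply: deg_in_leZ; apply: pf.
  have -> : (map_mx ( *:%R c) p *m pair_mx) 0 0 = c *: (p *m pair_mx) 0 0.
    by rewrite !mxE scaler_sumr; apply: eq_bigr => x _; rewrite mxE scalerAl.
  by rewrite -scalerBr => /msuppZ_le/pn.
suff redX m : red 'X_[m].
  rewrite -/(red f0) [f0]mpolyE; elim/big_ind: _ => //.
    exists 0; split=> [x l _|m]; first by rewrite mxE; apply: deg_in_le0.
    by rewrite mul0mx mxE subr0 msupp0.
  by move=> m _; apply: redZ.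
have [k] := ubnP (off_degree m); elim: k m => // k IH m; rewrite ltnS => mk.
case: (leqP (off_degree m) 1) => [m1|].
  exists 0; split=> [x l _|u]; first by rewrite mxE; apply: deg_in_le0.
  by rewrite mul0mx mxE subr0 msuppX inE => /eqP->.
case/off_degree_split => i [j [u [mE i0 ij utop]]].
have xT : (i, j) \in T by rewrite inE /= i0.
have j0 : j != ord0 by move: i0; rewrite -!val_eqE /=; lia.
have -> : 'X_[K, m] = 'X_[u] * pair_form (i, j) + 'X_[u] * tail_form (i, j).
  by rewrite -mulrDr /pair_form subrK -mpolyXD mE.
apply: redD; last first.
  rewrite /tail_form; case: ifP => _; last first.
    rewrite mulr0; exists 0; split=> [x l _|v]; first by rewrite mxE; apply: deg_in_le0.
    by rewrite mul0mx mxE subr0 msupp0.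
  rewrite -mpolyXD; apply: IH; apply: leq_trans mk.
  by rewrite mE !off_degreeD !off_degreeU i0 j0; have := t_off xT; lia.
exists ('X_[u] *: delta_mx 0 (enum_rank_in xT (i, j))); split=> [x l xl|v].
  rewrite !mxE eqxx /=; case: eqP => [E|_]; last by rewrite mulr0; apply: deg_in_le0.
  rewrite mulr1; apply: (deg_in_leW _ (deg_in_leX _ _)).
  by rewrite utop //; move: xl; rewrite /pair_class E enum_rankK_in.
by rewrite -scalemxAl -rowE !mxE enum_rankK_in // subrr msupp0.
Qed.

Lemma initial_ideal_pair f : Is f -> exists p : 'rV[S]_#|T|,
  (forall x, in_first (pair_class x) (p 0 x)) /\ f = (p *m pair_mx) 0 0.
Proof.
move=> If; have [p [pf pn]] := pair_reduce f; exists p; split=> //.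
apply/eqP; rewrite -subr_eq0; apply/eqP; apply: initial_ideal_normal pn.
apply: ideal_genB => //; rewrite mxE; apply: ideal_gen_sum => x _.
by apply: ideal_genM; rewrite mxE; apply: pair_form_in; apply: enum_valP.
Qed.

(** The product lies in the initial ideal, hence division leaves no remainder. Comparing degree 3
    parts leaves linear coefficients. *)
Lemma pair_mx_linear : linear_rep pair_class pair_mx.
Proof.
move=> x j xj.
have xI : Is ('X_j * pair_form (enum_val x)).
  by apply: ideal_genM; apply: pair_form_in; apply: enum_valP.
have [p [pf pE]] := initial_ideal_pair xI.
exists (map_mx (pihomog mdeg 1) p); split=> [y|].
  rewrite mxE pihomogP; split=> // l yl; apply: deg_in_le_pihomog.
  exact: pf.
apply/rowP => z; rewrite ord1 !mxE.
rewrite -[LHS](@pihomog_dE _ _ mdeg 3); last first.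
  by apply: (dhomogM (d := 1) (e := 2)); rewrite ?pair_form_homog ?dhomogX /= ?mdeg1.
rewrite pE mxE raddf_sum; apply: eq_bigr => y _ /=.
by rewrite (@pihomogMl _ _ 1 2) ?mxE // pair_form_homog.
Qed.

(** Let u be a monomial of largest off-degree in a coefficient. Then u x_i x_j cannot be cancelled:
    tails have too small an off-degree, and the splitting into u, i and j is unique. *)
Lemma pair_mx_free : free_rep pair_class pair_mx.
Proof.
move=> p pf p0.
suff small D : (forall x u, u \in msupp (p 0 x) -> (off_degree u < D)%N) -> p = 0.
  apply: (small (\max_x (msize (p 0%R x)).+1)%N) => x u ux.
  apply: (@leq_trans (msize (p 0 x)).+1); last first.
    exact: (leq_bigmax (F := fun x => (msize (p 0 x)).+1) x).
  rewrite ltnS; apply: leq_trans (ltnW (msize_mdeg_lt ux)).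
  by rewrite mdegE [in leqRHS](bigD1 ord0) //= leq_addl.
elim: D => [|D IH] pD.
  apply/rowP => x; rewrite mxE; apply: msuppnil0; case E: (msupp _) => [//|u l].
  by have := pD x u; rewrite E mem_head => /(_ isT).
apply: IH => x u ux; rewrite ltn_neqAle -ltnS (pD x u ux) andbT; apply/eqP => uD.
move xE: (enum_val x) (enum_valP x) => [i j] xT.
have /andP[/= i0 ij] : (i != ord0) && (i <= j)%N by move: xT; rewrite inE.
have j0 : j != ord0 by move: i0; rewrite -!val_eqE /=; lia.
pose m := (u + (U_(i) + U_(j)))%MM.
have utop (l : 'I_n.+1) : (i < l)%N -> u l = 0%N.
  move=> il; apply/eqP; rewrite -leqn0; apply: (pf x l _ _ ux).
  by rewrite /pair_class xE.
have m_off : off_degree m = D.+2.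
  by rewrite /m !off_degreeD !off_degreeU i0 j0 uD; lia.
have := congr1 (fun M : 'rV_1 => (M 0 0)@_m) p0; rewrite !mxE mcoeff0 raddf_sum /=.
rewrite (bigD1 x) //= big1 ?addr0 => [|y yx].
  rewrite mxE /pair_form xE /= mulrBr mcoeffB.
  have -> : (p 0 x * 'X_[U_(i) + U_(j)])@_m = (p 0 x)@_u by rewrite /m addmC mcoeffMX.
  rewrite [X in _ - X]memN_msupp_eq0 ?subr0.
    by apply/eqP; rewrite -mcoeff_msupp.
  apply/negP => /msuppM_le/allpairsP[/= [v s] [/= vx ss mE]].
  have := m_off; rewrite mE off_degreeD => E.
  have := pD x v vx; suff : (off_degree s <= 1)%N by lia.
  move: ss; rewrite /tail_form; case: ifP => _; last by rewrite msupp0.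
  by rewrite msuppX inE => /eqP->; apply: t_off.
rewrite mxE /pair_form mulrBr mcoeffB.
move yE: (enum_val y) (enum_valP y) => [i' j'] yT.
have /andP[/= i0' ij'] : (i' != ord0) && (i' <= j')%N by move: yT; rewrite inE.
rewrite !memN_msupp_eq0 ?subr0 //; apply/negP => /msuppM_le/allpairsP[/= [v s] [/= vy ss mE]].
  have := m_off; rewrite mE off_degreeD => E.
  have := pD y v vy; suff : (off_degree s <= 1)%N by lia.
  move: ss; rewrite /tail_form; case: ifP => _; last by rewrite msupp0.
  by rewrite msuppX inE => /eqP->; apply: t_off.
move: ss mE; rewrite msuppX inE => /eqP-> mE.
have [|ii jj] := off_degree_split_inj ij ij' utop _ mE.
  move=> l il; apply/eqP; rewrite -leqn0; apply: (pf y l _ _ vy).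
  by rewrite /pair_class yE.
by case/negP: yx; apply/eqP/enum_val_inj; rewrite xE yE ii jj.
Qed.

Lemma maximal_embdim_resolution : has_linear_resolution Is.
Proof.
have [B [F0 [F [[F0h Fh] [l Bl] E0 E1 E2]]]] :=
  linear_resolution_of (m := n.+1) pair_mx_free pair_mx_linear (fun x => leq_addl _ _).
pose b k := if k is k'.+1 then B k' else #|T|.
pose G k : 'M[S]_(b k.+1, b k) := match k with 0%N => F0 | k'.+1 => F k' end.
exists 2, b, pair_mx, G; split; last split; last split; last split; last split.
- by move=> x; rewrite mxE; apply: pair_form_homog.
- by move=> [|k] x y; [apply: F0h|apply: Fh].
- by exists l.+1.
- move=> h; split=> [/initial_ideal_pair[p [_ ->]]|[p ->]]; first by exists p.
  rewrite mxE; apply: ideal_gen_sum => x _; apply: ideal_genM.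
  by rewrite mxE; apply: pair_form_in; apply: enum_valP.
- exact: E0.
- by move=> [|k] v; [apply: E1|apply: E2].
Qed.

End MaximalEmbeddingDimension.

(** * Complete intersections *)

Section CompleteIntersection.
Context (K : fieldType) (n : nat) (a : 'I_n.+1 -> nat).
Local Notation S := {mpoly K[n.+1]}.
Local Notation wt := (weight a).
Local Notation I := (sg_ideal (K := K) a).
Local Notation Is := (initial_ideal I).
Hypothesis n_pos : (0 < n)%N.
Hypothesis a_pos : forall i, (0 < a i)%N.
Hypothesis a_gen : forall i m, wt m = a i -> m = U_(i)%MM.
Hypothesis a_inc : forall i j : 'I_n.+1, (i < j)%N -> (a i < a j)%N.
Hypothesis a_cof : exists N, forall h, (N <= h)%N -> exists m, wt m = h.
Hypothesis Is_quad : quadratic_ideal Is.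
Context (r : 'I_n.+1 -> 'X_{1..n.+1}).
Hypothesis r_wt : forall i, i != ord0 -> wt (r i) = (a i * 2)%N.
Hypothesis r_deg : forall i, i != ord0 -> (2 <= mdeg (r i))%N.
Hypothesis r_ne : forall i, i != ord0 -> r i != (U_(i) *+ 2)%MM.

Lemma ideal_height_n (J : S -> Prop) : J = I \/ J = Is -> ideal_height J n.
Proof. by case=> ->; [apply: sg_ideal_height|apply: initial_ideal_height]. Qed.

(** Since the height is [n], there are exactly [n] generators, so the square forms span the quadrics
    and confluence separates the standard monomials. *)
Lemma complete_intersection_mult (J : S -> Prop) : J = I \/ J = Is ->
  complete_intersection J -> a ord0 = (2 ^ n)%N.
Proof.
move=> JI [k [[[g Jg] _] Jk]].
have nk := ideal_height_uniq (ideal_height_n JI) Jk.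
have [_ /(_ nk) span] := num_gens_ge a_pos a_gen a_inc r_wt r_deg r_ne JI Jg.
have Is_gen := quadric_span_generated Is_quad r_wt r_deg span.
apply/eqP; rewrite eqn_leq (mult_le_pow2 a_pos a_inc K r_wt r_deg r_ne a_cof).
have sep := complete_intersection_separated a_inc r_wt r_ne Is_gen.
exact: separated_mult_ge a_pos sep.
Qed.

(** The [n] generators are the rule binomials for the toric ideal and the square forms for its
    initial ideal; [num_gens_ge] shows that fewer do not suffice. *)
Lemma mult_complete_intersection (J : S -> Prop) : J = I \/ J = Is ->
  a ord0 = (2 ^ n)%N -> complete_intersection J.
Proof.
move=> JI e2; exists n; split; last exact: ideal_height_n.
have sep := mult_pow2_separated a_pos a_inc K r_wt r_deg r_ne a_cof e2.
split; last first.
  by move=> k [g Jg]; have [] := num_gens_ge a_pos a_gen a_inc r_wt r_deg r_ne JI Jg.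
case: JI => ->; last first.
  exists (fun i => square_form K r (lift ord0 i)).
  apply: quadric_span_generated => //.
  exact: (separated_quadric_span a_pos a_inc r_wt r_deg r_ne sep).
exists (fun i => rule_binom K r (lift ord0 i)) => f; split; last first.
  have [I0 [ID IM]] := sg_ideal_is_ideal K a.
  move=> [k [p [g [gP ->]]]]; elim/big_ind: _ => // i _; apply: IM.
  have [j ->] := gP i.
  by apply: sg_ideal_binom; rewrite wtMn wtU r_wt.
move/(separated_rule_ideal a_pos a_inc r_wt r_deg r_ne sep).
apply: ideal_gen_sub => _ [i i0 ->]; apply: ideal_gen_in.
by case: (unliftP ord0 i) i0 => [j ->|->]; [exists j|rewrite eqxx].
Qed.

End CompleteIntersection.

(* G(H) = {a_1 < ... < a_n}, e = e(H) = min G(H). *)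
Theorem theorem1p1 (K : fieldType) (H : nat -> Prop) (n : nat)
  (a : 'I_n -> nat) (e : nat) :
  numerical_semigroup H ->
  minimal_generating_set H (fun x => exists i, a i = x) ->
  (forall i j : 'I_n, (i < j)%N -> (a i < a j)%N) ->
  (exists i, a i = e) -> (forall i, (e <= a i)%N) ->
  (1 < n)%N ->
  quadratic_ideal (initial_ideal (sg_ideal (K := K) a)) ->
  [/\ (n <= e <= 2 ^ n.-1)%N,
      (e = n <-> has_linear_resolution (initial_ideal (sg_ideal (K := K) a))) &
      ((e = 2 ^ n.-1)%N <->
         complete_intersection (initial_ideal (sg_ideal (K := K) a))) /\
      (complete_intersection (initial_ideal (sg_ideal (K := K) a)) <->
         complete_intersection (sg_ideal (K := K) a))].
Proof.
case: n a => [//|n] a Hsg Hmin a_inc [i1 ei1] e_min n_pos Is_quad.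
have eE : e = a ord0.
  have [->|i0] := eqVneq ord0 i1; first by rewrite ei1.
  have lt : ((ord0 : 'I_n.+1) < i1)%N by rewrite lt0n eq_sym.
  by have := a_inc _ _ lt; rewrite ei1 ltnNge e_min.
rewrite ltnS in n_pos; rewrite {}eE /=.
have a_inj := gen_inj a_inc.
have a_pos := generator_pos Hmin a_inj.
have a_gen := wt_generator Hmin a_inj.
have a_cof := wt_cofinite Hsg Hmin.
have [r rP] : exists r : 'I_n.+1 -> 'X_{1..n.+1}, forall i, i != ord0 ->
    [/\ weight a (r i) = (a i * 2)%N, (2 <= mdeg (r i))%N & r i != (U_(i) *+ 2)%MM].
  apply: (@fin_all_exists _ _ (fun i m => i != ord0 ->
    [/\ weight a m = (a i * 2)%N, (2 <= mdeg m)%N & m != (U_(i) *+ 2)%MM])) => i.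
  (* No rule rewrites x_0; its value is a dummy. *)
  have [->|i0] := eqVneq i ord0; first by exists 0%MM.
  by have [m mP] := quadratic_square a_inc Is_quad i0; exists m.
have r_wt i : i != ord0 -> weight a (r i) = (a i * 2)%N by case/rP.
have r_deg i : i != ord0 -> (2 <= mdeg (r i))%N by case/rP.
have r_ne i : i != ord0 -> r i != (U_(i) *+ 2)%MM by case/rP.
have ci2 J := @complete_intersection_mult K n a n_pos a_pos a_gen a_inc a_cof
  Is_quad r r_wt r_deg r_ne J.
have mci J := @mult_complete_intersection K n a n_pos a_pos a_gen a_inc a_cof
  Is_quad r r_wt r_deg r_ne J.
split.
- by rewrite (embdim_le_mult a_pos a_gen a_inc) (mult_le_pow2 a_pos a_inc K r_wt r_deg r_ne a_cof).
- split=> [e_max|lin]; last first.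
    apply/eqP; rewrite eqn_leq (embdim_le_mult a_pos a_gen a_inc) andbT.
    exact: (linear_resolution_mult_le a_pos a_gen a_inc a_cof n_pos Is_quad lin).
  have [t tP] : exists t : 'I_n.+1 * 'I_n.+1 -> 'X_{1..n.+1}, forall x,
      x.1 != ord0 -> x.2 != ord0 ->
      [/\ weight a (t x) = (a x.1 + a x.2)%N, (2 <= mdeg (t x))%N & (off_degree (t x) <= 1)%N].
    apply: (@fin_all_exists _ _ (fun (x : 'I_n.+1 * 'I_n.+1) m =>
      x.1 != ord0 -> x.2 != ord0 ->
      [/\ weight a m = (a x.1 + a x.2)%N, (2 <= mdeg m)%N & (off_degree m <= 1)%N])) => x.
    have [->|x1] := eqVneq x.1 ord0; first by exists 0%MM.
    have [->|x2] := eqVneq x.2 ord0; first by exists 0%MM.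
    by have [m mP] := product_rule a_pos a_gen a_inc e_max x1 x2; exists m.
  have {}tP x : x \in [set x : 'I_n.+1 * 'I_n.+1 | (x.1 != ord0) && (x.1 <= x.2)%N] ->
      [/\ weight a (t x) = (a x.1 + a x.2)%N, (2 <= mdeg (t x))%N & (off_degree (t x) <= 1)%N].
    rewrite inE => /andP[x1 x12]; apply: tP => //.
    by move: x1; rewrite -!val_eqE /=; lia.
  by apply: (@maximal_embdim_resolution K n a a_pos a_gen a_inc e_max t) => x /tP[].
- split; first by split=> [/mci|]; [apply; right|apply: ci2; right].
  split=> ci; apply: mci; [by left| |by right|].
    by apply: ci2 ci; right.
  by apply: ci2 ci; left.
Qed.
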